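(* Let $(W,S)$ be a finite rank, irreducible, infinite Coxeter system. Then $W$ is affine if and only if the poset $\overline{W}$ (elements of $W$ and infinite reduced words, under the weak order) admits finitely many maximal elements.
   Context: Finite rank means $S$ is finite; affine means that $(W,S)$ is the Coxeter system of an (irreducible) affine Weyl group. $\Phi$ is the root system of $(W,S)$ (in the standard reflection representation), $\Phi^+$ and $\Phi^-=-\Phi^+$ the sets of positive and negative roots. For $w\in W$ put $\Phi_w=\{\alpha\in\Phi^+ : w^{-1}(\alpha)\in\Phi^-\}$. An infinite reduced expression is a sequence $s_1s_2s_3\cdots$ with $s_i\in S$ such that $s_1s_2\cdots s_k$ is a reduced expression for every $k\ge 1$; put $\Phi_{s_1s_2s_3\cdots}=\bigcup_{i\ge1}\Phi_{s_1s_2\cdots s_i}$. Two infinite reduced expressions are equivalent if the associated sets $\Phi_{s_1s_2\cdots}$ are equal. $W_l$ is the set of equivalence classes (infinite reduced words), $\Phi_w$ for $w\in W_l$ is the common set attached to the class, and $\overline{W}=W_l\uplus W$ (disjoint union). The weak order on $\overline{W}$ is: $x\le y$ if and only if $\Phi_x\subset\Phi_y$. *)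

(* Defs.v *)
From HB Require Import structures.
From mathcomp Require Import all_boot all_order all_algebra.
From mathcomp Require Import all_classical all_reals all_analysis.

Set Implicit Arguments.
Unset Strict Implicit.
Unset Printing Implicit Defensive.

Import Order.TTheory GRing.Theory Num.Theory.

Local Open Scope quotient_scope.
Local Open Scope classical_set_scope.
Local Open Scope ring_scope.

(* In a Coxeter matrix the entry 0 stands for infinity: the corresponding
   relation (s i * s j) ^+ 0 = 1 is then trivially true. *)
Definition coxeter_matrix (n : nat) (m : 'M[nat]_n) : Prop :=
  [/\ forall i, m i i = 1%N,
      forall i j, m i j = m j i &
      forall i j, i != j -> m i j != 1%N].

Definition satisfies_relations (n : nat) (m : 'M[nat]_n) (G : groupType)
    (f : 'I_n -> G) : Prop :=
  forall i j, ((f i * f j) ^+ m i j = 1)%g.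

Definition word_prod (n : nat) (G : groupType) (f : 'I_n -> G)
    (w : seq 'I_n) : G :=
  (\prod_(i <- w) f i)%g.

(* W is the group presented by the generators s i and the relations
   (s i * s j) ^+ m i j = 1. Since the s i are involutions, generation can be
   expressed with words without inverses; the last clause is the universal
   property of the presentation (the morphism phi is unique by generation). *)
Definition coxeter_system (n : nat) (m : 'M[nat]_n) (W : groupType)
    (s : 'I_n -> W) : Prop :=
  [/\ coxeter_matrix m,
      satisfies_relations m s,
      forall x : W, exists w : seq 'I_n, word_prod s w = x &
      forall (G : groupType) (f : 'I_n -> G), satisfies_relations m f ->
        exists phi : {multiplicative W -> G}, forall i, phi (s i) = f i].

Definition coxeter_edge (n : nat) (m : 'M[nat]_n) : rel 'I_n :=
  fun i j => (i != j) && (m i j != 2%N).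

Definition irreducible_coxeter (n : nat) (m : 'M[nat]_n) : Prop :=
  (0 < n)%N /\ forall i j, connect (coxeter_edge m) i j.

Definition reduced (n : nat) (W : groupType) (s : 'I_n -> W)
    (w : seq 'I_n) : Prop :=
  forall w', word_prod s w' = word_prod s w -> (size w <= size w')%N.

Section StandardReflectionRepresentation.
Context (R : realType) (n : nat) (m : 'M[nat]_n) (W : groupType)
  (s : 'I_n -> W).

Definition gram : 'M[R]_n :=
  \matrix_(i, j) if m i j == 0%N then -1 else - cos (pi / (m i j)%:R).

Definition bform (u v : 'rV[R]_n) : R := (u *m gram *m v^T) 0 0.

Definition simple_root (i : 'I_n) : 'rV[R]_n := delta_mx 0 i.

Definition simple_refl (i : 'I_n) (v : 'rV[R]_n) : 'rV[R]_n :=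
  v - (2 * bform v (simple_root i)) *: simple_root i.

Definition word_act (w : seq 'I_n) (v : 'rV[R]_n) : 'rV[R]_n :=
  foldr simple_refl v w.

(* The linear map by which x acts does not depend on the word chosen to
   represent x, because the simple reflections satisfy the Coxeter relations;
   in a Coxeter system such a word always exists, so the default value [::] is
   never used for lack of one. *)
Definition act (x : W) : 'rV[R]_n -> 'rV[R]_n :=
  word_act (xget [::] [set w | word_prod s w = x]).

Definition roots : set 'rV[R]_n :=
  [set a | exists (x : W) (i : 'I_n), a = act x (simple_root i)].

Definition positive_roots : set 'rV[R]_n :=
  roots `&` [set a | forall i, 0 <= a 0 i].

Definition negative_roots : set 'rV[R]_n := [set - a | a in positive_roots].

Definition inv_set (x : W) : set 'rV[R]_n :=
  [set a | positive_roots a /\ negative_roots (act (x^-1)%g a)].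

Definition infinite_reduced : set (nat -> 'I_n) :=
  [set x | forall k, reduced s (mkseq x k)].

Definition inv_set_seq (x : nat -> 'I_n) : set 'rV[R]_n :=
  \bigcup_(k in [set k | (0 < k)%N]) inv_set (word_prod s (mkseq x k)).

Definition seq_equiv (x y : infinite_reduced) : bool :=
  inv_set_seq (val x) == inv_set_seq (val y).

Lemma seq_equiv_refl : reflexive seq_equiv.
Proof. by move=> x; exact: eqxx. Qed.

Lemma seq_equiv_sym : symmetric seq_equiv.
Proof. by move=> x y; exact: eq_sym. Qed.

Lemma seq_equiv_trans : transitive seq_equiv.
Proof. by move=> y x z /eqP xy /eqP yz; apply/eqP; rewrite xy. Qed.

Canonical seq_equiv_rel :=
  EquivRel seq_equiv seq_equiv_refl seq_equiv_sym seq_equiv_trans.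

Definition infinite_word : Type := {eq_quot seq_equiv_rel}.

Definition inv_set_infinite (c : infinite_word) : set 'rV[R]_n :=
  inv_set_seq (val (repr (c : {eq_quot seq_equiv_rel}))).

Lemma inv_set_infinite_pi (x : infinite_reduced) :
  inv_set_infinite (\pi_({eq_quot seq_equiv_rel}) x) = inv_set_seq (val x).
Proof.
rewrite /inv_set_infinite; apply/eqP.
by case: piP => y /eqmodP /eqP /= ->.
Qed.

Definition Wbar : Type := (infinite_word + W)%type.

Definition inv_set_bar (x : Wbar) : set 'rV[R]_n :=
  match x with
  | inl c => inv_set_infinite c
  | inr w => inv_set w
  end.

Definition weak_le (x y : Wbar) : Prop := inv_set_bar x `<=` inv_set_bar y.

Definition weak_maximal (x : Wbar) : Prop := forall y, weak_le x y -> y = x.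

End StandardReflectionRepresentation.

Section AffineWeylGroups.
Context (R : realType) (d : nat).
Implicit Types (a b u v : 'rV[R]_d) (Psi : set 'rV[R]_d).

Definition dot u v : R := (u *m v^T) 0 0.

Definition coroot a : 'rV[R]_d := (2 / dot a a) *: a.

(* The reflection in the affine hyperplane of the v with dot v a = k. *)
Definition affine_refl a (k : int) v : 'rV[R]_d :=
  v - (dot v a - k%:~R) *: coroot a.

(* Finite reduced crystallographic root systems spanning the space. *)
Definition root_system Psi : Prop :=
  [/\ finite_set Psi /\ ~ Psi 0,
      exists2 B : 'M[R]_d, B \in unitmx & forall i, Psi (row i B),
      forall a (c : R), Psi a -> Psi (c *: a) -> c = 1 \/ c = -1,
      forall a b, Psi a -> Psi b -> Psi (affine_refl a 0 b) &
      forall a b, Psi a -> Psi b -> dot b (coroot a) \is a Num.int].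

Definition irreducible_root_system Psi : Prop :=
  Psi !=set0 /\
  forall A, A `<=` Psi -> A !=set0 -> (Psi `\` A) !=set0 ->
    exists a b, [/\ A a, (Psi `\` A) b & dot a b != 0].

(* The simple roots are the rows of Delta. *)
Definition simple_system Psi (Delta : 'M[R]_d) : Prop :=
  [/\ Delta \in unitmx,
      forall i, Psi (row i Delta) &
      forall a, Psi a -> exists2 c : 'rV[R]_d, a = c *m Delta &
        (forall i, 0 <= c 0 i) \/ (forall i, c 0 i <= 0)].

Definition highest_root Psi (Delta : 'M[R]_d) (theta : 'rV[R]_d) : Prop :=
  Psi theta /\
  forall a, Psi a -> exists2 c : 'rV[R]_d, theta - a = c *m Delta &
    forall i, 0 <= c 0 i.

(* The group generated by all the affine reflections of Psi; as these are
   involutions, products without inverses suffice. *)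
Inductive affine_weyl_group Psi : set ('rV[R]_d -> 'rV[R]_d) :=
| affine_weyl_id : affine_weyl_group Psi id
| affine_weyl_refl a k f : Psi a -> affine_weyl_group Psi f ->
    affine_weyl_group Psi (affine_refl a k \o f).

(* The reflections in the walls of the fundamental alcove. *)
Definition affine_simple_refls (Delta : 'M[R]_d) (theta : 'rV[R]_d) :
    set ('rV[R]_d -> 'rV[R]_d) :=
  [set affine_refl (row i Delta) 0 | i in [set: 'I_d]] `|`
  [set affine_refl theta 1].

End AffineWeylGroups.

Definition affine_coxeter (R : realType) (n : nat) (W : groupType)
    (s : 'I_n -> W) : Prop :=
  exists (d : nat) (Psi : set 'rV[R]_d) (Delta : 'M[R]_d) (theta : 'rV[R]_d)
         (phi : W -> 'rV[R]_d -> 'rV[R]_d),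
    [/\ root_system Psi /\ irreducible_root_system Psi,
        simple_system Psi Delta /\ highest_root Psi Delta theta,
        injective phi /\ (forall x y, phi (x * y)%g = phi x \o phi y),
        range phi = affine_weyl_group Psi &
        [set phi (s i) | i in [set: 'I_n]] = affine_simple_refls Delta theta].

(* Main.v *)
Require Import Defs.
From HB Require Import structures.
From mathcomp Require Import all_boot all_order all_algebra.
From mathcomp Require Import all_classical all_reals all_analysis.
From mathcomp Require Import ring lra zify.

(* Let [mu] be the least eigenvalue of the Gram matrix of the reflection representation;
   by Perron-Frobenius it has a positive eigenvector [v].

   If [mu > 0], the form is positive definite and [W] is finite.

   If [mu < 0], the heights [- B v] of the roots are unbounded, which yields two roots
   spanning a hyperbolic plane and, by iterating the corresponding translation, an infinite
   family of positive roots with pairwise products [<= -1]. Two such roots never lie in the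
   same inversion set, since together they generate infinitely many roots, while every
   root lies in the inversion set of some maximal infinite word: there are infinitely
   many maximal elements.

   If [mu = 0], the radical is spanned by [v] and [W] acts by affine isometries of the dual
   Euclidean space. A separation argument shows that there are finitely many directions
   of roots; after rescaling the roots so that those of a given direction differ by integer
   multiples of the radical vector, one finds a special point, and [W] is the affine Weyl
   group of the directions.

   Conversely, in an affine Weyl group inversion sets are sets of hyperplanes separating
   alcoves. The inversion set of an infinite word involves finitely many directions, all
   negative on some vector, hence on some vector of the coroot lattice, and it is covered
   by the inversion set of the infinite word attached to that translation. Thus a maximal
   element is determined by a subset of the finite root system. *)

Set Implicit Arguments.
Unset Strict Implicit.
Unset Printing Implicit Defensive.

Import Order.TTheory GRing.Theory Num.Theory.
Import numFieldNormedType.Exports.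

Local Open Scope classical_set_scope.
Local Open Scope ring_scope.

(** * The bilinear form *)

(** Gram entries never go below -1, so no two simple roots span a hyperbolic plane; such pairs only
    occur among high roots. A pair is not enough: the infinite family is the orbit of a third root
    [g] under the translation, and its products become arbitrarily negative only if [g] pairs with
    the two isotropic lines with equal signs. This is the quadratic condition of
    [hyperbolic_family].

    When [mu = 0], no list of diagrams is consulted. Integrality comes from the shifts of roots
    along the radical: they form a discrete group, and every translation of [W] must respect its
    step. A special point is a linear form with value 1 at the radical vector and integral on the
    lattice of the rescaled roots. It exists once that vector is known to be primitive, and this
    follows from the fact that every lattice vector of shortest root length is a root.

    In the converse, [phi] is merely an abstract isomorphism matching the generators, so nothing
    relates roots to hyperplanes at the outset. The dictionary is built by induction on words: a
    root and the side of a wall change sign at the same letters. *)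

Lemma satisfies_relations_inv n (m : 'M[nat]_n) (G : groupType) (f : 'I_n -> G)
    i : coxeter_matrix m -> satisfies_relations m f -> (f i * f i = 1)%g.
Proof. by case=> m1 _ _ /(_ i i); rewrite m1 expg1. Qed.

Section Words.
Context (n : nat) (G : groupType) (f : 'I_n -> G).

Lemma word_prod_nil : word_prod f [::] = 1%g.
Proof. by rewrite /word_prod big_nil. Qed.

Lemma word_prod_cons i w : word_prod f (i :: w) = (f i * word_prod f w)%g.
Proof. by rewrite /word_prod big_cons. Qed.

Lemma word_prod1 i : word_prod f [:: i] = f i.
Proof. by rewrite word_prod_cons word_prod_nil mulg1. Qed.

Lemma word_prod_cat w w' :
  word_prod f (w ++ w') = (word_prod f w * word_prod f w')%g.
Proof. by rewrite /word_prod big_cat. Qed.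

Lemma word_prod_rcons w i : word_prod f (rcons w i) = (word_prod f w * f i)%g.
Proof. by rewrite -cats1 word_prod_cat word_prod1. Qed.

End Words.

Section BijectionGroup.
Context (T : Type).

(** The universal property in [coxeter_system] speaks of a [groupType]. Bijections of a possibly
    infinite type are made into one, so that reflections of a vector space can be fed to it. *)
Record bijection := Bijection {
  bij_fun :> T -> T;
  bij_inv : T -> T;
  bij_funK : cancel bij_fun bij_inv;
  bij_invK : cancel bij_inv bij_fun }.

HB.instance Definition _ := gen_eqMixin bijection.
HB.instance Definition _ := gen_choiceMixin bijection.

Lemma bijectionP (f g : bijection) : f =1 g -> f = g.
Proof.
case: f g => [f f' fK f'K] [g g' gK g'K] /= /funext fg; rewrite fg in fK f'K *.
have f'g' : f' = g' by apply/funext => x; rewrite -{1}(g'K x) fK.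
by move: fK f'K; rewrite f'g' => fK f'K; congr Bijection; exact: Prop_irrelevance.
Qed.

Definition bijection_one : bijection := @Bijection id id (frefl _) (frefl _).

Definition bijection_inv (f : bijection) : bijection :=
  Bijection (@bij_invK f) (@bij_funK f).

Definition bijection_mul (f g : bijection) : bijection :=
  Bijection (can_comp (@bij_funK f) (@bij_funK g))
            (can_comp (@bij_invK g) (@bij_invK f)).

Lemma bijection_mulA : associative bijection_mul.
Proof. by move=> f g h; exact: bijectionP. Qed.

Lemma bijection_mul1 : left_id bijection_one bijection_mul.
Proof. by move=> f; exact: bijectionP. Qed.

Lemma bijection_mulr1 : right_id bijection_one bijection_mul.
Proof. by move=> f; exact: bijectionP. Qed.

Lemma bijection_mulV : left_inverse bijection_one bijection_inv bijection_mul.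
Proof. by move=> f; apply: bijectionP => x /=; rewrite bij_funK. Qed.

Lemma bijection_mulrV : right_inverse bijection_one bijection_inv bijection_mul.
Proof. by move=> f; apply: bijectionP => x /=; rewrite bij_invK. Qed.

HB.instance Definition _ := isGroup.Build bijection bijection_mulA
  bijection_mul1 bijection_mulr1 bijection_mulV bijection_mulrV.

Lemma bijection_mulE (f g : bijection) x : (f * g)%g x = f (g x).
Proof. by []. Qed.

Lemma bijection_expE (f : bijection) k x : (f ^+ k)%g x = iter k f x.
Proof. by elim: k => //= k <-; rewrite expgS. Qed.

End BijectionGroup.

Section Form.
Context (R : realType) (n : nat) (m : 'M[nat]_n).
Local Notation B := (bform (R := R) m).
Local Notation a_ := (@simple_root R n).
Implicit Types (u v w : 'rV[R]_n).

Lemma bformDl u v w : B (u + v) w = B u w + B v w.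
Proof. by rewrite /bform !mulmxDl mxE. Qed.
Lemma bformZl c u w : B (c *: u) w = c * B u w.
Proof. by rewrite /bform -!scalemxAl mxE. Qed.
Lemma bformNl u w : B (- u) w = - B u w.
Proof. by rewrite -scaleN1r bformZl mulN1r. Qed.
Lemma bformBl u v w : B (u - v) w = B u w - B v w.
Proof. by rewrite bformDl bformNl. Qed.
Lemma bform0l w : B 0 w = 0.
Proof. by rewrite -(scale0r (0 : 'rV_n)) bformZl mul0r. Qed.
Lemma bformDr u v w : B w (u + v) = B w u + B w v.
Proof. by rewrite /bform linearD mulmxDr mxE. Qed.
Lemma bformZr c u w : B w (c *: u) = c * B w u.
Proof. by rewrite /bform linearZ -!scalemxAr mxE. Qed.
Lemma bformNr u w : B w (- u) = - B w u.
Proof. by rewrite -scaleN1r bformZr mulN1r. Qed.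
Lemma bformBr u v w : B w (u - v) = B w u - B w v.
Proof. by rewrite bformDr bformNr. Qed.
Lemma bform0r w : B w 0 = 0.
Proof. by rewrite -(scale0r (0 : 'rV_n)) bformZr mul0r. Qed.

Definition bformE := (bformDl, bformZl, bformNl, bformDr, bformZr, bformNr).

Lemma bform_suml (I : Type) (r : seq I) (P : pred I) (F : I -> 'rV[R]_n) w :
  B (\sum_(i <- r | P i) F i) w = \sum_(i <- r | P i) B (F i) w.
Proof. by apply: (big_morph (B^~ w)) => [u v|]; rewrite ?bformDl ?bform0l. Qed.

Lemma bform_sumr (I : Type) (r : seq I) (P : pred I) (F : I -> 'rV[R]_n) w :
  B w (\sum_(i <- r | P i) F i) = \sum_(i <- r | P i) B w (F i).
Proof. by apply: (big_morph (B w)) => [u v|]; rewrite ?bformDr ?bform0r. Qed.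

Lemma row_sum_simple v : v = \sum_i v 0 i *: a_ i.
Proof. exact: row_sum_delta. Qed.

Lemma simple_rootE i j : a_ i 0 j = (j == i)%:R.
Proof. by rewrite mxE eqxx. Qed.

Lemma bform_simple i j : B (a_ i) (a_ j) = gram R m i j.
Proof. by rewrite /bform /simple_root -rowE trmx_delta -colE !mxE. Qed.

Lemma bform_expandl u v : B u v = \sum_i u 0 i * B (a_ i) v.
Proof.
by rewrite {1}(row_sum_simple u) bform_suml; apply: eq_bigr => i _; rewrite bformZl.
Qed.

Lemma bform_expandr u v : B v u = \sum_i u 0 i * B v (a_ i).
Proof.
by rewrite {1}(row_sum_simple u) bform_sumr; apply: eq_bigr => i _; rewrite bformZr.
Qed.

Hypothesis cox : coxeter_matrix m.

Lemma coxeter_matrix_ge2 i j : i != j -> m i j != 0%N -> (2 <= m i j)%N.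
Proof.
case: cox => _ _ m1 /m1; by case: (m i j) => [|[|k]].
Qed.

Lemma gram_sym i j : gram R m i j = gram R m j i.
Proof. by case: cox => _ ms _; rewrite !mxE ms. Qed.

Lemma gram_diag i : gram R m i i = 1.
Proof. by case: cox => m1 _ _; rewrite mxE m1 /= divr1 cospi opprK. Qed.

Lemma gram_ge i j : -1 <= gram R m i j.
Proof. by rewrite mxE; case: ifP => // _; rewrite lerN2 cos_le1. Qed.

Lemma cos_pi_div_ge0 k : (2 <= k)%N -> 0 <= cos (pi / k%:R) :> R.
Proof.
move=> k2; have k0 : 0 < k%:R :> R by rewrite ltr0n (leq_trans _ k2).
apply: cos_ge0_pihalf; apply/andP; split.
  by rewrite (@le_trans _ _ 0) ?divr_ge0 ?pi_ge0 ?ler0n// oppr_le0 divr_ge0 ?pi_ge0.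
by rewrite ler_pM2l ?pi_gt0// lef_pV2 ?posrE// ler_nat.
Qed.

Lemma cos_pi_div_gt0 k : (2 < k)%N -> 0 < cos (pi / k%:R) :> R.
Proof.
move=> k2; have k0 : 0 < k%:R :> R by rewrite ltr0n (leq_trans _ k2).
apply: cos_gt0_pihalf; apply/andP; split.
  by rewrite (@lt_le_trans _ _ 0) ?divr_ge0 ?pi_ge0 ?ler0n// oppr_lt0 divr_gt0 ?pi_gt0.
by rewrite ltr_pM2l ?pi_gt0// ltf_pV2 ?posrE// ltr_nat.
Qed.

Lemma gram_le0 i j : i != j -> gram R m i j <= 0.
Proof.
move=> ij; rewrite mxE; case: ifP => [_|/negbT m0]; first by rewrite oppr_le0.
by rewrite oppr_le0 cos_pi_div_ge0 // coxeter_matrix_ge2.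
Qed.

Lemma gram_edge i j : coxeter_edge m i j -> gram R m i j < 0.
Proof.
case/andP => ij m2; rewrite mxE; case: ifP => [_|/negbT m0]; first by rewrite oppr_lt0.
rewrite oppr_lt0 cos_pi_div_gt0 // ltn_neqAle eq_sym m2.
exact: coxeter_matrix_ge2.
Qed.

Lemma bformC u v : B u v = B v u.
Proof.
rewrite bform_expandl bform_expandr; apply: eq_bigr => i _; congr (_ * _).
rewrite (bform_expandr v) (bform_expandl v); apply: eq_bigr => j _; congr (_ * _).
by rewrite !bform_simple gram_sym.
Qed.

Lemma bform_simple1 i : B (a_ i) (a_ i) = 1.
Proof. by rewrite bform_simple gram_diag. Qed.

Definition reflection b v := v - (2 * B v b) *: b.

Lemma simple_reflE i v : simple_refl m i v = reflection (a_ i) v.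
Proof. by []. Qed.

Lemma reflectionD b u v : reflection b (u + v) = reflection b u + reflection b v.
Proof. by rewrite /reflection bformDl mulrDr scalerDl opprD addrACA. Qed.

Lemma reflectionZ b c u : reflection b (c *: u) = c *: reflection b u.
Proof. by rewrite /reflection bformZl scalerBr scalerA; congr (_ - _ *: _); ring. Qed.

Lemma reflection_self b : B b b = 1 -> reflection b b = - b.
Proof. by move=> b1; rewrite /reflection b1 mulr1 -{1}(scale1r b) -scalerBl; rewrite (_ : 1 - 2 = -1) ?scaleN1r//; ring. Qed.

Lemma reflection_form b u v : B b b = 1 ->
  B (reflection b u) (reflection b v) = B u v.
Proof. by move=> b1; rewrite /reflection !bformE b1 (bformC b v); ring. Qed.

Lemma reflectionK b : B b b = 1 -> involutive (reflection b).
Proof.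
move=> b1 v; rewrite /reflection bformBl bformZl b1 mulr1 -addrA -opprD -scalerDl.
by have -> : 2 * B v b + 2 * (B v b - 2 * B v b) = 0; [ring | rewrite scale0r subr0].
Qed.

End Form.

(** * The reflection representation *)

Section Dihedral.
Context (R : realType).

(* With c = cos t this is sin (k t) / sin t. *)
Fixpoint dihedral_coef (c : R) (k : nat) : R :=
  match k with
  | 0 => 0
  | k1.+1 => match k1 with
    | 0 => 1
    | k2.+1 => 2 * c * dihedral_coef c k1 - dihedral_coef c k2
    end
  end.

Lemma dihedral_coefSS c k :
  dihedral_coef c k.+2 = 2 * c * dihedral_coef c k.+1 - dihedral_coef c k.
Proof. by []. Qed.

Lemma dihedral_coef_sin t k :
  dihedral_coef (cos t) k * sin t = sin (k%:R * t).
Proof.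
suff [] : dihedral_coef (cos t) k * sin t = sin (k%:R * t) /\
    dihedral_coef (cos t) k.+1 * sin t = sin (k.+1%:R * t) by [].
elim: k => [|k [IH0 IH1]]; first by rewrite !mul0r sin0 !mul1r.
split=> [//|]; rewrite dihedral_coefSS mulrBl IH0 -(mulrA (2 * cos t)) IH1.
have -> : k.+2%:R * t = k.+1%:R * t + t by rewrite -[k.+2]addn1 natrD mulrDl mul1r.
have -> : k%:R * t = k.+1%:R * t - t by rewrite -natr1 mulrDl mul1r addrK.
by rewrite sinB sinD; ring.
Qed.

Lemma dihedral_coef1 k : dihedral_coef 1 k = k%:R.
Proof.
suff [] : dihedral_coef 1 k = k%:R /\ dihedral_coef 1 k.+1 = k.+1%:R by [].
elim: k => [|k [IH0 IH1]] //; split=> [//|].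
by rewrite dihedral_coefSS IH0 IH1 -[k.+2]addn2 -[k.+1]addn1 !natrD; ring.
Qed.

Lemma sin_pi_div_gt0 k : (2 <= k)%N -> 0 < sin (pi / k%:R) :> R.
Proof.
move=> k2; have k0 : 0 < k%:R :> R by rewrite ltr0n (leq_trans _ k2).
apply: sin_gt0_pi; apply/andP; split; first by rewrite divr_gt0 ?pi_gt0.
by rewrite ltr_pdivrMr // ltr_pMr ?pi_gt0// ltr1n.
Qed.

Lemma dihedral_coef_ge0 k j : (2 <= k)%N -> (j <= k)%N ->
  0 <= dihedral_coef (cos (pi / k%:R)) j.
Proof.
move=> k2 jk; have k0 : 0 < k%:R :> R by rewrite ltr0n (leq_trans _ k2).
have := sin_pi_div_gt0 k2; move/pmulr_lge0 <-; rewrite dihedral_coef_sin.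
apply: sin_ge0_pi; apply/andP; split.
  by rewrite !mulr_ge0 ?ler0n// ?pi_ge0// invr_ge0 ler0n.
by rewrite mulrCA ger_pMr ?pi_gt0// ler_pdivrMr// mul1r ler_nat.
Qed.

Lemma dihedral_coef_period k : (2 <= k)%N ->
  [/\ dihedral_coef (cos (pi / k%:R)) k.*2 = 0,
      dihedral_coef (cos (pi / k%:R)) k.*2.+1 = 1 &
      dihedral_coef (cos (pi / k%:R)) k.*2.-1 = -1].
Proof.
move=> k2; have s0 := sin_pi_div_gt0 k2; set t := pi / k%:R in s0 *.
have kt : k.*2%:R * t = 2 * pi.
  rewrite -muln2 natrM mulrAC /t mulrCA divff ?mulr1 1?mulrC//.
  by rewrite pnatr_eq0 -lt0n (leq_trans _ k2).
have sI := mulIf (lt0r_neq0 s0).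
split; apply: sI; rewrite dihedral_coef_sin.
- by rewrite kt mul0r mulrC mulr_natr sin2pi.
- by rewrite -natr1 mulrDl mul1r kt addrC mulr_natl sinD2pi mul1r.
- have -> : k.*2.-1%:R * t = - t + 2 * pi.
    rewrite -kt -{2}[k.*2]prednK ?double_gt0 ?(leq_trans _ k2)//.
    by rewrite -natr1 mulrDl mul1r; ring.
  by rewrite mulr_natl sinD2pi sinN mulN1r.
Qed.

End Dihedral.

(* The alternating word of length [k] in [i] and [j] whose last letter is [j]. *)
Fixpoint alternating (T : Type) (i j : T) (k : nat) : seq T :=
  if k is k'.+1 then (if odd k' then i else j) :: alternating i j k' else [::].

Section Alternating.
Context (T : Type).
Implicit Types (i j : T).

Lemma size_alternating i j k : size (alternating i j k) = k.
Proof. by elim: k => //= k ->. Qed.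

Lemma alternatingS i j k : alternating i j k.+1 = rcons (alternating j i k) j.
Proof.
elim: k => //= k IH; rewrite -IH /=; by case: (odd k).
Qed.

Lemma alternating_suffix i j k l : (l <= k)%N ->
  exists2 u, size u = (k - l)%N & alternating i j k = u ++ alternating i j l.
Proof.
move=> lk; rewrite -{2}(subnK lk); elim: (k - l)%N => [|p [u su IH]] /=.
  by exists [::].
by exists ((if odd (p + l) then i else j) :: u); rewrite /= ?su ?IH.
Qed.

End Alternating.

Lemma mulg_conj_exp (G : groupType) (g h : G) k :
  (g * (h * g) ^+ k * h)%g = ((g * h) ^+ k.+1)%g.
Proof.
elim: k => [|k IH]; first by rewrite expg0 mulg1 expg1.
by rewrite expgS [RHS]expgS -IH !mulgA.
Qed.

(** This turns a Coxeter relation into a braid relation: at [k = m i j] the right-hand side is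
    trivial. *)
Lemma word_prod_alternating n (G : groupType) (f : 'I_n -> G) i j k :
  (f i * f i = 1)%g -> (f j * f j = 1)%g ->
  (word_prod f (alternating i j k) * (word_prod f (alternating j i k))^-1)%g =
  (if odd k then (f j * f i) ^+ k else (f i * f j) ^+ k)%g.
Proof.
move=> fi fj; have fV l : (f l * f l = 1)%g -> ((f l)^-1 = f l)%g.
  by move=> /(congr1 (fun g => (f l)^-1 * g)%g); rewrite mulgA mulVg mul1g mulg1.
elim: k => [|k IH]; first by rewrite /= word_prod_nil invg1 mulg1 expg0.
rewrite /= !word_prod_cons invgM !mulgA -(mulgA _ (word_prod _ _)) IH.
by case: (odd k) => /=; rewrite ?(fV _ fi) ?(fV _ fj) mulg_conj_exp.
Qed.

Section WordAct.
Context (R : realType) (n : nat) (m : 'M[nat]_n).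
Hypothesis cox : coxeter_matrix m.
Local Notation B := (bform (R := R) m).
Local Notation a_ := (@simple_root R n).
Local Notation wa := (@word_act R n m).
Implicit Types (u v : 'rV[R]_n) (w : seq 'I_n).

Lemma simple_reflK i : involutive (@simple_refl R n m i).
Proof. by move=> v; rewrite simple_reflE reflectionK ?bform_simple1. Qed.

Lemma word_actD w u v : wa w (u + v) = wa w u + wa w v.
Proof. by elim: w => //= i w ->; rewrite simple_reflE reflectionD. Qed.

Lemma word_actZ w c v : wa w (c *: v) = c *: wa w v.
Proof. by elim: w => //= i w ->; rewrite simple_reflE reflectionZ. Qed.

Lemma word_act_cat w w' v : wa (w ++ w') v = wa w (wa w' v).
Proof. by rewrite /word_act foldr_cat. Qed.

Lemma word_act_form w u v : B (wa w u) (wa w v) = B u v.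
Proof.
by elim: w => //= i w; rewrite !simple_reflE reflection_form ?bform_simple1.
Qed.

Lemma simple_refl_simple i j :
  simple_refl m i (a_ j) = a_ j + (2 * - gram R m i j) *: a_ i.
Proof. by rewrite /simple_refl bform_simple gram_sym // mulrN scaleNr. Qed.

(** One more reflection replaces one coefficient by [2 * c] times the other minus itself, which is
    the recurrence of [dihedral_coef]. *)
Lemma word_act_alternating i j k : i != j ->
  let c := - gram R m i j in
  wa (alternating i j k) (a_ i) =
  if odd k then dihedral_coef c k *: a_ i + dihedral_coef c k.+1 *: a_ j
  else dihedral_coef c k.+1 *: a_ i + dihedral_coef c k *: a_ j.
Proof.
move=> ij c; have gji : gram R m j i = gram R m i j by rewrite gram_sym.
elim: k => [|k IH]; first by rewrite /= scale1r scale0r addr0.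
rewrite [LHS]/= {}IH [odd _.+1]/= if_neg dihedral_coefSS.
move: (dihedral_coef c k.+1) (dihedral_coef c k) => s1 s0.
case: (odd k); rewrite simple_reflE reflectionD !reflectionZ -!simple_reflE;
  rewrite !simple_refl_simple // gram_diag // ?gji -/c;
  by move: (a_ i) (a_ j) => x y; apply/rowP => l; rewrite !mxE; ring.
Qed.

Lemma word_act_double i j k v :
  wa (alternating i j k.*2) v =
  iter k (simple_refl m i \o simple_refl m j) v.
Proof. by elim: k => //= k ->; rewrite odd_double. Qed.

(** For a finite entry at least 2 the form is nondegenerate on the plane of the two roots, since
    [1 - c ^+ 2] is the square of a nonzero sine. The orthogonal complement of the plane is fixed,
    and on the plane the periodicity of the coefficients gives the identity. *)
Lemma simple_refl_relation i j v :
  iter (m i j) (simple_refl m i \o simple_refl m j) v = v.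
Proof.
have [<-|ij] := eqVneq i j.
  by case: cox => -> _ _; rewrite /= simple_reflK.
have [->//|m0] := eqVneq (m i j) 0%N.
have m2 := coxeter_matrix_ge2 cox ij m0.
have gE : - gram R m i j = cos (pi / (m i j)%:R) by rewrite mxE (negbTE m0) opprK.
have [S0 S1 Sm1] := dihedral_coef_period R m2.
rewrite -word_act_double.
have ai : wa (alternating i j (m i j).*2) (a_ i) = a_ i.
  by rewrite word_act_alternating// odd_double gE S0 S1 scale1r scale0r addr0.
(* The last letter [j] negates [a_ j]; the remaining word ends in [i], so the formula applies with
   [i] and [j] exchanged. *)
have aj : wa (alternating i j (m i j).*2) (a_ j) = a_ j.
  have dS : (m i j).*2 = (m i j).*2.-1.+1 by rewrite prednK // double_gt0 lt0n.
  rewrite dS alternatingS -cats1 word_act_cat /= simple_reflE.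
  rewrite reflection_self ?bform_simple1// -scaleN1r word_actZ.
  rewrite word_act_alternating 1?eq_sym// gram_sym// gE.
  have -> : odd (m i j).*2.-1.
    by move: (odd_double (m i j)); rewrite {1}dS /= => /negbFE.
  by rewrite -dS Sm1 S0 scale0r addr0 scaleN1r scaleN1r opprK.
set c := - gram R m i j in gE.
have c1 : 1 - c ^+ 2 != 0.
  rewrite gE -sin2cos2 expf_neq0 //.
  by rewrite gt_eqF// sin_pi_div_gt0.
have gc : gram R m i j = - c by rewrite opprK.
have gc' : gram R m j i = - c by rewrite gram_sym.
pose x := B v (a_ i); pose y := B v (a_ j).
(* The solution of the two linear equations that make [v0] orthogonal to both simple roots. *)
pose p := (x + c * y) / (1 - c ^+ 2); pose q := (y + c * x) / (1 - c ^+ 2).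
pose v0 := v - (p *: a_ i + q *: a_ j).
have vi : B v0 (a_ i) = 0.
  rewrite bformBl bformDl !bformZl !bform_simple gram_diag// gc' -/x /p /q.
  by field.
have vj : B v0 (a_ j) = 0.
  rewrite bformBl bformDl !bformZl !bform_simple gram_diag// gc -/y /p /q.
  by field.
have fixed z k : B z (a_ i) = 0 -> B z (a_ j) = 0 ->
    wa (alternating i j k) z = z.
  move=> zi zj; elim: k => //= k ->; rewrite /simple_refl.
  by case: (odd k); rewrite ?zi ?zj mulr0 scale0r subr0.
have -> : v = v0 + (p *: a_ i + q *: a_ j) by rewrite subrK.
by rewrite (word_actD _ v0) (word_actD _ (p *: a_ i)) (word_actZ _ p) (word_actZ _ q) ai aj fixed.
Qed.

End WordAct.

Section Action.
Context (R : realType) (n : nat) (m : 'M[nat]_n) (W : groupType)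
  (s : 'I_n -> W).
Hypothesis coxWS : coxeter_system m s.
Local Notation B := (bform (R := R) m).
Local Notation a_ := (@simple_root R n).
Local Notation act := (@act R n m W s).
Implicit Types (u v : 'rV[R]_n) (w : seq 'I_n) (x y : W) (i j : 'I_n).

Let cox : coxeter_matrix m. Proof. by case: coxWS. Qed.

Lemma word_prod_surj x : exists w, word_prod s w = x.
Proof. by case: coxWS => _ _ + _; exact. Qed.

Lemma simple_mul_self i : (s i * s i = 1)%g.
Proof. by case: coxWS => _ rel _ _; exact: satisfies_relations_inv rel. Qed.

Lemma simple_mulK x i : (x * s i * s i = x)%g.
Proof. by rewrite -mulgA simple_mul_self mulg1. Qed.

Lemma simple_mulKl x i : (s i * (s i * x) = x)%g.
Proof. by rewrite mulgA simple_mul_self mul1g. Qed.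

Lemma simple_invg i : ((s i)^-1 = s i)%g.
Proof. by rewrite -[LHS]mulg1 -(simple_mul_self i) mulgA mulVg mul1g. Qed.

(** The universal property, applied to the group of bijections of the space, extends the simple
    reflections to a morphism from [W], whose value at a product of letters cannot depend on the
    word. *)
Lemma word_act_prod w w' :
  word_prod s w = word_prod s w' -> @word_act R n m w =1 word_act m w'.
Proof.
pose f i : bijection 'rV[R]_n :=
  Bijection (@simple_reflK R n m cox i) (@simple_reflK R n m cox i).
have rel : satisfies_relations m f.
  move=> i j; apply: bijectionP => v; rewrite bijection_expE.
  exact: (simple_refl_relation cox i j v).
case: coxWS => _ _ _ /(_ _ f rel) [phi phis].
have phiE w0 v : phi (word_prod s w0) v = word_act m w0 v.
  have phi1 : phi 1%g = 1%g.
    apply: (mulgI (phi 1%g)); rewrite mulg1 -[in LHS]gmulfM mulg1 //.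
  elim: w0 => [|i w0 IH]; first by rewrite word_prod_nil phi1.
  by rewrite word_prod_cons gmulfM phis bijection_mulE IH.
by move=> ww' v; rewrite -!phiE ww'.
Qed.

Lemma actE w v : act (word_prod s w) v = word_act m w v.
Proof.
rewrite /Defs.act; case: xgetP => [w' _ /= /word_act_prod -> //|].
by move=> /(_ w); case.
Qed.

Lemma actM x y v : act (x * y)%g v = act x (act y v).
Proof.
have [w <-] := word_prod_surj x; have [w' <-] := word_prod_surj y.
by rewrite -word_prod_cat !actE word_act_cat.
Qed.

Lemma act1 v : act 1%g v = v.
Proof. by rewrite -(word_prod_nil s) actE. Qed.

Lemma act_simple i v : act (s i) v = simple_refl m i v.
Proof. by rewrite -(word_prod1 s) actE. Qed.

Lemma actD x u v : act x (u + v) = act x u + act x v.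
Proof. by have [w <-] := word_prod_surj x; rewrite !actE word_actD. Qed.

Lemma actZ x c v : act x (c *: v) = c *: act x v.
Proof. by have [w <-] := word_prod_surj x; rewrite !actE word_actZ. Qed.

Lemma actN x v : act x (- v) = - act x v.
Proof. by rewrite -scaleN1r actZ scaleN1r. Qed.

Lemma act_sum (I : Type) (r : seq I) (P : pred I) (F : I -> 'rV[R]_n) x :
  act x (\sum_(i <- r | P i) F i) = \sum_(i <- r | P i) act x (F i).
Proof.
apply: (big_morph (act x)) => [u v|]; first exact: actD.
by rewrite -{1}(scale0r (0 : 'rV[R]_n)) actZ scale0r.
Qed.

Lemma act_form x u v : B (act x u) (act x v) = B u v.
Proof. by have [w <-] := word_prod_surj x; rewrite !actE word_act_form. Qed.

Lemma actK x v : act x^-1%g (act x v) = v.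
Proof. by rewrite -actM mulVg act1. Qed.

Lemma actVK x v : act x (act x^-1%g v) = v.
Proof. by rewrite -actM mulgV act1. Qed.

Lemma act_inj x : injective (act x).
Proof. exact: can_inj (actK x). Qed.

Lemma act_simple_self i : act (s i) (a_ i) = - a_ i.
Proof. by rewrite act_simple simple_reflE reflection_self ?bform_simple1. Qed.

Definition coxeter_length x : nat :=
  xget 0%N [set k | (exists2 w, word_prod s w = x & size w = k) /\
                    forall w, word_prod s w = x -> (k <= size w)%N].
Local Notation len := coxeter_length.

Lemma coxeter_lengthP x :
  (exists2 w, word_prod s w = x & size w = len x) /\
  forall w, word_prod s w = x -> (len x <= size w)%N.
Proof.
rewrite /len; case: xgetP => [k -> //|noP]; exfalso.
have [w0 w0x] := word_prod_surj x.
have ex : exists k, `[< exists2 w, word_prod s w = x & size w = k >].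
  by exists (size w0); apply/asboolP; exists w0.
case: (ex_minnP ex) => k /asboolP kx kmin; apply: (noP k); split=> // w wx.
by apply: kmin; apply/asboolP; exists w.
Qed.

Lemma coxeter_length_word x : exists2 w, word_prod s w = x & size w = len x.
Proof. by case: (coxeter_lengthP x). Qed.

Lemma coxeter_length_le w : (len (word_prod s w) <= size w)%N.
Proof. by have [_] := coxeter_lengthP (word_prod s w); exact. Qed.

Lemma coxeter_length_mul x w : (len (x * word_prod s w) <= len x + size w)%N.
Proof.
have [u <- <-] := coxeter_length_word x.
by rewrite -word_prod_cat -size_cat coxeter_length_le.
Qed.

Lemma reducedP w : reduced s w <-> size w = len (word_prod s w).
Proof.
split=> [red|sw w' w'w]; last by rewrite sw -w'w coxeter_length_le.
apply/eqP; rewrite eqn_leq coxeter_length_le andbT.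
by have [u uw <-] := coxeter_length_word (word_prod s w); exact: red.
Qed.

Lemma reduced_word x : exists2 w, word_prod s w = x & reduced s w.
Proof.
have [w wx sw] := coxeter_length_word x; exists w => //.
by apply/reducedP; rewrite wx.
Qed.

Lemma coxeter_length1 : len 1%g = 0%N.
Proof. by apply/eqP; rewrite -leqn0 -(word_prod_nil s) coxeter_length_le. Qed.

Lemma coxeter_length_last x : x <> 1%g -> exists i, (len (x * s i)).+1 = len x.
Proof.
have [w wx sw] := coxeter_length_word x; case/lastP: w => [|w i] in wx sw *.
  by rewrite -wx word_prod_nil.
exists i; rewrite -wx word_prod_rcons simple_mulK.
apply/eqP; rewrite eqn_leq; apply/andP; split.
  by rewrite -word_prod_rcons wx -sw size_rcons ltnS coxeter_length_le.
by rewrite -(word_prod1 s i) -addn1; exact: coxeter_length_mul.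
Qed.

Lemma word_prod_braid i j : m i j != 0%N ->
  word_prod s (alternating i j (m i j)) = word_prod s (alternating j i (m i j)).
Proof.
move=> _; have := word_prod_alternating (m i j) (simple_mul_self i) (simple_mul_self j).
case: coxWS => [[_ msym _] rel _ _]; have rji : ((s j * s i) ^+ m i j = 1)%g by rewrite msym.
rewrite rel rji if_same.
by move=> /(congr1 (fun g => g * word_prod s (alternating j i (m i j)))%g); rewrite mulgVK mul1g.
Qed.

(** Write [x] as [v k] times an alternating word in [i] and [j] of maximal length [k], with lengths
    adding up, where [j] is a last letter of [x]. By maximality and induction on length, [v k] keeps
    [a_ i] and [a_ j] nonnegative, while the alternating word sends [a_ i] to a nonnegative
    combination of these two because [k] stays below [m i j]. *)
Lemma act_simple_ge0 x i : (len x <= len (x * s i))%N ->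
  forall l, 0 <= act x (a_ i) 0 l.
Proof.
have [N] := ubnP (len x); elim: N => // N IH in x i * => lxN lxi l.
have [->|x1] := eqVneq x 1%g; first by rewrite act1 simple_rootE ler0n.
have [j lxj] := coxeter_length_last (elimN eqP x1).
have ij : i != j by apply: contraTneq lxi => ->; rewrite -ltnNge -lxj.
pose v k := (x * (word_prod s (alternating i j k))^-1)%g.
pose Q k := (len (v k) + k == len x)%N.
have Q1 : Q 1%N by rewrite /Q /v /= word_prod1 simple_invg addn1 lxj.
have vS k : v k.+1 = (v k * s (if odd k then i else j))%g.
  by rewrite /v /= word_prod_cons invgM simple_invg mulgA.
have vx k : (v k * word_prod s (alternating i j k))%g = x by rewrite mulgVK.
have lev k : (len x <= len (v k) + k)%N.
  by rewrite -{1}(vx k) -{4}(size_alternating i j k) coxeter_length_mul.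
have Qle k : Q k -> (k <= len x)%N by move=> /eqP <-; exact: leq_addl.
case: (ex_maxnP (ex_intro Q _ Q1) Qle) => k Qk kmax; have k1 := kmax _ Q1.
have lvk : (len (v k) < len x)%N by rewrite -(eqP Qk); lia.
have vkN : (len (v k) < N)%N by exact: leq_trans lvk _.
have lv_next : (len (v k) <= len (v k * s (if odd k then i else j)))%N.
  rewrite leqNgt -vS; apply/negP => lt; have := lev k.+1.
  have : ~~ Q k.+1 by apply/negP => /kmax; rewrite ltnn.
  by move: Qk; rewrite /Q => /eqP; lia.
have lv_prev : (len (v k) <= len (v k * s (if odd k then j else i)))%N.
  case: (k) k1 Qk => // k' _ /eqP Qk'; rewrite vS /= if_neg simple_mulK.
  by have := lev k'; rewrite -Qk' vS; lia.
have vi_ge0 l' : 0 <= act (v k) (a_ i) 0 l'.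
  by apply: IH => //; case: (odd k) lv_next lv_prev.
have vj_ge0 l' : 0 <= act (v k) (a_ j) 0 l'.
  by apply: IH => //; case: (odd k) lv_next lv_prev.
(* Otherwise the braid relation would make the alternating tail end in [i], and [x * s i] would be
   shorter than [x]. *)
have kbound : m i j = 0%N \/ (k < m i j)%N.
  have [->|m0] := eqVneq (m i j) 0%N; [by left | right].
  rewrite ltnNge; apply/negP => mk.
  have Qm : (len (v (m i j)) + m i j <= len x)%N.
    have [u su uE] := alternating_suffix i j mk.
    have -> : v (m i j) = (v k * word_prod s u)%g.
      by rewrite /v uE word_prod_cat invgM !mulgA mulgVK.
    by have := coxeter_length_mul (v k) u; rewrite su; move/eqP: Qk; lia.
  have xsi : (x * s i)%g = (v (m i j) * word_prod s (alternating i j (m i j).-1))%g.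
    have aE : alternating j i (m i j) = rcons (alternating i j (m i j).-1) i.
      by rewrite -alternatingS prednK ?lt0n.
    by rewrite -{1}(vx (m i j)) word_prod_braid // aE word_prod_rcons mulgA simple_mulK.
  move: lxi; rewrite xsi leqNgt => /negP; apply.
  apply: leq_ltn_trans (coxeter_length_mul _ _) _; rewrite size_alternating.
  by move: m0 Qm; case: (m i j) => // p _; rewrite addnS.
have S_ge0 p : (p <= k.+1)%N -> 0 <= dihedral_coef (- gram R m i j) p.
  move=> pk; case: kbound => [m0|km].
    by rewrite mxE m0 /= opprK dihedral_coef1.
  have m2 : (2 <= m i j)%N by lia.
  have m0 : (m i j == 0%N) = false by lia.
  by rewrite mxE m0 opprK dihedral_coef_ge0// (leq_trans pk km).
rewrite -{1}(vx k) actM actE word_act_alternating //.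
move: (S_ge0 k (leqnSn k)) (S_ge0 k.+1 (leqnn _)).
move: (dihedral_coef _ k) (dihedral_coef _ k.+1) => z0 z1 z00 z10.
by case: (odd k); rewrite actD !actZ !mxE addr_ge0// mulr_ge0.
Qed.

End Action.

(** * Roots and inversion sets *)

Section Roots.
Context (R : realType) (n : nat) (m : 'M[nat]_n) (W : groupType)
  (s : 'I_n -> W).
Hypothesis coxWS : coxeter_system m s.
Local Notation B := (bform (R := R) m).
Local Notation a_ := (@simple_root R n).
Local Notation act := (@act R n m W s).
Local Notation len := (coxeter_length s).
Local Notation Phi := (@Defs.roots R n m W s).
Local Notation pos := (@positive_roots R n m W s).
Local Notation neg := (@negative_roots R n m W s).
Local Notation N := (@inv_set R n m W s).
Implicit Types (u v b : 'rV[R]_n) (w : seq 'I_n) (x y : W) (i j : 'I_n).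

Let cox : coxeter_matrix m. Proof. by case: coxWS. Qed.

Definition nonneg v := forall l, 0 <= v 0 l.

Lemma nonnegD u v : nonneg u -> nonneg v -> nonneg (u + v).
Proof. by move=> u0 v0 l; rewrite mxE addr_ge0. Qed.

Lemma nonnegZ c v : 0 <= c -> nonneg v -> nonneg (c *: v).
Proof. by move=> c0 v0 l; rewrite mxE mulr_ge0. Qed.

Lemma nonneg_eq0 v : nonneg v -> nonneg (- v) -> v = 0.
Proof.
move=> v0 v0'; apply/rowP => l; rewrite [RHS]mxE; apply/eqP.
by rewrite eq_le v0 -oppr_ge0 andbT; have := v0' l; rewrite mxE.
Qed.

Lemma simple_root_nonneg i : nonneg (a_ i).
Proof. by move=> l; rewrite simple_rootE ler0n. Qed.

Lemma act_simple_form x i : B (act x (a_ i)) (act x (a_ i)) = 1.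
Proof. by rewrite act_form ?bform_simple1. Qed.

Lemma form1_neq0 b : B b b = 1 -> b <> 0.
Proof. by move=> b1 b0; move: b1; rewrite b0 bform0l => /esym/eqP; rewrite oner_eq0. Qed.

Lemma act_simpleM x i : act (x * s i)%g (a_ i) = - act x (a_ i).
Proof. by rewrite actM // act_simple_self // actN. Qed.

Lemma act_simple_le0 x i : (len (x * s i) <= len x)%N -> nonneg (- act x (a_ i)).
Proof.
move=> lx; rewrite -act_simpleM; apply: act_simple_ge0 => //.
by rewrite (simple_mulK coxWS).
Qed.

Lemma act_simple_sign x i : nonneg (act x (a_ i)) \/ nonneg (- act x (a_ i)).
Proof.
case: (leqP (len x) (len (x * s i))) => lx; first by left; apply: act_simple_ge0.
by right; apply: act_simple_le0; rewrite ltnW.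
Qed.

Lemma act_simple_nonneg x i : nonneg (act x (a_ i)) <-> (len x < len (x * s i))%N.
Proof.
split=> [x0|/ltnW lx]; last exact: act_simple_ge0.
rewrite ltnNge; apply/negP => /act_simple_le0 /(nonneg_eq0 x0).
exact: form1_neq0 (act_simple_form x i).
Qed.

Lemma act_simple_nonpos x i : nonneg (- act x (a_ i)) <-> (len (x * s i) < len x)%N.
Proof. by rewrite -act_simpleM act_simple_nonneg (simple_mulK coxWS). Qed.

Lemma act_nonneg_eq1 x : (forall i, nonneg (act x (a_ i))) -> x = 1%g.
Proof.
move=> x0; have [->//|x1] := eqVneq x 1%g; exfalso.
have [i lx] := coxeter_length_last coxWS (elimN eqP x1).
by have /act_simple_nonneg := x0 i; rewrite -lx; lia.
Qed.

Lemma act_faithful x y : (forall i, act x (a_ i) = act y (a_ i)) -> x = y.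
Proof.
move=> xy; apply: (mulgI y^-1%g); rewrite mulVg; apply: act_nonneg_eq1 => i.
by rewrite actM // xy actK //; exact: simple_root_nonneg.
Qed.

Lemma coxeter_length_inv x : len x^-1%g = len x.
Proof.
have le z : (len z^-1%g <= len z)%N.
  have [w <- <-] := coxeter_length_word coxWS z; elim/last_ind: w => [|w i IH].
    by rewrite word_prod_nil invg1 (coxeter_length1 coxWS).
  rewrite word_prod_rcons invgM size_rcons (simple_invg coxWS).
  have [u uw su] := coxeter_length_word coxWS (word_prod s w)^-1%g.
  rewrite -uw -word_prod_cons; apply: leq_trans (coxeter_length_le coxWS _) _.
  by rewrite /= su ltnS.
by apply/eqP; rewrite eqn_leq le -{1}(invgK x) le.
Qed.

Lemma root_simple i : Phi (a_ i).
Proof. by exists 1%g, i; rewrite act1. Qed.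

Lemma root_act x b : Phi b -> Phi (act x b).
Proof. by case=> y [i ->]; exists (x * y)%g, i; rewrite actM. Qed.

Lemma coxeter_rootN b : Phi b -> Phi (- b).
Proof. by case=> y [i ->]; exists (y * s i)%g, i; rewrite act_simpleM. Qed.

Lemma root_form b : Phi b -> B b b = 1.
Proof. by case=> x [i ->]; exact: act_simple_form. Qed.

Lemma root_neq0 b : Phi b -> b <> 0.
Proof. by move=> /root_form /form1_neq0. Qed.

Lemma negative_rootsP b : neg b <-> pos (- b).
Proof.
split=> [[c pc <-]|pb]; first by rewrite opprK.
by exists (- b); rewrite ?opprK.
Qed.

Lemma root_sign b : Phi b -> pos b \/ neg b.
Proof.
move=> Pb; have [x [i bE]] := Pb; have [b0|b0] := act_simple_sign x i.
  by left; split=> //; rewrite bE.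
by right; apply/negative_rootsP; split; [exact: coxeter_rootN|rewrite bE].
Qed.

Lemma positive_not_negative b : pos b -> neg b -> False.
Proof.
move=> [Pb b0] /negative_rootsP [_ b0'].
exact: (root_neq0 Pb) (nonneg_eq0 b0 b0').
Qed.

Lemma positive_simple i : pos (a_ i).
Proof. by split; [exact: root_simple|exact: simple_root_nonneg]. Qed.

Lemma root_reflection b : Phi b -> exists t, forall v, act t v = reflection m b v.
Proof.
case=> x [i ->]; exists (x * s i * x^-1)%g => v.
rewrite !actM // act_simple // /simple_refl /reflection actD // actN // actZ // actVK //.
by rewrite -(act_form coxWS x (act x^-1%g v)) actVK.
Qed.

Lemma root_reflect b c : Phi b -> Phi c -> Phi (reflection m b c).
Proof.
by move=> /root_reflection[t tE] Pc; rewrite -tE; exact: root_act.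
Qed.

Lemma positive_root_nonsimple b i : pos b -> b <> a_ i ->
  exists2 j, j != i & 0 < b 0 j.
Proof.
move=> [Pb b0] bi; apply: contrapT => noj.
have bj j : j != i -> b 0 j = 0.
  move=> ji; apply/eqP; rewrite eq_le b0 andbT leNgt; apply/negP => bj0.
  by apply: noj; exists j.
have bE : b = b 0 i *: a_ i.
  apply/rowP => j; rewrite mxE simple_rootE.
  by have [->|/bj ->] := eqVneq j i; rewrite ?mulr1 ?mulr0.
apply: bi; rewrite bE; suff -> : b 0 i = 1 by rewrite scale1r.
apply/eqP; rewrite -(@eqrXn2 _ 2) ?b0// expr1n expr2.
by have := root_form Pb; rewrite {1 2}bE bformZl bformZr bform_simple1// mulr1 => ->.
Qed.

(** The reflection changes only coordinate [i], so another positive coordinate survives and excludes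
    a negative root. *)
Lemma positive_simple_refl b i : pos b -> b <> a_ i -> pos (act (s i) b).
Proof.
move=> pb bi; have [j ji bj0] := positive_root_nonsimple pb bi.
have Pb : Phi (act (s i) b) by apply: root_act; case: pb.
have [//|/negative_rootsP[_ /(_ j)]] := root_sign Pb.
rewrite act_simple // !mxE eqxx (negbTE ji) mulr0 subr0.
by rewrite oppr_ge0 leNgt bj0.
Qed.

Lemma inv_set1 : N 1%g = set0.
Proof.
rewrite -subset0 => b [pb]; rewrite invg1 act1 //; exact: positive_not_negative.
Qed.

Lemma inv_set_simple x i : N x (a_ i) <-> (len (s i * x) < len x)%N.
Proof.
rewrite -(coxeter_length_inv x) -(coxeter_length_inv (s i * x)) invgM (simple_invg coxWS) //.
rewrite -act_simple_nonpos; split=> [[_ /negative_rootsP[]]//|nx].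
split; first exact: positive_simple.
by apply/negative_rootsP; split=> //; apply: coxeter_rootN; apply: root_act; exact: root_simple.
Qed.

Lemma inv_set_simpleM x i b : pos b -> b <> a_ i ->
  N (s i * x)%g b <-> N x (act (s i) b).
Proof.
move=> pb bi; have pb' := positive_simple_refl pb bi.
by rewrite /inv_set /= invgM (simple_invg coxWS) // actM //; split=> -[].
Qed.

Lemma inv_set_simpleV x i : N (s i * x)%g (a_ i) <-> ~ N x (a_ i).
Proof.
rewrite !inv_set_simple (simple_mulKl coxWS) //; split=> [lx|/negP]; first by apply/negP; lia.
rewrite -leqNgt leq_eqVlt => /orP[/eqP|//].
have := act_simple_sign x^-1%g i.
rewrite act_simple_nonneg act_simple_nonpos.
have <- : ((s i * x)^-1 = x^-1 * s i)%g by rewrite invgM (simple_invg coxWS).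
by rewrite !coxeter_length_inv => + E; rewrite -E ltnn; case.
Qed.

Lemma inv_set_sub_word w :
  N (word_prod s w) `<=` [set b | exists2 k, (k < size w)%N &
    exists i, b = word_act m (take k w) (a_ i)].
Proof.
elim: w => [|i w IH] b; first by rewrite word_prod_nil inv_set1.
have [-> _|bi] := eqVneq b (a_ i); first by exists 0%N => //; exists i.
rewrite word_prod_cons => Nb; have [pb _] := Nb.
move/inv_set_simpleM : Nb => /(_ pb (elimN eqP bi)) /IH[k kw [j bj]].
exists k.+1 => //=; exists j; rewrite -bj act_simple // simple_reflK //.
Qed.

Lemma finite_inv_set x : finite_set (N x).
Proof.
have [w <-] := word_prod_surj coxWS x; apply: sub_finite_set (@inv_set_sub_word w) _.
have -> : [set b | exists2 k, (k < size w)%N & exists i, b = word_act m (take k w) (a_ i)]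
  = (fun ki => word_act m (take ki.1 w) (a_ ki.2)) @` (`I_(size w) `*` [set: 'I_n]).
  apply/seteqP; split=> b /=.
    by move=> [k kw [i ->]]; exists (k, i).
  by move=> [[k i] [/= kw _] <-]; exists k => //; exists i.
by apply: finite_image; apply: finite_setX => //; exact: finite_finset.
Qed.

Lemma reduced_cons i w : reduced s (i :: w) ->
  [/\ reduced s w, N (word_prod s (i :: w)) (a_ i) &
      ~ N (word_prod s w) (a_ i)].
Proof.
move=> /(reducedP coxWS); rewrite word_prod_cons => sw.
have lw : (len (word_prod s w) < len (s i * word_prod s w)%g)%N.
  by rewrite -sw ltnS (coxeter_length_le coxWS).
have Ni : N (s i * word_prod s w)%g (a_ i).
  by apply/inv_set_simple; rewrite (simple_mulKl coxWS).
split=> //; last exact/inv_set_simpleV.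
apply/(reducedP coxWS); apply/eqP; rewrite eqn_leq (coxeter_length_le coxWS) // andbT.
rewrite -ltnS -[X in (X < _)%N]/(size (i :: w)).-1.
have [u uw su] := coxeter_length_word coxWS (word_prod s w).
have := coxeter_length_le coxWS (i :: u); rewrite word_prod_cons uw -sw /= su; lia.
Qed.

Lemma cons_reduced i w : reduced s w -> ~ N (word_prod s w) (a_ i) ->
  reduced s (i :: w).
Proof.
move=> /(reducedP coxWS) sw nN; apply/(reducedP coxWS); apply/eqP.
rewrite eqn_leq (coxeter_length_le coxWS) // andbT /= sw word_prod_cons.
have /inv_set_simpleV/inv_set_simple : ~ N (word_prod s w) (a_ i) by [].
by rewrite (simple_mulKl coxWS).
Qed.

Lemma reduced_catl w w' : reduced s (w ++ w') -> reduced s w.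
Proof.
move=> red u uw; have := red (u ++ w').
by rewrite !word_prod_cat uw !size_cat leq_add2r; exact.
Qed.

Lemma inv_set_prefix w w' : reduced s (w ++ w') ->
  N (word_prod s w) `<=` N (word_prod s (w ++ w')).
Proof.
elim: w => [|i w IH]; first by rewrite word_prod_nil inv_set1.
move=> red b Nb; have [pb _] := Nb; have [red' Ni _] := reduced_cons red.
have [->//|/eqP bi] := eqVneq b (a_ i).
rewrite cat_cons word_prod_cons; apply/inv_set_simpleM => //; apply: IH => //.
by apply/inv_set_simpleM => //; rewrite -word_prod_cons.
Qed.

(** Inclusion of inversion sets is thus the prefix order. The first letter [i] is cancelled on both
    sides: away from [a_ i], the map [act (s i)] carries the inversions of [s i * x] to those of
    [x], so the inclusion is inherited by the rest of the word. *)
Lemma inv_set_sub_extend w x : reduced s w -> N (word_prod s w) `<=` N x ->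
  exists2 w', reduced s (w ++ w') & word_prod s (w ++ w') = x.
Proof.
elim: w x => [|i w IH] x.
  by move=> _ _; have [w <- red] := reduced_word coxWS x; exists w.
move=> red Nsub; have [red' Ni nNi] := reduced_cons red.
have nNi' : ~ N (s i * x)%g (a_ i) by move/inv_set_simpleV; apply; exact: Nsub.
have [|w' redw' w'x] := IH (s i * x)%g red'.
  move=> b Nb; have [pb _] := Nb.
  have bi : b <> a_ i by move=> bi; apply: nNi; rewrite -bi.
  apply/inv_set_simpleM => //; apply: Nsub; rewrite word_prod_cons.
  have pb' := positive_simple_refl pb bi.
  have sbi : act (s i) b <> a_ i.
    move=> sb; apply: (@positive_not_negative b) => //; apply/negative_rootsP.
    by rewrite -(actK coxWS (s i) b) sb (simple_invg coxWS) // act_simple_self // opprK; exact: positive_simple.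
  by apply/inv_set_simpleM => //; rewrite -actM // (simple_mul_self coxWS) // act1.
have E : word_prod s ((i :: w) ++ w') = x.
  by rewrite cat_cons word_prod_cons w'x (simple_mulKl coxWS).
exists w' => //=; apply: cons_reduced => //; by rewrite w'x.
Qed.

Lemma inv_set_inj : injective N.
Proof.
move=> x y Nxy; have [w wx red] := reduced_word coxWS x.
have [|w' red' w'y] := @inv_set_sub_extend w y red; first by rewrite wx Nxy.
have [u uy redu] := reduced_word coxWS y.
have [|u' redu' u'x] := @inv_set_sub_extend u x redu; first by rewrite uy Nxy.
have : (size (w ++ w') <= size u)%N by apply: red'; rewrite uy.
have : (size (u ++ u') <= size w)%N by apply: redu'; rewrite u'x.
rewrite !size_cat => le1 le2; have w'0 : w' = [::] by apply: size0nil; lia.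
by rewrite -wx -w'y w'0 cats0.
Qed.

Lemma positive_root_inv_set b : pos b -> exists x, N x b.
Proof.
move=> pb; have [[x [i bE]] _] := pb; exists (x * s i)%g; split=> //.
rewrite bE invgM actM // actK // (simple_invg coxWS) // act_simple_self //.
by apply/negative_rootsP; rewrite opprK; exact: positive_simple.
Qed.

(* Iterating the two reflections produces infinitely many distinct roots, all of
   them nonnegative combinations of [a] and [b]. *)
Lemma inv_set_form_gt x a b : N x a -> N x b -> -1 < B a b.
Proof.
move=> Na Nb; rewrite ltNge; apply/negP => ab.
have [[Pa a0] /negative_rootsP[_ xa0]] := Na.
have [[Pb b0] /negative_rootsP[_ xb0]] := Nb.
set c := - B a b; have c1 : 1 <= c by rewrite /c; lra.
have abE : B a b = - c by rewrite opprK.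
(* As [c] is at least 1, the coefficients grow by at least 1 at each step. Besides nonnegativity
   this yields distinctness, read off at a coordinate where [a] is positive. *)
have Sge k : 0 <= dihedral_coef c k /\ dihedral_coef c k + 1 <= dihedral_coef c k.+1.
  elim: k => [|k [IH0 IH1]]; first by rewrite /=; split; lra.
  split; [lra|rewrite dihedral_coefSS]; nra.
pose r k := dihedral_coef c k.+1 *: a + dihedral_coef c k *: b.
pose r' k := dihedral_coef c k *: a + dihedral_coef c k.+1 *: b.
have Pr k : Phi (r k) /\ Phi (r' k).
  elim: k => [|k [IH IH']]; first by rewrite /r /r' /= !scale1r !scale0r addr0 add0r.
  have -> : r k.+1 = reflection m a (r' k).
    rewrite /reflection /r /r' dihedral_coefSS bformDl !bformZl (root_form Pa) -/c.
    rewrite (bformC cox b) abE.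
    by apply/rowP => l; rewrite !mxE; ring.
  have -> : r' k.+1 = reflection m b (r k).
    rewrite /reflection /r /r' dihedral_coefSS bformDl !bformZl (root_form Pb) -/c.
    rewrite abE.
    by apply/rowP => l; rewrite !mxE; ring.
  by split; exact: root_reflect.
have Nr k : N x (r k).
  have [S0 _] := Sge k; have [S1 _] := Sge k.+1; have [P1 _] := Pr k.
  split; first by split=> //; apply: nonnegD; apply: nonnegZ.
  apply/negative_rootsP; split; first exact/coxeter_rootN/root_act.
  rewrite actD // !actZ // opprD -!scalerN.
  by apply: nonnegD; apply: nonnegZ.
have [l al0] : exists l, 0 < a 0 l.
  apply: contrapT => nol; apply: (root_neq0 Pa); apply: nonneg_eq0 => // l.
  by rewrite mxE oppr_ge0 leNgt; apply/negP => al; apply: nol; exists l.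
have rS k : r k 0 l < r k.+1 0 l.
  rewrite !mxE; have [_ S0] := Sge k; have [_ S1] := Sge k.+1; have := b0 l.
  move: (dihedral_coef c k) (dihedral_coef c k.+1) (dihedral_coef c k.+2) S0 S1.
  by move=> z0 z1 z2 ? ? ?; nra.
have r_inj : injective r.
  have r_lt (j k : nat) : (j < k)%N -> r j 0 l < r k 0 l.
    elim: k => // k IH; rewrite ltnS leq_eqVlt => /orP[/eqP ->//|/IH rjk].
    exact: lt_trans (rS k).
  by move=> /= j k rjk; case: (ltngtP (j : nat) k) => // jk; have := r_lt _ _ jk; rewrite rjk ltxx.
apply: (@infinite_nat); apply: sub_finite_set (_ : finite_set (r @^-1` N x)).
  by move=> k _; exact: Nr.
by apply: finite_preimage (finite_inv_set x) => j k _ _; exact: r_inj.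
Qed.

End Roots.

(** * Infinite reduced words *)

Section InfiniteWords.
Context (R : realType) (n : nat) (m : 'M[nat]_n) (W : groupType)
  (s : 'I_n -> W).
Hypothesis coxWS : coxeter_system m s.
Hypothesis infW : infinite_set [set: W].
Local Notation B := (bform (R := R) m).
Local Notation a_ := (@simple_root R n).
Local Notation act := (@act R n m W s).
Local Notation len := (coxeter_length s).
Local Notation Phi := (@Defs.roots R n m W s).
Local Notation pos := (@positive_roots R n m W s).
Local Notation neg := (@negative_roots R n m W s).
Local Notation N := (@inv_set R n m W s).
Local Notation Nseq := (@inv_set_seq R n m W s).
Local Notation Nbar := (@inv_set_bar R n m W s).
Implicit Types (w : seq 'I_n) (x y u v : W) (p q : nat -> 'I_n).

Let cox : coxeter_matrix m. Proof. by case: coxWS. Qed.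

Lemma finite_bounded_length k : finite_set [set x : W | (len x <= k)%N].
Proof.
apply: (@sub_finite_set _ _ ((fun t : k.-bseq 'I_n => word_prod s t) @` setT)).
  move=> x /= lx; have [w wx sw] := coxeter_length_word coxWS x.
  have wk : (size w <= k)%N by rewrite sw.
  by exists (Bseq wk).
by apply: finite_image; exact: finite_finset.
Qed.

Lemma inv_set_len x y : N x `<=` N y -> (len x <= len y)%N.
Proof.
have [w <- red] := reduced_word coxWS x => /(inv_set_sub_extend coxWS red)[w' red' <-].
rewrite -(reducedP coxWS _).1 // -(reducedP coxWS _).1 //.
by rewrite size_cat leq_addr.
Qed.

(** An element without ascent would send every positive root to a negative one. The inversion set of
    its inverse would then contain all others, bounding all lengths and making [W] finite. *)
Lemma ascent_exists x : exists i, (len x < len (x * s i)%g)%N.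
Proof.
apply: contrapT => noasc; apply: infW.
have xneg i : nonneg (- act x (a_ i)).
  apply: act_simple_le0 => //; rewrite leqNgt; apply/negP => lx.
  by apply: noasc; exists i.
apply: sub_finite_set (finite_bounded_length (len x^-1%g)) => y _ /=.
apply: inv_set_len => b [pb _]; split=> //; rewrite invgK.
apply/negative_rootsP; have [Pb b0] := pb; split; first by apply: coxeter_rootN => //; exact: root_act.
rewrite (row_sum_simple b) act_sum // -sumrN.
elim/big_ind: _ => [l||i _]; [by rewrite mxE | exact: nonnegD |].
by rewrite actZ // -scalerN; apply: nonnegZ.
Qed.

Lemma reduced_ascent w i : reduced s w ->
  (len (word_prod s w) < len (word_prod s w * s i)%g)%N -> reduced s (rcons w i).
Proof.
move=> /(reducedP coxWS) sw lw; apply/(reducedP coxWS); apply/eqP.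
rewrite eqn_leq (coxeter_length_le coxWS) andbT size_rcons sw.
by rewrite word_prod_rcons.
Qed.

Lemma inv_set_ascent x i : (len x < len (x * s i)%g)%N -> N x `<=` N (x * s i)%g.
Proof.
have [w <- red] := reduced_word coxWS x => lw.
rewrite -word_prod_rcons -cats1; apply: inv_set_prefix => //.
by rewrite cats1; exact: reduced_ascent.
Qed.

Lemma mkseqD p k l : mkseq p (k + l) = mkseq p k ++ map p (iota k l).
Proof. by rewrite /mkseq iotaD map_cat. Qed.

Lemma inv_set_mkseq_mono p k l : infinite_reduced s p -> (k <= l)%N ->
  N (word_prod s (mkseq p k)) `<=` N (word_prod s (mkseq p l)).
Proof.
move=> red kl; have := red l; rewrite -(subnKC kl) mkseqD => red'.
exact: inv_set_prefix.
Qed.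

Lemma inv_set_seqP p b : infinite_reduced s p ->
  Nseq p b <-> exists k, N (word_prod s (mkseq p k)) b.
Proof.
move=> red; split=> [[k _ Nb]|[k Nb]]; first by exists k.
by exists k.+1 => //; apply: inv_set_mkseq_mono Nb.
Qed.

Lemma inv_set_seq_finite p (F : set 'rV[R]_n) : infinite_reduced s p ->
  finite_set F -> F `<=` Nseq p ->
  exists k, F `<=` N (word_prod s (mkseq p k)).
Proof.
move=> red /finite_seqP[r ->]; elim: r => [|b r IH] rN; first by exists 0%N.
have [k kr] : exists k, [set` r] `<=` N (word_prod s (mkseq p k)).
  by apply: IH => c /= cr; apply: rN; rewrite /= inE cr orbT.
have /(inv_set_seqP _ red)[l lb] : Nseq p b by apply: rN; rewrite /= inE eqxx.
exists (maxn k l) => c /=; rewrite inE => /predU1P[->|cr].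
  by apply: inv_set_mkseq_mono lb; rewrite // leq_maxr.
by apply: inv_set_mkseq_mono (kr c cr); rewrite // leq_maxl.
Qed.

Lemma inv_set_seq_not_sub p x : infinite_reduced s p -> ~ (Nseq p `<=` N x).
Proof.
move=> red Nsub; have /(reducedP coxWS) := red (len x).+1; rewrite size_mkseq => lx.
have : ((len x).+1 <= len x)%N; last by rewrite ltnn.
rewrite {1}lx; apply: inv_set_len => b Nb.
by apply: Nsub; apply/inv_set_seqP => //; exists (len x).+1.
Qed.

(** By [inv_set_sub_extend] a reduced word of each [u k] extends to one of the next term; strict
    growth makes the limit an infinite word. *)
Lemma inv_set_chain (u : nat -> W) : (forall k, N (u k) `<=` N (u k.+1)) ->
  (forall k, u k <> u k.+1) ->
  exists2 p, infinite_reduced s p & Nseq p = \bigcup_k N (u k).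
Proof.
(* [i0] is only a default for [nth]. It is never read, because [wd i.+1] has at least [i.+1]
   letters. *)
move=> uS uneq; have [i0 _] := ascent_exists 1%g.
have [w0 w0u red0] := reduced_word coxWS (u 0%N).
pose ext k w := xget [::] [set w' | reduced s (w ++ w') /\
                                    word_prod s (w ++ w') = u k.+1].
pose wd := nat_rect (fun _ => seq 'I_n) w0 (fun k w => w ++ ext k w).
have wdP k : reduced s (wd k) /\ word_prod s (wd k) = u k.
  elim: k => // k [red wu] /=; rewrite -/(wd k) /ext; case: xgetP => //= noext.
  have [|w' redw w'u] := @inv_set_sub_extend R _ _ _ _ coxWS (wd k) (u k.+1) red.
    by rewrite wu; exact: uS.
  by case: (noext w').
have wd_size k : (k <= size (wd k))%N.
  elim: k => // k IH /=; rewrite -/(wd k) size_cat.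
  suff : ext k (wd k) != [::] by case: (ext k (wd k)) => //= ? ? _; lia.
  apply/negP => /eqP ext0; apply: (uneq k).
  by rewrite -(wdP k).2 -(wdP k.+1).2 /= -/(wd k) ext0 cats0.
have wd_prefix k l : (k <= l)%N -> exists w', wd l = wd k ++ w'.
  move=> kl; rewrite -(subnKC kl); elim: (l - k)%N => [|j [w' E]].
    by exists [::]; rewrite addn0 cats0.
  by exists (w' ++ ext (k + j)%N (wd (k + j)%N)); rewrite addnS /= -/(wd _) catA -E.
pose p i := nth i0 (wd i.+1) i.
have pE k : mkseq p k = take k (wd k).
  apply: (@eq_from_nth _ i0); first by rewrite size_mkseq size_takel.
  move=> i; rewrite size_mkseq => ik; rewrite nth_mkseq // nth_take // /p.
  have [w' ->] := wd_prefix _ _ ik; rewrite nth_cat.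
  by rewrite ifT // (leq_trans _ (wd_size _)).
have pred : infinite_reduced s p.
  move=> k; rewrite pE; apply: (reduced_catl (w' := drop k (wd k))).
  by rewrite cat_take_drop; case: (wdP k).
have wdE k : wd k = mkseq p (size (wd k)).
  rewrite pE; have [w' ->] := wd_prefix _ _ (wd_size k); by rewrite take_size_cat.
exists p => //; apply/seteqP; split=> b.
  move=> /(inv_set_seqP _ pred)[k Nb]; exists k => //.
  have [redk <-] := wdP k; rewrite -(cat_take_drop k (wd k)) -pE.
  by apply: inv_set_prefix Nb => //; rewrite pE cat_take_drop.
move=> [k _]; have [_ <-] := wdP k; rewrite wdE => Nb.
by apply/inv_set_seqP => //; exists (size (wd k)).
Qed.

Definition bar_of_seq p (red : infinite_reduced s p) : Wbar R m s :=
  inl (\pi_({eq_quot (seq_equiv_rel R m s)})%qT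
         (exist _ p (mem_set red) : infinite_reduced s)).

Lemma inv_set_bar_of_seq p (red : infinite_reduced s p) :
  Nbar (bar_of_seq red) = Nseq p.
Proof. by rewrite /= inv_set_infinite_pi. Qed.

Lemma bar_of_seq_surj (z : Wbar R m s) :
  (exists p (red : infinite_reduced s p), z = bar_of_seq red) \/
  exists x, z = inr x.
Proof.
case: z => [c|x]; [left|by right; exists x].
case: (repr (c : {eq_quot (seq_equiv_rel R m s)}%qT))
  (reprK (c : {eq_quot (seq_equiv_rel R m s)}%qT)) => p pin <-.
exists p, (set_mem pin); congr (inl (\pi_ _ _)%qT); exact: val_inj.
Qed.

(** This makes [weak_le] antisymmetric, so maximality can be tested on inversion sets. An infinite
    word cannot agree with an element, whose length would bound all its prefixes. *)
Lemma inv_set_bar_inj : injective Nbar.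
Proof.
move=> z z'.
case: (bar_of_seq_surj z) => [[p [red ->]]|[x ->]];
  case: (bar_of_seq_surj z') => [[q [red' ->]]|[y ->]].
- rewrite !inv_set_bar_of_seq => E; congr inl; apply/eqmodP => /=.
  by apply/eqP.
- by rewrite inv_set_bar_of_seq => E; case: (@inv_set_seq_not_sub p y red); rewrite E.
- by rewrite inv_set_bar_of_seq => E; case: (@inv_set_seq_not_sub q x red'); rewrite -E.
- by move=> /= /(inv_set_inj coxWS) ->.
Qed.

Lemma weak_maximal_seq (z : Wbar R m s) : weak_maximal z ->
  exists p (red : infinite_reduced s p), z = bar_of_seq red.
Proof.
move=> zmax; case: (bar_of_seq_surj z) => // -[x zx]; exfalso.
have [i lx] := ascent_exists x.
have := zmax (inr (x * s i)%g); rewrite zx => /(_ (inv_set_ascent lx))[xx].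
by rewrite xx ltnn in lx.
Qed.

Lemma inv_set_bar_finite (z : Wbar R m s) (F : set 'rV[R]_n) :
  finite_set F -> F `<=` Nbar z -> exists x, F `<=` N x.
Proof.
move=> finF; case: (bar_of_seq_surj z) => [[p [red ->]]|[x ->]]; last by exists x.
rewrite inv_set_bar_of_seq => /(inv_set_seq_finite red finF)[k kF].
by exists (word_prod s (mkseq p k)).
Qed.

Lemma roots_enum : exists e : nat -> 'rV[R]_n, Phi `<=` range e.
Proof.
exists (fun k => if @unpickle (seq 'I_n * 'I_n)%type k is Some wi
                 then word_act m wi.1 (a_ wi.2) else 0).
move=> b [x [i ->]]; have [w <-] := word_prod_surj coxWS x.
by exists (pickle (w, i)) => //; rewrite pickleK actE.
Qed.

(* Adjoin the roots one after the other, each time it is possible. *)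
Lemma weak_maximal_above x : exists2 z : Wbar R m s, weak_maximal z & N x `<=` Nbar z.
Proof.
have [e eP] := roots_enum.
(* Stage [k] decides the root [e k]: it is adjoined as soon as some element above the current one
   contains it. Strictness of the step is required by [inv_set_chain]. *)
pose step (uk : W * nat) u' := [/\ N uk.1 `<=` N u', uk.1 <> u' &
  forall v, N uk.1 `<=` N v -> N v (e uk.2) -> N u' (e uk.2)].
have /choice[f fP] : forall uk, exists u', step uk u'.
  move=> [u k]; have [[v [uv vk]]|nov] := pselect (exists v, N u `<=` N v /\ N v (e k)).
  - have [i lv] := ascent_exists v; exists (v * s i)%g; split=> /=.
    + exact: subset_trans (inv_set_ascent lv).
    + by move=> E; have := inv_set_len uv; rewrite E leqNgt lv.
    + by move=> _ _ _; apply: inv_set_ascent vk.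
  - have [i lu] := ascent_exists u; exists (u * s i)%g; split=> /=.
    + exact: inv_set_ascent.
    + by move=> E; rewrite -E ltnn in lu.
    + by move=> v uv vk; case: nov; exists v.
pose u := nat_rect (fun _ => W) x (fun k u => f (u, k)).
have uS k : N (u k) `<=` N (u k.+1) by case: (fP (u k, k)).
have [|p red pE] := inv_set_chain uS; first by move=> k; case: (fP (u k, k)).
exists (bar_of_seq red); last first.
  by rewrite inv_set_bar_of_seq pE => b Nb; exists 0%N.
move=> z; rewrite /weak_le inv_set_bar_of_seq => pz; apply: inv_set_bar_inj.
rewrite inv_set_bar_of_seq; apply/seteqP; split=> // b zb.
have [k _ kb] : range e b.
  apply: eP; have [|y /(_ b erefl)[[]//]] := @inv_set_bar_finite z _ (finite_set1 b).
  by move=> c ->.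
(* Such an element witnesses that [b], which is [e k], could be adjoined at stage [k]; hence it
   was. *)
have [y yF] : exists y, N (u k) `|` [set b] `<=` N y.
  apply: (@inv_set_bar_finite z).
    by rewrite finite_setU; split; [exact: finite_inv_set|exact: finite_set1].
  move=> c [ukc|->//]; apply: pz; rewrite pE; by exists k.
rewrite pE; exists k.+1 => //=; rewrite -kb.
have [_ _ /(_ y)] := fP (u k, k); apply=> /=; last by rewrite kb; apply: yF; right.
by move=> c ukc; apply: yF; left.
Qed.

End InfiniteWords.

(** * The Perron-Frobenius vector *)

Lemma finite_set_inj (T U : Type) (A : set T) (C : set U) (f : T -> U) :
  finite_set C -> (forall x, A x -> C (f x)) ->
  (forall x y, A x -> A y -> f x = f y -> x = y) -> finite_set A.
Proof.
move=> finC AC finj; have [[a Aa]|A0] := pselect (A !=set0); last first.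
  by have -> : A = set0; [apply/seteqP; split=> // x Ax; case: A0; exists x|].
have /choice[g gP] : forall c, exists x, (exists2 x, A x & f x = c) -> A x /\ f x = c.
  move=> c; have [[x Ax fx]|no] := pselect (exists2 x, A x & f x = c).
    by exists x.
  by exists a => /no.
apply: sub_finite_set (finite_image g finC) => x Ax; exists (f x); first exact: AC.
by have [|Ag fg] := gP (f x); [exists x | exact: finj].
Qed.

(** Finitely many cubes of side [h] cover the bounded region, and each contains at most one point of
    [A]. *)
Lemma finite_grid_separated (R : realType) d (A : set 'rV[R]_d) (K h : R) :
  0 < h -> (forall u i, A u -> `|u 0 i| <= K) ->
  (forall u v, A u -> A v -> (forall i, `|u 0 i - v 0 i| < h) -> u = v) ->
  finite_set A.
Proof.
move=> h0 AK sep; pose L := (Num.bound (K / h)).+1.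
have fl u i : A u -> - (L%:Z) <= Num.floor (u 0 i / h) < L%:Z.
  move=> Au; have uK := AK u i Au.
  have hL : K / h < L%:R.
    apply: lt_le_trans (archi_boundP _) _.
      by rewrite divr_ge0 ?(le_trans (normr_ge0 _) uK)// ltW.
    by rewrite ler_nat.
  have : `|u 0 i / h| < L%:R.
    by apply: le_lt_trans hL; rewrite normrM (gtr0_norm (_ : 0 < h^-1)) ?invr_gt0// ler_pM2r ?invr_gt0.
  rewrite ltr_norml => /andP[l1 l2].
  rewrite floor_ge_int floor_lt_int mulrNz.
  by apply/andP; split; [exact: ltW | exact: l2].
apply: (@finite_set_inj _ {ffun 'I_d -> 'I_(L + L).+1} A setT
  (fun u => [ffun i => inord `|(Num.floor (u 0 i / h) + L%:Z)%R|%N])) => //.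
move=> u v Au Av /ffunP uv; apply: sep => // i; have := uv i; rewrite !ffunE.
have /andP[u1 u2] := fl u i Au; have /andP[v1 v2] := fl v i Av.
move/(congr1 val); rewrite /= !inordK; [|lia|lia].
move=> fE; have {}fE : Num.floor (u 0 i / h) = Num.floor (v 0 i / h) by lia.
have /andP[] := floor_itv (u 0 i / h); have /andP[] := floor_itv (v 0 i / h).
rewrite fE intrD !ler_pdivlMr// !ltr_pdivrMr// => b1 b2 b3 b4.
by rewrite ltr_norml; apply/andP; split; lra.
Qed.

Section Dot.
Context (R : realType) (n : nat).

Lemma dotE (u v : 'rV[R]_n) : dot u v = \sum_i u 0 i * v 0 i.
Proof. by rewrite /dot mxE; apply: eq_bigr => i _; rewrite mxE. Qed.

Lemma dot_ge0 (u : 'rV[R]_n) : 0 <= dot u u.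
Proof. by rewrite dotE sumr_ge0 // => i _; rewrite -expr2 sqr_ge0. Qed.

Lemma dot_coord_le (u : 'rV[R]_n) i : u 0 i ^+ 2 <= dot u u.
Proof.
rewrite dotE (bigD1 i) //= expr2 lerDl sumr_ge0 // => j _.
by rewrite -expr2 sqr_ge0.
Qed.

Lemma dot_eq0 (u : 'rV[R]_n) : dot u u = 0 -> u = 0.
Proof.
move=> u0; apply/rowP => i; rewrite mxE; apply/eqP.
by rewrite -sqrf_eq0 eq_le sqr_ge0 andbT -u0 dot_coord_le.
Qed.

Lemma dotZ c (u : 'rV[R]_n) : dot (c *: u) (c *: u) = c ^+ 2 * dot u u.
Proof.
by rewrite !dotE mulr_sumr; apply: eq_bigr => i _; rewrite !mxE; ring.
Qed.

Lemma dotC (u v : 'rV[R]_n) : dot u v = dot v u.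
Proof. by rewrite !dotE; apply: eq_bigr => i _; rewrite mulrC. Qed.

Lemma dotDl (u v w : 'rV[R]_n) : dot (u + v) w = dot u w + dot v w.
Proof. by rewrite /dot mulmxDl mxE. Qed.

Lemma dotZl c (u w : 'rV[R]_n) : dot (c *: u) w = c * dot u w.
Proof. by rewrite /dot -scalemxAl mxE. Qed.

Lemma dotDr (u v w : 'rV[R]_n) : dot w (u + v) = dot w u + dot w v.
Proof. by rewrite !(dotC w) dotDl. Qed.

Lemma dotZr c (u w : 'rV[R]_n) : dot w (c *: u) = c * dot w u.
Proof. by rewrite !(dotC w) dotZl. Qed.

Lemma dotNl (u w : 'rV[R]_n) : dot (- u) w = - dot u w.
Proof. by rewrite -scaleN1r dotZl mulN1r. Qed.

Lemma dotNr (u w : 'rV[R]_n) : dot w (- u) = - dot w u.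
Proof. by rewrite !(dotC w) dotNl. Qed.

Lemma dot0l (w : 'rV[R]_n) : dot 0 w = 0.
Proof. by rewrite -(scale0r (0 : 'rV_n)) dotZl mul0r. Qed.

Lemma dot0r (w : 'rV[R]_n) : dot w 0 = 0.
Proof. by rewrite dotC dot0l. Qed.

Definition dot_linE := (dotDl, dotZl, dotNl, dotDr, dotZr, dotNr).

End Dot.

Section Continuity.
Context (R : realType) (n : nat) (m : 'M[nat]_n).

Lemma continuous_sum (T : topologicalType) (I : Type) (r : seq I) (F : I -> T -> R) :
  (forall i, continuous (F i)) -> continuous (fun x => \sum_(i <- r) F i x).
Proof.
move=> Fc; elim: r => [|i r IH].
  rewrite (_ : (fun x => _) = cst 0); first exact: cst_continuous.
  by apply/funext => x; rewrite big_nil.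
rewrite (_ : (fun x => _) = (F i \+ (fun x => \sum_(j <- r) F j x))); last first.
  by apply/funext => x; rewrite big_cons.
by move=> x; apply: cvgD; [exact: Fc | exact: IH].
Qed.

Lemma continuous_mul (T : topologicalType) (f g : T -> R) :
  continuous f -> continuous g -> continuous (fun x => f x * g x).
Proof. by move=> fc gc x; apply: cvgM; [exact: fc | exact: gc]. Qed.

Lemma coord_rV_continuous i : continuous (fun u : 'rV[R]_n => u 0 i).
Proof. exact: coord_continuous. Qed.

Lemma dot_continuous : continuous (fun u : 'rV[R]_n => dot u u).
Proof.
have -> : (fun u : 'rV[R]_n => dot u u) = (fun u => \sum_i u 0 i * u 0 i).
  by apply/funext => u; rewrite dotE.
apply: continuous_sum => i; apply: continuous_mul; exact: coord_rV_continuous.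
Qed.

Lemma bform_continuous : continuous (fun u : 'rV[R]_n => bform m u u).
Proof.
have -> : (fun u : 'rV[R]_n => bform m u u) =
    (fun u => \sum_i u 0 i * \sum_j u 0 j * gram R m i j).
  apply/funext => u; rewrite bform_expandl; apply: eq_bigr => i _; congr (_ * _).
  by rewrite bform_expandr; apply: eq_bigr => j _; rewrite bform_simple.
apply: continuous_sum => i; apply: continuous_mul; first exact: coord_rV_continuous.
apply: continuous_sum => j; apply: continuous_mul; first exact: coord_rV_continuous.
exact: cst_continuous.
Qed.

(** The unit sphere is compact, so the form attains its minimum there; homogeneity extends the bound
    to all vectors. *)
Lemma rayleigh_min : (0 < n)%N -> exists (mu : R) (u : 'rV[R]_n),
  [/\ dot u u = 1, bform m u u = mu &
      forall v, mu * dot v v <= bform m v v].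
Proof.
move=> n0; pose S := [set u : 'rV[R]_n | dot u u = 1].
have S0 : S !=set0.
  exists (simple_root R (Ordinal n0)); rewrite /S /= dotE (bigD1 (Ordinal n0)) //=.
  rewrite simple_rootE eqxx mulr1 big1 ?addr0// => i /negbTE i0.
  by rewrite simple_rootE i0 mul0r.
have Sc : compact S.
  apply: (@subclosed_compact _ _ [set u : 'rV[R]_n | forall i, `[-1, 1]%classic (u 0 i)]).
  - rewrite (_ : S = (fun u => dot u u) @^-1` [set x | x = 1]) //.
    by apply: preimage_closed; [move=> u _; exact: dot_continuous | exact: closed_eq].
  - by have := @rV_compact R n (fun=> `[-1, 1]%classic); apply=> i; exact: segment_compact.
  - move=> u Su i; rewrite /= in_itv /= -ler_norml -(@ler_pXn2r _ 2) ?nnegrE//.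
    by rewrite expr1n real_normK ?num_real// -Su dot_coord_le.
have [u uS umin] := EVT_min_rV S0 Sc (continuous_subspaceT bform_continuous).
exists (bform m u u), u; split=> //; first by move: uS; rewrite inE.
move=> v; have [->|/eqP v0] := eqVneq v 0.
  by rewrite bform0l -(scale0r (0 : 'rV_n)) dotZ expr0n /= mul0r mulr0.
have dv : 0 < dot v v.
  by rewrite lt_neqAle dot_ge0 andbT; apply/eqP => /esym /dot_eq0.
have sv : 0 < Num.sqrt (dot v v) by rewrite sqrtr_gt0.
have := umin ((Num.sqrt (dot v v))^-1 *: v).
rewrite inE /S /= dotZ exprVn sqr_sqrtr ?dot_ge0// mulVf ?gt_eqF// => /(_ erefl).
rewrite bformZl bformZr mulrA -expr2 exprVn sqr_sqrtr ?dot_ge0//.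
by rewrite mulrC ler_pdivlMr.
Qed.

End Continuity.

Section PerronFrobenius.
Context (R : realType) (n : nat) (m : 'M[nat]_n).
Hypothesis cox : coxeter_matrix m.
Hypothesis irr : irreducible_coxeter m.
Local Notation B := (bform (R := R) m).
Local Notation a_ := (@simple_root R n).

Context (mu : R).
Hypothesis mu_le : forall u, mu * dot u u <= B u u.

Let Q (u v : 'rV[R]_n) := B u v - mu * dot u v.

Let QC u v : Q u v = Q v u. Proof. by rewrite /Q bformC // dotC. Qed.
Let QDl u v w : Q (u + v) w = Q u w + Q v w.
Proof. by rewrite /Q bformDl dotDl; ring. Qed.
Let QZl c u w : Q (c *: u) w = c * Q u w.
Proof. by rewrite /Q bformZl dotZl; ring. Qed.
Let QDZ u c v : Q (u + c *: v) (u + c *: v) = Q u u + 2 * c * Q u v + c ^+ 2 * Q v v.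
Proof. by rewrite QDl QZl !(QC _ (_ + _)) !QDl !QZl (QC v u); ring. Qed.
Let Q_ge0 u : 0 <= Q u u. Proof. by rewrite subr_ge0. Qed.

Let Q_iso u w : Q u u = 0 -> Q u w = 0.
Proof.
move=> u0; apply/eqP/negPn/negP => uw.
(* The coefficient is chosen so that [Q] would take the value -1 at this vector. *)
have := Q_ge0 (w - ((Q w w + 1) / (2 * Q u w)) *: u).
set t := (Q w w + 1) / (2 * Q u w).
rewrite -scaleNr QDZ u0 mulr0 addr0 (QC w u).
have -> : 2 * - t * Q u w = - (Q w w + 1) by rewrite /t; field.
lra.
Qed.

Let dot_simple u i : dot u (a_ i) = u 0 i.
Proof.
rewrite dotE (bigD1 i) //= simple_rootE eqxx mulr1 big1 ?addr0// => j ji.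
by rewrite simple_rootE (negbTE ji) mulr0.
Qed.

Let Q_expand u v : Q u v = \sum_i \sum_j u 0 i * v 0 j * Q (a_ i) (a_ j).
Proof.
rewrite {1}/Q bform_expandl dotE mulr_sumr -sumrB; apply: eq_bigr => i _.
rewrite bform_expandr mulr_sumr (bigD1 i) //= [RHS](bigD1 i) //= /Q.
have a1 : a_ i 0 i = 1 by rewrite simple_rootE eqxx.
rewrite !dot_simple a1.
have -> : \sum_(j | j != i) u 0 i * (v 0 j * B (a_ i) (a_ j)) =
    \sum_(j | j != i) u 0 i * v 0 j * (B (a_ i) (a_ j) - mu * dot (a_ i) (a_ j)).
  apply: eq_bigr => j ji; by rewrite dot_simple simple_rootE (negbTE ji) mulr0 subr0 mulrA.
by ring.
Qed.

Let absv (u : 'rV[R]_n) : 'rV[R]_n := \row_i `|u 0 i|.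

(** Off-diagonal Gram entries are nonpositive, so passing to absolute values lowers each mixed term
    and keeps the squares. *)
Let Q_abs u : Q (absv u) (absv u) <= Q u u.
Proof.
rewrite !Q_expand; apply: ler_sum => i _; apply: ler_sum => j _; rewrite !mxE.
have [->|ij] := eqVneq i j; first by rewrite -!expr2 real_normK ?num_real.
rewrite -normrM ler_wnM2r ?ler_norm// /Q bform_simple dot_simple simple_rootE.
by rewrite [j == i]eq_sym (negbTE ij) mulr0 subr0 gram_le0.
Qed.

(* The coordinatewise absolute value of an isotropic vector is isotropic, hence in
   the kernel; a zero coordinate then propagates along the Coxeter graph. *)
Lemma isotropic_zero_coord u i : B u u = mu * dot u u -> u 0 i = 0 -> u = 0.
Proof.
move=> iso ui; have Qu : Q u u = 0 by rewrite /Q iso subrr.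
have Qau : Q (absv u) (absv u) = 0.
  by apply/eqP; rewrite eq_le Q_ge0 andbT -Qu Q_abs.
have step k l : coxeter_edge m k l -> u 0 k = 0 -> u 0 l = 0.
  move=> kl uk; have := Q_iso (a_ k) Qau.
  rewrite /Q dot_simple mxE uk normr0 mulr0 subr0 bform_expandl => s0.
  have le0 j : true -> absv u 0 j * B (a_ j) (a_ k) <= 0.
    move=> _; rewrite mxE; have [->|jk] := eqVneq j k; first by rewrite uk normr0 mul0r.
    by rewrite mulr_ge0_le0 // bform_simple gram_le0.
  have /eqP := s0; rewrite -oppr_eq0 -sumrN psumr_eq0 => [|j _]; last by rewrite oppr_ge0 le0.
  move=> /allP /(_ l (mem_index_enum _)) /=; rewrite oppr_eq0 mulf_eq0 mxE normr_eq0.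
  case/orP => [/eqP//|]; rewrite bform_simple gram_sym// lt_eqF//.
  exact: gram_edge.
have ext k l : connect (coxeter_edge m) k l -> u 0 k = 0 -> u 0 l = 0.
  move=> /connectP[p pth ->]; elim: p k pth => //= j p IH k /andP[kj pth] uk.
  by apply: IH => //; apply: step kj uk.
by apply/rowP => j; rewrite mxE; apply: ext ui; case: irr.
Qed.

Lemma isotropic_kernel u v : B u u = mu * dot u u -> B u v = mu * dot u v.
Proof. by move=> iso; apply/eqP; rewrite -subr_eq0 -/(Q _ _) Q_iso // /Q iso subrr. Qed.

Lemma isotropic_pos u : B u u = mu * dot u u -> u <> 0 ->
  exists2 v : 'rV[R]_n, (forall i, 0 < v 0 i) & B v v = mu * dot v v.
Proof.
move=> iso u0; exists (absv u) => [i|].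
  rewrite mxE normr_gt0; apply/negP => /eqP ui; exact: u0 (isotropic_zero_coord iso ui).
apply/eqP; rewrite -subr_eq0 eq_le [X in _ && X]Q_ge0 andbT.
by apply: le_trans (Q_abs u) _; rewrite /Q iso subrr.
Qed.

(** Isotropic vectors of [Q] lie in its kernel, so the combination of [u] and [v] that cancels
    coordinate [i] is again isotropic, hence zero. *)
Lemma isotropic_line u v i : B u u = mu * dot u u -> B v v = mu * dot v v ->
  v 0 i != 0 -> u = (u 0 i / v 0 i) *: v.
Proof.
move=> iu iv vi; apply/eqP; rewrite -subr_eq0; apply/eqP.
apply: (@isotropic_zero_coord _ i); last by rewrite !mxE mulfVK ?subrr.
apply/eqP; rewrite -subr_eq0 -scaleNr; apply/eqP.
have Qu : Q u u = 0 by rewrite /Q iu subrr.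
have Qv : Q v v = 0 by rewrite /Q iv subrr.
by have := QDZ u (- (u 0 i / v 0 i)) v; rewrite Qu (Q_iso _ Qu) Qv !mulr0 !addr0.
Qed.

End PerronFrobenius.

Lemma perron_frobenius (R : realType) n (m : 'M[nat]_n) :
  coxeter_matrix m -> irreducible_coxeter m ->
  exists (mu : R) (v : 'rV[R]_n),
  [/\ forall i, 0 < v 0 i, forall u, bform m v u = mu * dot v u,
      forall u, mu * dot u u <= bform m u u &
      forall u, bform m u u = mu * dot u u -> exists c, u = c *: v].
Proof.
move=> cox irr; have [n0 _] := irr.
have [mu [u [u1 umu mu_le]]] := @rayleigh_min R n m n0.
have iso : bform m u u = mu * dot u u by rewrite u1 mulr1.
have u0 : u <> 0.
  by move=> u0; move: u1; rewrite u0 -(scale0r (0 : 'rV_n)) dotZ expr0n /= mul0r => /esym/eqP; rewrite oner_eq0.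
have [v v0 viso] := isotropic_pos cox irr mu_le iso u0.
exists mu, v; split=> // [w|w wiso]; first exact: isotropic_kernel.
exists (w 0 (Ordinal n0) / v 0 (Ordinal n0)).
by apply: isotropic_line wiso viso _ => //; rewrite gt_eqF.
Qed.

(** * Indefinite forms *)

Section Hyperbolic.
Context (R : realType) (n : nat) (m : 'M[nat]_n) (W : groupType)
  (s : 'I_n -> W).
Hypothesis coxWS : coxeter_system m s.
Local Notation B := (bform (R := R) m).
Local Notation a_ := (@simple_root R n).
Local Notation act := (@act R n m W s).
Local Notation Phi := (@Defs.roots R n m W s).
Local Notation pos := (@positive_roots R n m W s).
Local Notation N := (@inv_set R n m W s).
Local Notation Nbar := (@inv_set_bar R n m W s).
Implicit Types (u v b g : 'rV[R]_n) (x y : W) (i j : 'I_n).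

Let cox : coxeter_matrix m. Proof. by case: coxWS. Qed.

Lemma exp_unbounded (E C : R) : 1 < E -> exists2 k, (0 < k)%N & C <= E ^+ k.
Proof.
move=> E1; have h0 : 0 < E - 1 by lra.
have bern k : 1 + k%:R * (E - 1) <= E ^+ k.
  elim: k => [|k IH]; first by rewrite mul0r addr0 expr0.
  rewrite exprS -natr1; have k0 : 0 <= k%:R :> R by exact: ler0n.
  have : E * (1 + k%:R * (E - 1)) <= E * E ^+ k by rewrite ler_pM2l //; lra.
  apply: le_trans; rewrite -subr_ge0.
  have -> : E * (1 + k%:R * (E - 1)) - (1 + (k%:R + 1) * (E - 1)) = k%:R * (E - 1) ^+ 2.
    by ring.
  by rewrite mulr_ge0 ?sqr_ge0.
exists (Num.bound `|C / (E - 1)|).+1 => //; apply: le_trans (bern _).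
have := le_lt_trans (ler_norm _) (archi_boundP (normr_ge0 (C / (E - 1)))).
by rewrite ltr_pdivrMr // -natr1; lra.
Qed.

(* The vectors e b1 + b2 and b1 + e b2 with e + 1/e = -2 B(b1,b2) are the isotropic
   eigenvectors of the product of the two reflections. *)
Lemma hyperbolic_family b1 b2 g : Phi b1 -> Phi b2 -> Phi g ->
  1 < `|B b1 b2| ->
  0 < B g b1 ^+ 2 + B g b2 ^+ 2 - 2 * B b1 b2 * B g b1 * B g b2 ->
  exists r : nat -> 'rV[R]_n, (forall k, Phi (r k)) /\
    forall k l, (k < l)%N -> B (r k) (r l) <= -1.
Proof.
wlog pN : b1 / B b1 b2 < -1 => [wl P1 P2 Pg p1 q0|].
  case: (ltP (B b1 b2) (-1)) => [pN|pN]; first exact: (wl b1).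
  have p1' : 1 < B b1 b2 by move: p1; rewrite ltr_normr => /orP[//|]; lra.
  apply: (wl (- b1)) => //; first by rewrite bformNl; lra.
  - exact: coxeter_rootN.
  - by rewrite bformNl normrN.
  - by rewrite bformNl bformNr; nra.
move=> P1 P2 Pg _.
set x := B g b1; set y := B g b2; pose c := - B b1 b2; move=> q0.
have p12 : B b1 b2 = - c by rewrite opprK.
have p21 : B b2 b1 = - c by rewrite bformC.
have c1 : 1 < c by rewrite /c; lra.
have [e e1 ec] : exists2 e : R, 1 < e & e ^+ 2 = 2 * c * e - 1.
  exists (c + Num.sqrt (c ^+ 2 - 1)).
    by have := sqrtr_ge0 (c ^+ 2 - 1); lra.
  rewrite sqrrD sqr_sqrtr; first by ring.
  by nra.
have P1' := root_form coxWS P1; have P2' := root_form coxWS P2.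
have [t1 t1E] := root_reflection coxWS P1; have [t2 t2E] := root_reflection coxWS P2.
pose la := e *: b1 + b2; pose mu := b1 + e *: b2.
have e0 : e != 0 by lra.
have t1mu : act t1 mu = e *: la.
  rewrite t1E /reflection /mu /la bformDl bformZl P1' p21.
  apply/rowP => l; rewrite !mxE; move: (b1 0 l) (b2 0 l) => z1 z2.
  suff : (e ^+ 2 - 2 * c * e + 1) * z1 = 0 by lra.
  by rewrite ec; ring.
have t2la : act t2 la = e *: mu.
  rewrite t2E /reflection /mu /la bformDl bformZl P2' p12.
  apply/rowP => l; rewrite !mxE; move: (b1 0 l) (b2 0 l) => z1 z2.
  suff : (e ^+ 2 - 2 * c * e + 1) * z2 = 0 by lra.
  by rewrite ec; ring.
have t1la : act t1 la = e^-1 *: mu.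
  apply: (act_inj coxWS (x := t1)); rewrite actZ // t1mu scalerA mulVf // scale1r.
  by rewrite !t1E reflectionK.
have t2mu : act t2 mu = e^-1 *: la.
  apply: (act_inj coxWS (x := t2)); rewrite actZ // t2la scalerA mulVf // scale1r.
  by rewrite !t2E reflectionK.
pose h := (t1 * t2)%g; pose E := e ^+ 2.
have E1 : 1 < E by rewrite /E; nra.
have hla : act h la = E *: la by rewrite actM // t2la actZ // t1mu scalerA.
have hmu : act h mu = E^-1 *: mu by rewrite actM // t2mu actZ // t1la scalerA -invfM -expr2.
pose P := B la mu.
have PE : P = 2 * e * (1 - c ^+ 2).
  rewrite /P /la /mu !bformE P1' P2' p12 p21.
  by transitivity (2 * e - c * (e ^+ 2 + 1)); [ring | rewrite ec; ring].
have P0 : P < 0 by rewrite PE; nra.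
have lala : B la la = 0.
  rewrite /la !bformE P1' P2' p12 p21.
  by transitivity (e ^+ 2 - 2 * c * e + 1); [ring | rewrite ec; ring].
have mumu : B mu mu = 0.
  rewrite /mu !bformE P1' P2' p12 p21.
  by transitivity (e ^+ 2 - 2 * c * e + 1); [ring | rewrite ec; ring].
have mula : B mu la = P by rewrite bformC.
(* Since [la] and [mu] are isotropic, the coefficient along one is read off by pairing with the
   other. The remainder [g0] is orthogonal to the plane and fixed by [h]. *)
pose a := B g mu / P; pose b := B g la / P.
pose g0 := g - (a *: la + b *: mu).
have gE : g = a *: la + b *: mu + g0 by rewrite addrC subrK.
have P0' : P != 0 by lra.
have g0la : B g0 la = 0.
  by rewrite /g0 bformBl bformDl !bformZl lala mula /b; field.
have g0mu : B g0 mu = 0.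
  by rewrite /g0 bformBl bformDl !bformZl mumu -/P /a; field.
have E1' : e ^+ 2 - 1 != 0 by rewrite /E in E1; lra.
have g01 : B g0 b1 = 0.
  have -> : b1 = (e ^+ 2 - 1)^-1 *: (e *: la - mu).
    have -> : e *: la - mu = (e ^+ 2 - 1) *: b1.
      by rewrite /la /mu; apply/rowP => l; rewrite !mxE; ring.
    by rewrite scalerA mulVf // scale1r.
  by rewrite bformZr bformBr bformZr g0la g0mu; ring.
have g02 : B g0 b2 = 0.
  have -> : b2 = (e ^+ 2 - 1)^-1 *: (e *: mu - la).
    have -> : e *: mu - la = (e ^+ 2 - 1) *: b2.
      by rewrite /la /mu; apply/rowP => l; rewrite !mxE; ring.
    by rewrite scalerA mulVf // scale1r.
  by rewrite bformZr bformBr bformZr g0la g0mu; ring.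
have hg0 : act h g0 = g0.
  rewrite actM // t1E t2E /reflection g02 mulr0 scale0r subr0 g01 mulr0 scale0r.
  by rewrite subr0.
have hk k : act (h ^+ k)%g g = (E ^+ k * a) *: la + (E ^- k * b) *: mu + g0.
  elim: k => [|k IH]; first by rewrite act1 // !expr0 invr1 !mul1r.
  rewrite expgS actM // IH (actD coxWS h _ g0) (actD coxWS h (_ *: la)).
  rewrite (actZ coxWS h _ la) (actZ coxWS h _ mu) hla hmu hg0 !scalerA.
  rewrite (exprS E k) (invfM E).
  by congr (_ *: _ + _ *: _ + _); ring.
(* Positive because [P] is negative, while the hypothesis on [g] says that [B g la * B g mu] is
   positive. *)
pose d := - (a * b * P).
have d0 : 0 < d.
  have -> : d = - ((e * (x ^+ 2 + y ^+ 2 + 2 * c * x * y)) / P).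
    have -> : e * (x ^+ 2 + y ^+ 2 + 2 * c * x * y) = B g la * B g mu.
      rewrite /la /mu !bformE -/x -/y.
      transitivity (e * x ^+ 2 + e * y ^+ 2 + (e ^+ 2 + 1) * x * y); last by ring.
      by rewrite ec; ring.
    by rewrite /d /a /b; field.
  rewrite -mulrN -invrN; apply: mulr_gt0; last by rewrite invr_gt0; lra.
  by apply: mulr_gt0; [lra | rewrite p12 in q0; lra].
clearbody g0 a b la mu.
have g00 : B g0 g0 = 1 + 2 * d.
  have := root_form coxWS Pg; rewrite {1 2}gE !bformE lala mumu mula -/P.
  rewrite (bformC cox la g0) (bformC cox mu g0) g0la g0mu /d => gg; lra.
have Bk k : B g (act (h ^+ k)%g g) = 1 - d * (E ^+ k + E ^- k - 2).
  rewrite hk {1}gE !bformE lala mumu mula -/P (bformC cox la g0) (bformC cox mu g0).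
  by rewrite g0la g0mu g00 /d; ring.
(* By [Bk], the product with the image under [h ^+ j] is at most -1 once [d * (E ^+ j - 2)] reaches
   2; hence this bound, and the powers of [h ^+ M]. *)
have [M M0 ME] := exp_unbounded (2 + 2 / d) E1.
exists (fun k => act (h ^+ (M * k))%g g); split=> [k|k l kl]; first exact: root_act.
rewrite -(subnKC (ltnW kl)) mulnDr expgnDr actM // act_form // Bk.
have kl0 : (0 < l - k)%N by rewrite subn_gt0.
have EM : 2 + 2 / d <= E ^+ (M * (l - k)).
  by apply: le_trans ME _; rewrite ler_eXn2l // leq_pmulr.
have EV : 0 <= E ^- (M * (l - k)) by rewrite invr_ge0 exprn_ge0 //; lra.
have : d * (2 / d) <= d * (E ^+ (M * (l - k)) + E ^- (M * (l - k)) - 2).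
  by rewrite ler_pM2l //; lra.
have -> : d * (2 / d) = 2 by field; lra.
lra.
Qed.

(** Each root, made positive, is put into a maximal element. The sign is recorded along with that
    element because only two roots changed by the same sign keep a product at most -1, which
    [inv_set_form_gt] forbids inside one inversion set. *)
Lemma infinite_weak_maximal (r : nat -> 'rV[R]_n) : infinite_set [set: W] ->
  (forall k, Phi (r k)) -> (forall k l, (k < l)%N -> B (r k) (r l) <= -1) ->
  infinite_set [set z : Wbar R m s | weak_maximal z].
Proof.
move=> infW Pr rneg finM; apply: infinite_nat.
pose sg k : bool := `[< pos (r k) >].
have sgP k : pos (if sg k then r k else - r k).
  rewrite /sg; case: asboolP => // nP.
  by case: (root_sign coxWS (Pr k)) => // /negative_rootsP.
have /choice[z zP] : forall k, exists z : Wbar R m s,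
    weak_maximal z /\ Nbar z (if sg k then r k else - r k).
  move=> k; have [x Nx] := positive_root_inv_set coxWS (sgP k).
  have [z zmax xz] := weak_maximal_above R coxWS infW x.
  by exists z; split=> //; exact: xz.
apply: (@finite_set_inj _ _ setT ([set z : Wbar R m s | weak_maximal z] `*` [set: bool])
   (fun k => (z k, sg k))).
- by apply: finite_setX => //; exact: finite_finset.
- by move=> k _; split=> //; case: (zP k).
have noteq k l : (k < l)%N -> (z k, sg k) <> (z l, sg l).
  move=> kl [zkl skl]; have [_ Nk] := zP k; have [_ Nl] := zP l.
  set bk := (if sg k then r k else - r k) in Nk.
  set bl := (if sg l then r l else - r l) in Nl.
  have [x xF] : exists x, [set bk; bl] `<=` N x.
    apply: (@inv_set_bar_finite _ _ _ _ _ coxWS (z k)); first exact: finite_set2.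
    by move=> _ [->|->] //; rewrite zkl.
  have := @inv_set_form_gt _ _ _ _ _ coxWS x bk bl (xF _ (or_introl erefl)) (xF _ (or_intror erefl)).
  rewrite ltNge => /negP; apply; rewrite /bk /bl skl.
  by case: (sg l); rewrite ?bformNl ?bformNr ?opprK; exact: rneg.
move=> k l _ _ E; case: (ltngtP k l) => // [/noteq|/noteq] //; by rewrite E.
Qed.

Lemma finite_lower_bound (F : 'I_n -> R) : (forall i, 0 < F i) ->
  exists2 d, 0 < d & forall i, d <= F i.
Proof.
move=> F0; have S0 : 0 <= \sum_i (F i)^-1.
  by apply: sumr_ge0 => i _; rewrite invr_ge0 ltW.
exists (\sum_i (F i)^-1 + 1)^-1 => [|i]; first by rewrite invr_gt0; lra.
rewrite -[leRHS]invrK lef_pV2 ?posrE ?invr_gt0//; last by lra.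
rewrite (bigD1 i) //= -addrA lerDl; apply: addr_ge0 => //.
by apply: sumr_ge0 => j _; rewrite invr_ge0 ltW.
Qed.

Section Indefinite.
Context (v : 'rV[R]_n).
Hypothesis v0 : forall i, 0 < v 0 i.
Hypothesis vneg : forall i, B v (a_ i) < 0.
Let f b := - B v b.

Let f_simple i : 0 < f (a_ i). Proof. by rewrite oppr_gt0. Qed.

Let f_pos b : pos b -> 0 < f b.
Proof.
move=> pb; have [Pb b0] := pb; rewrite /f bform_expandr -sumrN lt_neqAle; apply/andP; split.
  rewrite eq_sym psumr_neq0; last first.
    by move=> i _; rewrite -mulrN mulr_ge0 // oppr_ge0 ltW.
  apply: contrapT => /negP /hasPn noi; apply: (root_neq0 coxWS Pb).
  apply/rowP => i; rewrite mxE; apply/eqP; rewrite eq_le b0 andbT leNgt.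
  by have := noi i (mem_index_enum _); rewrite /= -mulrN pmulr_lgt0 ?f_simple.
by apply: sumr_ge0 => i _; rewrite -mulrN mulr_ge0 // oppr_ge0 ltW.
Qed.

Let f_expand b : f b = \sum_i v 0 i * (- B (a_ i) b).
Proof. by rewrite /f bform_expandl -sumrN; apply: eq_bigr => i _; rewrite mulrN. Qed.

Let reflect_up b i : pos b -> B (a_ i) b < 0 -> pos (reflection m (a_ i) b).
Proof.
move=> [Pb b0] bi; split.
  by apply: root_reflect => //; exact: root_simple.
rewrite /reflection -scaleNr; apply: nonnegD => //; apply: nonnegZ.
  by rewrite bformC //; lra.
exact: simple_root_nonneg.
Qed.

Let f_reflect b i : f (reflection m (a_ i) b) = f b + 2 * (- B (a_ i) b) * f (a_ i).
Proof. by rewrite /f /reflection bformBr bformZr (bformC cox b); ring. Qed.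

(** The height of [b] is the sum of the [v 0 i * - B (a_ i) b], so one of the [n] terms is at least
    the average. Reflecting in that simple root multiplies the height by at least [1 + d]. *)
Lemma height_unbounded : (0 < n)%N -> forall K, exists2 b, pos b & K <= f b.
Proof.
move=> n0 K.
have [d d0 dle] : exists2 d, 0 < d & forall i, d <= 2 * f (a_ i) / (n%:R * v 0 i).
  by apply: finite_lower_bound => i; rewrite divr_gt0 ?mulr_gt0 ?f_simple ?ltr0n.
have step b : pos b -> exists2 b', pos b' & (1 + d) * f b <= f b'.
  move=> pb; have fb := f_pos pb.
  have [i bi] : exists i, f b / n%:R <= v 0 i * (- B (a_ i) b).
    apply: contrapT => noi; have : f b < \sum_(i < n) f b / n%:R.
      rewrite {1}f_expand; apply: ltr_sum => [|i _].
        by apply/hasP; exists (Ordinal n0); rewrite ?mem_index_enum.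
      by rewrite ltNge; apply/negP => bi; apply: noi; exists i.
    rewrite sumr_const card_ord -[_ *+ n]mulr_natr mulfVK ?ltxx//.
    by rewrite pnatr_eq0 -lt0n.
  have fbn : 0 < f b / n%:R by rewrite divr_gt0 ?ltr0n.
  have Bi : 0 < - B (a_ i) b.
    by rewrite -(pmulr_rgt0 _ (v0 i)); exact: lt_le_trans bi.
  exists (reflection m (a_ i) b); first by apply: reflect_up => //; lra.
  rewrite f_reflect mulrDl mul1r lerD2l.
  apply: (@le_trans _ _ (2 * f (a_ i) / (n%:R * v 0 i) * f b)).
    by rewrite ler_pM2r.
  have -> : 2 * f (a_ i) / (n%:R * v 0 i) * f b = 2 * f (a_ i) * (f b / n%:R / v 0 i).
    by field; rewrite ?pnatr_eq0 -?lt0n ?n0 ?gt_eqF.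
  rewrite [leRHS]mulrAC ler_pM2l ?mulr_gt0 ?f_simple//.
  by rewrite ler_pdivrMr // [leRHS]mulrC.
have iterb k : exists2 b, pos b & (1 + d) ^+ k * f (a_ (Ordinal n0)) <= f b.
  elim: k => [|k [b pb bk]].
    by exists (a_ (Ordinal n0)); rewrite ?expr0 ?mul1r//; exact: positive_simple.
  have [b' pb' bb'] := step b pb; exists b' => //; apply: le_trans bb'.
  by rewrite exprS -mulrA ler_pM2l //; lra.
have [|k _ kE] := @exp_unbounded (1 + d) (K / f (a_ (Ordinal n0))); first by lra.
have [b pb bk] := iterb k; exists b => //; apply: le_trans bk.
by rewrite -ler_pdivrMr ?f_simple.
Qed.

(** Suppose no triple works. A high root [b] has product below -1 with some [a_ j]; its reflection
    [b'] is higher still, has product above 1 with [a_ j] and below -1 with another [a_ k]. The sign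
    constraints then make all other simple roots orthogonal to these two. On the remaining plane the
    Gram entry is at least -1, so [B v] cannot be negative at both [a_ j] and [a_ k]. *)
Lemma indefinite_hyperbolic_triple : (0 < n)%N -> exists b1 b2 g,
  [/\ Phi b1, Phi b2, Phi g, 1 < `|B b1 b2| &
   0 < B g b1 ^+ 2 + B g b2 ^+ 2 - 2 * B b1 b2 * B g b1 * B g b2].
Proof.
move=> n0; apply: contrapT => noT.
have qle b1 b2 g : Phi b1 -> Phi b2 -> Phi g -> 1 < `|B b1 b2| ->
    B g b1 ^+ 2 + B g b2 ^+ 2 - 2 * B b1 b2 * B g b1 * B g b2 <= 0.
  by move=> P1 P2 Pg p1; rewrite leNgt; apply/negP => q0; apply: noT; exists b1, b2, g.
have Pa i := @root_simple R n m W s coxWS i.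
have Ba i j : i != j -> -1 <= B (a_ i) (a_ j) <= 0.
  by move=> ij; rewrite bform_simple gram_ge// gram_le0.
(* If [B b a_j < -1], the form of [b] with every other simple root is nonnegative,
   and it vanishes exactly when that root is orthogonal to [a_j]. *)
have sgn b j k : Phi b -> k != j -> B b (a_ j) < -1 ->
    0 <= B b (a_ k) /\ (B b (a_ k) = 0 <-> B (a_ k) (a_ j) = 0).
  move=> Pb kj bj; have /andP[_ y0] := Ba _ _ kj.
  have := qle b (a_ j) (a_ k) Pb (Pa j) (Pa k).
  rewrite ltr0_norm; last lra.
  move=> /(_ ltac:(lra)); rewrite (bformC cox (a_ k) b).
  move: (B b (a_ k)) (B (a_ k) (a_ j)) (B b (a_ j)) y0 bj => x y p y0 bj q.
  split.
    rewrite leNgt; apply/negP => x0; have := sqr_ge0 y.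
    have xy : 0 <= x * y by rewrite mulr_le0 // ltW.
    have pxy : p * (x * y) <= 0 by rewrite mulr_le0_ge0 //; lra.
    have x2 : 0 < x ^+ 2 by rewrite exprn_even_gt0 //= lt_eqF.
    lra.
  by split=> E; apply/eqP; rewrite -sqrf_eq0 eq_le sqr_ge0 andbT; move: q; rewrite E; lra.
have sgn' b j k : Phi b -> k != j -> 1 < B b (a_ j) ->
    B b (a_ k) <= 0 /\ (B b (a_ k) = 0 <-> B (a_ k) (a_ j) = 0).
  move=> Pb kj bj; have := @sgn (- b) j k (coxeter_rootN coxWS Pb) kj.
  rewrite !bformNl => /(_ ltac:(lra)) [le0 [E1 E2]]; split; first lra.
  by split=> E; [apply: E1; rewrite E oppr0 | apply/eqP; rewrite -oppr_eq0 E2].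
have big b : pos b -> \sum_i v 0 i < f b -> exists i, B b (a_ i) < -1.
  move=> pb; rewrite f_expand => lt; apply: contrapT => noi.
  move: lt; rewrite ltNge => /negP; apply; apply: ler_sum => i _.
  rewrite ger_pMr // (bformC cox); suff : -1 <= B b (a_ i) by lra.
  by rewrite leNgt; apply/negP => bi; apply: noi; exists i.
have [b pb fb] := height_unbounded n0 (\sum_i v 0 i + 1).
have [|j bj] := big b pb; first lra.
pose b' := reflection m (a_ j) b.
have pb' : pos b' by apply: reflect_up => //; rewrite bformC //; lra.
have [Pb' _] := pb'.
have b'j : 1 < B b' (a_ j).
  by rewrite /b' /reflection bformBl bformZl bform_simple1 //; lra.
have [|k b'k] := big b' pb'.
  rewrite f_reflect (bformC cox); have := f_simple j.
  by move: (B b (a_ j)) (f (a_ j)) (f b) fb bj; move=> *; nra.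
have kj : k != j by apply/eqP => kj; rewrite kj in b'k; lra.
have orth l : l != j -> l != k -> B (a_ l) (a_ j) = 0 /\ B (a_ l) (a_ k) = 0.
  move=> lj lk; have [le0 [E1 _]] := sgn' b' j l Pb' lj b'j.
  have [ge0 [E2 _]] := sgn b' k l Pb' lk b'k.
  have E : B b' (a_ l) = 0 by lra.
  by split; [exact: E1 | exact: E2].
have := vneg j; have := vneg k.
rewrite !(bform_expandl m v) (bigD1 k) //= (bigD1 j) ?[j == k]eq_sym//=.
rewrite [X in _ + (_ + X)]big1 => [|l /andP[lk lj]]; last by rewrite (orth l lj lk).2 mulr0.
rewrite [X in _ -> X < 0 -> _](bigD1 k) //= [X in _ -> _ + X < 0 -> _](bigD1 j) ?[j == k]eq_sym//=.
rewrite [X in _ -> _ + (_ + X) < 0 -> _]big1 => [|l /andP[lk lj]]; last by rewrite (orth l lj lk).1 mulr0.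
rewrite !bform_simple1 // !addr0 !mulr1 (bformC cox (a_ j) (a_ k)).
have /andP[g1 g0] := Ba k j kj; have := v0 j; have := v0 k.
by move: (v 0 j) (v 0 k) (B (a_ k) (a_ j)) g1 g0 => *; nra.
Qed.

End Indefinite.

Lemma indefinite_infinite_maximal (v : 'rV[R]_n) : (0 < n)%N ->
  infinite_set [set: W] -> (forall i, 0 < v 0 i) -> (forall i, B v (a_ i) < 0) ->
  infinite_set [set z : Wbar R m s | weak_maximal z].
Proof.
move=> n0 infW v0 vneg.
have [b1 [b2 [g [P1 P2 Pg p q]]]] := indefinite_hyperbolic_triple v0 vneg n0.
have [r [Pr rneg]] := hyperbolic_family P1 P2 Pg p q.
exact: infinite_weak_maximal Pr rneg.
Qed.

End Hyperbolic.

(** * Semidefinite forms *)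

Lemma dot_cauchy (R : realType) d (u v : 'rV[R]_d) :
  dot u v ^+ 2 <= dot u u * dot v v.
Proof.
have [->|/eqP v0] := eqVneq v 0; first by rewrite !dot0r expr0n mulr0.
have dv : 0 < dot v v.
  by rewrite lt_neqAle dot_ge0 andbT; apply/eqP => /esym /dot_eq0.
have := dot_ge0 (dot v v *: u - dot u v *: v).
rewrite !dot_linE (dotC v u) => H.
rewrite -subr_ge0 -(pmulr_lge0 _ dv).
by apply: le_trans H _; rewrite le_eqVlt; apply/orP; left; apply/eqP; ring.
Qed.

Lemma finite_set_argmin (T : Type) (R : realType) (A : set T) (f : T -> R) :
  finite_set A -> A !=set0 -> exists2 a, A a & forall b, A b -> f a <= f b.
Proof.
move=> finA [x Ax].
suff H (r : seq R) : r != [::] -> exists2 c, c \in r & forall b, b \in r -> c <= b.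
  have /finite_seqP[r rE] := finite_image f finA.
  have fr y : A y -> f y \in r.
    move=> Ay.
    by have : (f @` A) (f y); [exists y | rewrite rE].
  have [|c cr cmin] := H r.
    by have := fr x Ax; case: (r).
  have [a Aa ac] : (f @` A) c by rewrite rE.
  by exists a => // b Ab; rewrite ac; apply: cmin; exact: fr.
elim: r => // y r IH _; have [->|r0] := eqVneq r [::].
  by exists y; rewrite ?inE// => b; rewrite inE => /eqP ->.
have [c cr cmin] := IH r0; case: (leP y c) => yc.
  exists y; first by rewrite inE eqxx.
  by move=> b; rewrite inE => /predU1P[->//|/cmin]; exact: le_trans.
exists c; first by rewrite inE cr orbT.
by move=> b; rewrite inE => /predU1P[->|/cmin//]; exact: ltW.
Qed.

(** * Finiteness of the group when the form is positive definite *)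

Section PositiveDefinite.
Context (R : realType) (n : nat) (m : 'M[nat]_n) (W : groupType)
  (s : 'I_n -> W).
Hypothesis coxWS : coxeter_system m s.
Local Notation B := (bform (R := R) m).
Local Notation a_ := (@simple_root R n).
Local Notation act := (@act R n m W s).
Implicit Types (u v z b : 'rV[R]_n) (x y : W) (i j : 'I_n).

Let cox : coxeter_matrix m. Proof. by case: coxWS. Qed.

Lemma bform_cauchy1 u b : (forall v, 0 <= B v v) -> B b b = 1 ->
  B u b ^+ 2 <= B u u.
Proof.
move=> B0 b1; have := B0 (u - B u b *: b).
by rewrite !(bformBl, bformBr) !bformE b1 (bformC cox b); lra.
Qed.

Lemma bform_le_coord (h : R) (z : 'rV[R]_n) : (forall i, `|z 0 i| <= h) ->
  B z z <= (n%:R * h) ^+ 2.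
Proof.
move=> zh; rewrite bform_expandl.
have -> : (n%:R * h) ^+ 2 = \sum_(i < n) \sum_(j < n) h ^+ 2.
  by rewrite !sumr_const card_ord -[_ *+ n]mulr_natr -[h ^+ 2 *+ n]mulr_natr; ring.
apply: ler_sum => i _; rewrite bform_expandr mulr_sumr; apply: ler_sum => j _.
apply: le_trans (ler_norm _) _; rewrite !normrM expr2.
apply: ler_pM => //; rewrite -[leRHS]mulr1; apply: ler_pM => //.
rewrite bform_simple ler_norml gram_ge /=.
have [->|ij] := eqVneq i j; first by rewrite gram_diag.
exact: le_trans (gram_le0 _ cox ij) ler01.
Qed.

(** If [x] is not 1, some [act x^-1 (a_ i)] is negative, so [act x v] has nonpositive product with
    [a_ i] whereas [v] has product at least [d]. Cauchy-Schwarz then keeps the two vectors at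
    distance at least [d]. *)
Lemma act_dominant_eq1 v x (d : R) : (forall u, 0 <= B u u) -> 0 < d ->
  (forall i, d <= B v (a_ i)) ->
  B (v - act x v) (v - act x v) < d ^+ 2 -> x = 1%g.
Proof.
move=> B0 d0 dv small; apply/eqP; apply: contraT => x1.
have [i xi] : exists i, nonneg (- act x^-1%g (a_ i)).
  have [|i lx] := coxeter_length_last coxWS (x := x^-1%g).
    by move=> E; move: x1; rewrite -(invgK x) E invg1 eqxx.
  by exists i; apply/act_simple_nonpos => //; rewrite -lx.
have le0 : B (act x v) (a_ i) <= 0.
  rewrite -(actVK coxWS x (a_ i)) act_form // -oppr_ge0 -bformNr.
  rewrite bform_expandr; apply: sumr_ge0 => j _; apply: mulr_ge0; first exact: xi.
  exact: le_trans (ltW d0) (dv j).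
have dle : d <= B (v - act x v) (a_ i).
  by rewrite bformBl; have := dv i; lra.
have := bform_cauchy1 (v - act x v) B0 (bform_simple1 _ cox i).
rewrite leNgt => /negP; case; apply: lt_le_trans small _.
by rewrite ler_pXn2r ?nnegrE ?(ltW d0) ?(le_trans (ltW d0) dle).
Qed.

(** The orbit of [v] is bounded and, by [act_dominant_eq1], uniformly separated with trivial
    stabilizer. *)
Lemma positive_definite_finite (mu : R) v : 0 < mu -> (0 < n)%N ->
  (forall i, 0 < v 0 i) -> (forall u, B v u = mu * dot v u) ->
  (forall u, mu * dot u u <= B u u) -> finite_set [set: W].
Proof.
move=> mu0 n0 v0 vE mule.
have B0 u : 0 <= B u u by apply: le_trans (mule u); rewrite mulr_ge0 ?dot_ge0 ?ltW.
have dotv i : dot v (a_ i) = v 0 i.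
  rewrite dotE (bigD1 i) //= simple_rootE eqxx mulr1 big1 ?addr0// => j ji.
  by rewrite simple_rootE (negbTE ji) mulr0.
have [d d0 dv] : exists2 d, 0 < d & forall i, d <= B v (a_ i).
  by apply: finite_lower_bound => i; rewrite vE dotv mulr_gt0.
have h0 : 0 < d / n.+1%:R by rewrite divr_gt0 ?ltr0n.
have small u : (forall i, `|u 0 i| < d / n.+1%:R) -> B u u < d ^+ 2.
  move=> uh; have := @bform_le_coord (d / n.+1%:R) u (fun i => ltW (uh i)).
  move/le_lt_trans; apply; rewrite ltr_pXn2r ?nnegrE ?mulr_ge0 ?ler0n ?ltW//.
  by rewrite mulrCA gtr_pMr // ltr_pdivrMr ?ltr0n// mul1r ltr_nat.
have inj x y : (forall i, `|(act x v) 0 i - (act y v) 0 i| < d / n.+1%:R) -> x = y.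
  move=> xy; apply: (mulgI x^-1%g); rewrite mulVg; apply/esym.
  apply: (@act_dominant_eq1 v _ d) => //.
  have -> : v - act (x^-1 * y)%g v = act x^-1%g (act x v - act y v).
    by rewrite actD // actN // actM // actK.
  by rewrite act_form //; apply: small => i; rewrite !mxE.
have finO : finite_set [set u | exists x, u = act x v].
  apply: (@finite_grid_separated _ _ _ (1 + B v v / mu) (d / n.+1%:R)) => //.
    move=> u i [x ->]; have := dot_coord_le (act x v) i.
    have := mule (act x v); rewrite act_form // -ler_pdivlMl // mulrC => le1 le2.
    have K0 : 0 <= B v v / mu by rewrite divr_ge0 // ltW.
    have := le_trans le2 le1; rewrite -real_normK ?num_real//.
    by move: (normr_ge0 ((act x v) 0 i)) => ? ?; nra.
  by move=> _ _ [x ->] [y ->] /inj ->.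
apply: (finite_set_inj finO (f := fun x => act x v)) => [x _|x y _ _ E].
  by exists x.
by apply: inj => i; rewrite E subrr normr0.
Qed.

End PositiveDefinite.

(** Cholesky factorization by induction on the size: a zero pivot forces its whole row to vanish,
    and otherwise the Schur complement is again semidefinite. The left inverse [C] records that [P]
    has full column rank. *)
Lemma psd_factor (R : realType) k (G : 'M[R]_k) : G^T = G ->
  (forall u : 'rV_k, 0 <= (u *m G *m u^T) 0 0) ->
  exists r (P : 'M[R]_(k, r)), G = P *m P^T /\ exists C : 'M[R]_(r, k), C *m P = 1%:M.
Proof.
elim: k G => [|k IH] G Gsym psd.
  exists 0%N, 0; split; first by apply/matrixP => -[].
  by exists 0; apply/matrixP => -[].
change 'M[R]_(1 + k) in G.
change (exists r (P : 'M[R]_(1 + k, r)), G = P *m P^T /\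
  exists C : 'M[R]_(r, 1 + k), C *m P = 1%:M).
pose a := G 0 0; pose b : 'rV[R]_k := ursubmx G; pose D : 'M[R]_k := drsubmx G.
have dlE : dlsubmx G = b^T by rewrite /b -{1}Gsym trmx_ursub.
have Dsym : D^T = D by rewrite /D -{2}Gsym trmx_drsub.
have ulE : ulsubmx G = a%:M.
  rewrite [LHS]mx11_scalar; congr (_%:M); rewrite !mxE /a; congr (G _ _); exact: val_inj.
have GE : G = block_mx a%:M b b^T D by rewrite -ulE -dlE submxK.
have psd' (u : 'rV[R]_(1 + k)) : 0 <= (u *m G *m u^T) 0 0 by exact: psd.
have quad x (y : 'rV_k) :
    0 <= a * x ^+ 2 + 2 * x * (b *m y^T) 0 0 + (y *m D *m y^T) 0 0.
  have := psd' (row_mx x%:M y); rewrite GE.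
  rewrite (mul_row_block x%:M y) tr_row_mx mul_row_col !mulmxDl.
  have -> : y *m b^T *m x%:M^T = x *: (b *m y^T)^T.
    by rewrite tr_scalar_mx mul_mx_scalar trmx_mul trmxK.
  rewrite tr_scalar_mx !mul_scalar_mx -!scalemxAl mul_mx_scalar.
  congr (0 <= _); rewrite !mxE.
  by rewrite eqxx mulr1n; ring.
have a0 : 0 <= a by have := quad 1 0; rewrite trmx0 !mulmx0 ![(0 : 'M[R]_1) _ _]mxE; lra.
have bb : (b *m b^T) 0 0 = dot b b by [].
have [a_eq0|a_neq0] := eqVneq a 0.
  have b0 : b = 0.
    apply: dot_eq0; apply/eqP; rewrite eq_le dot_ge0 andbT leNgt; apply/negP => b_gt0.
    (* The test vector at which a nonzero [b] would give the value -1. *)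
    have := quad (- (((b *m D *m b^T) 0 0 + 1) / (2 * dot b b))) b.
    rewrite a_eq0 bb mul0r add0r.
    have -> : 2 * - (((b *m D *m b^T) 0 0 + 1) / (2 * dot b b)) * dot b b =
      - ((b *m D *m b^T) 0 0 + 1) by field; rewrite gt_eqF.
    lra.
  have [|r [P [DE [C CP]]]] := IH D Dsym.
    by move=> y; have := quad 0 y; rewrite expr0n /= mulr0 add0r mulr0 mul0r add0r.
  exists r, (col_mx (0 : 'M[R]_(1, r)) P); split.
    rewrite GE a_eq0 b0 trmx0 DE tr_col_mx mul_col_row trmx0 !mul0mx !mulmx0.
    by congr (block_mx _ _ _ _); apply/matrixP => i j; rewrite !mxE mul0rn.
  by exists (row_mx (0 : 'M[R]_(r, 1)) C); rewrite mul_row_col mul0mx add0r.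
have a_gt0 : 0 < a by rewrite lt_neqAle eq_sym a_neq0.
pose q := Num.sqrt a.
have q0 : q != 0 by rewrite gt_eqF // sqrtr_gt0.
have qq : q * q = a by rewrite -expr2 sqr_sqrtr.
have [||r [P [DE [C CP]]]] := IH (D - a^-1 *: (b^T *m b)).
- by rewrite linearB /= linearZ /= trmx_mul trmxK Dsym.
(* The first coordinate minimizes the quadratic form for fixed [y]; completing the square leaves the
   Schur complement. *)
- move=> y; have := quad (- a^-1 * (b *m y^T) 0 0) y.
  rewrite mulmxBr mulmxBl -scalemxAr -scalemxAl mulmxA.
  have -> : y *m b^T *m b *m y^T = ((b *m y^T) 0 0) ^+ 2 *: 1%:M.
    rewrite -mulmxA -(trmxK (y *m b^T)) trmx_mul trmxK.
    rewrite {1 2}[b *m y^T]mx11_scalar tr_scalar_mx -scalar_mxM -expr2.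
    by rewrite scale_scalar_mx mulr1.
  move: (b *m y^T) (y *m D *m y^T) => z1 z2; rewrite !mxE eqxx mulr1n mulr1.
  by congr (0 <= _); field.
exists (1 + r)%N, (block_mx q%:M 0 (q^-1 *: b^T) P); split.
  rewrite GE tr_block_mx mulmx_block !trmx0 !mulmx0 !mul0mx !addr0 tr_scalar_mx.
  rewrite linearZ /= trmxK !mul_scalar_mx scalerA mulfV // scale1r.
  rewrite scale_scalar_mx qq mul_mx_scalar scalerA mulfV // scale1r.
  congr block_mx; rewrite -DE -scalemxAl -scalemxAr scalerA -invfM qq.
  by rewrite addrC subrK.
exists (block_mx (q^-1)%:M 0 (- (a^-1 *: (C *m b^T))) C).
rewrite mulmx_block !mulmx0 !mul0mx !addr0 CP add0r mul_scalar_mx scale_scalar_mx mulVf //.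
rewrite mul_mx_scalar -scalemxAr scalerN scalerA -qq invfM mulrA mulfV // mul1r.
by rewrite addNr -scalar_mx_block.
Qed.

(** The map [P] realizes the quotient by the radical. It has [d] columns because the radical is a
    line. *)
Lemma euclidean_model (R : realType) d (m : 'M[nat]_d.+1) (de : 'rV[R]_d.+1) :
  coxeter_matrix m -> (forall i, 0 < de 0 i) -> (forall u, bform m de u = 0) ->
  (forall u : 'rV[R]_d.+1, 0 <= bform m u u) ->
  (forall u : 'rV[R]_d.+1, bform m u u = 0 -> exists c, u = c *: de) ->
  exists P : 'M[R]_(d.+1, d),
  [/\ forall u v, bform m u v = dot (u *m P) (v *m P),
      de *m P = 0,
      forall u, u *m P = 0 -> exists c, u = c *: de &
      exists C : 'M[R]_(d, d.+1), C *m P = 1%:M].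
Proof.
move=> cox de0 der psd rad.
have Gsym : (gram R m)^T = gram R m by apply/matrixP => i j; rewrite mxE gram_sym.
have [r [P [GE [C CP]]]] := psd_factor Gsym psd.
have BE u v : bform m u v = dot (u *m P) (v *m P).
  by rewrite /bform /dot GE trmx_mul !mulmxA.
have ker u : u *m P = 0 -> exists c, u = c *: de.
  by move=> uP; apply: rad; rewrite BE uP dot0l.
have deP : de *m P = 0 by apply: dot_eq0; rewrite -BE der.
have rP : \rank P = r.
  by apply/eqP; apply/row_fullP; exists C.
have rk : \rank (kermx P) = 1%N.
  apply/eqP; rewrite eqn_leq; apply/andP; split.
    have : (kermx P <= de)%MS.
      apply/row_subP => i; have [|c ->] := ker (row i (kermx P)); last exact: scalemx_sub.
      by rewrite -row_mul mulmx_ker row0.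
    by move=> /mxrankS /leq_trans; apply; exact: rank_leq_row.
  have : (de <= kermx P)%MS by apply/sub_kermxP.
  move=> /mxrankS; apply: leq_trans; rewrite lt0n mxrank_eq0.
  by apply/eqP => E; have := de0 0; rewrite E mxE ltxx.
have rd : r = d.
  have := mxrank_ker P; rewrite rk rP; have := rank_leq_row P; rewrite rP; lia.
by subst r; exists P; split=> //; exists C.
Qed.

(** * The affine action *)

Section AffineAction.
Context (R : realType) (d : nat) (m : 'M[nat]_d.+1) (W : groupType)
  (s : 'I_d.+1 -> W) (de : 'rV[R]_d.+1) (P : 'M[R]_(d.+1, d)).
Local Notation B := (bform (R := R) m).
Local Notation a_ := (@simple_root R d.+1).
Local Notation act := (@act R d.+1 m W s).
Local Notation Phi := (@Defs.roots R d.+1 m W s).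
Local Notation pos := (@positive_roots R d.+1 m W s).
Implicit Types (u v b g : 'rV[R]_d.+1) (p q : 'rV[R]_d) (x y : W) (i j : 'I_d.+1).

Hypothesis coxWS : coxeter_system m s.
Hypothesis derad : forall u, B de u = 0.
Hypothesis BE : forall u v, B u v = dot (u *m P) (v *m P).
Hypothesis deP : de *m P = 0.
Hypothesis Pker : forall u, u *m P = 0 -> exists c, u = c *: de.
Hypothesis Pinv : exists C : 'M[R]_(d, d.+1), C *m P = 1%:M.

Let cox : coxeter_matrix m. Proof. by case: coxWS. Qed.

Lemma act_radical x : act x de = de.
Proof.
have [w <-] := word_prod_surj coxWS x; rewrite actE //.
elim: w => //= i w ->; rewrite simple_reflE /reflection derad mulr0 scale0r subr0 //.
Qed.

Lemma model_surj p : exists u, u *m P = p.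
Proof. by have [C CP] := Pinv; exists (p *m C); rewrite -mulmxA CP mulmx1. Qed.

Lemma dual_model c : dot c de = 0 -> exists p, forall v, dot c v = dot p (v *m P).
Proof.
move=> c0; have [C CP] := Pinv; exists (c *m C^T) => v.
have [k kE] : exists k, v - v *m P *m C = k *: de.
  by apply: Pker; rewrite mulmxBl -!mulmxA CP mulmx1 subrr.
have -> : v = k *: de + v *m P *m C by rewrite -kE subrK.
rewrite dotDr dotZr c0 mulr0 add0r mulmxDl -scalemxAl deP scaler0 add0r.
have -> : v *m P *m C *m P = v *m P by rewrite -(mulmxA _ C) CP mulmx1.
by rewrite /dot trmx_mul mulmxA.
Qed.

Lemma positive_root_unit b : Phi b -> dot (b *m P) (b *m P) = 1.
Proof. by move=> /(root_form coxWS); rewrite BE. Qed.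

Section Base.
Context (e : 'rV[R]_d.+1).
Hypothesis ede : dot e de = 1.

(* The value at the point [p] of the affine function attached to [v]; [de] is
   attached to the constant 1. *)
Definition affine_value p v := dot e v + dot p (v *m P).
Local Notation F := affine_value.

Lemma affine_valueD p u v : F p (u + v) = F p u + F p v.
Proof. by rewrite /F mulmxDl !dotDr; ring. Qed.

Lemma affine_valueZ p c v : F p (c *: v) = c * F p v.
Proof. by rewrite /F -scalemxAl !dotZr; ring. Qed.

Lemma affine_valueN p v : F p (- v) = - F p v.
Proof. by rewrite -scaleN1r affine_valueZ mulN1r. Qed.

Lemma affine_value_de p : F p de = 1.
Proof. by rewrite /F ede deP dot0r addr0. Qed.

Lemma affine_value_expand p v : F p v = \sum_i v 0 i * F p (a_ i).
Proof.
have F00 : F p 0 = 0 by rewrite -(scale0r (0 : 'rV_d.+1)) affine_valueZ mul0r.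
rewrite {1}(row_sum_simple v) (big_morph _ (affine_valueD p) F00).
by apply: eq_bigr => i _; exact: affine_valueZ.
Qed.

Lemma affine_value_inj p q : (forall v, F p v = F q v) -> p = q.
Proof.
move=> pq; apply/eqP; rewrite -subr_eq0; apply/eqP/dot_eq0.
have [u uE] := model_surj (p - q).
rewrite -{2}uE dotDl dotNl.
by have := pq u; rewrite /F => /addrI ->; rewrite subrr.
Qed.

Lemma affine_action_exists x p : exists q, forall v, F q v = F p (act x^-1%g v).
Proof.
have [w <-] := word_prod_surj coxWS x; elim: w p => [|i w IH] p.
  by exists p => v; rewrite word_prod_nil invg1 act1.
have [q qE] := IH p; exists (q - (2 * F q (a_ i)) *: (a_ i *m P)) => v.
rewrite word_prod_cons invgM actM // (simple_invg coxWS) act_simple // -qE.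
rewrite simple_reflE /reflection affine_valueD affine_valueN affine_valueZ.
rewrite (BE v) /F dotDl dotNl dotZl (dotC (a_ i *m P)); ring.
Qed.

(** The contragredient action on the affine space of linear forms with value 1 at [de], preserved
    since [W] fixes [de]. The default 0 is never taken, by [affine_action_exists]. *)
Definition affine_action x p : 'rV[R]_d :=
  xget 0 [set q | forall v, F q v = F p (act x^-1%g v)].
Local Notation phi := affine_action.

Lemma affine_actionE x p v : F (phi x p) v = F p (act x^-1%g v).
Proof.
rewrite /phi; case: xgetP => [q _ /= ->//|no].
by have [q qE] := affine_action_exists x p; case: (no q).
Qed.

Lemma affine_actionM x y p : phi (x * y)%g p = phi x (phi y p).
Proof. by apply: affine_value_inj => v; rewrite !affine_actionE invgM actM. Qed.

Lemma affine_action1 p : phi 1%g p = p.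
Proof. by apply: affine_value_inj => v; rewrite affine_actionE invg1 act1. Qed.

Lemma affine_actionK x p : phi x^-1%g (phi x p) = p.
Proof. by rewrite -affine_actionM mulVg affine_action1. Qed.

Lemma affine_action_reflection t b p : (forall v, act t v = reflection m b v) ->
  B b b = 1 -> phi t p = p - (2 * F p b) *: (b *m P).
Proof.
move=> tb b1; apply: affine_value_inj => v; rewrite affine_actionE.
have -> : act t^-1%g v = reflection m b v.
  by apply: (act_inj coxWS (x := t)); rewrite actVK // tb reflectionK.
rewrite /reflection affine_valueD affine_valueN affine_valueZ.
rewrite (BE v) /F dotDl dotNl dotZl (dotC (b *m P)); ring.
Qed.

Lemma affine_action_isometry x p q :
  dot (phi x p - phi x q) (phi x p - phi x q) = dot (p - q) (p - q).
Proof.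
have [u uE] := model_surj (p - q).
suff -> : phi x p - phi x q = act x u *m P.
  by rewrite -BE act_form // BE uE.
have lin v : dot (phi x p - phi x q) (v *m P) = dot (act x u *m P) (v *m P).
  rewrite -BE -(actVK coxWS x v) act_form // BE uE actVK // !dotDl !dotNl.
  by have := affine_actionE x p v; have := affine_actionE x q v; rewrite /F; lra.
apply/eqP; rewrite -subr_eq0; apply/eqP/dot_eq0.
have [v vE] := model_surj (phi x p - phi x q - act x u *m P).
by rewrite -{2}vE dotDl dotNl lin subrr.
Qed.

End Base.

Section Height.
Hypothesis de_gt0 : forall i, 0 < de 0 i.
Hypothesis de_sum : \sum_i de 0 i = 1.
Hypothesis infW : infinite_set [set: W].
Hypothesis irr : irreducible_coxeter m.

(** With this base form the origin evaluates every root to its height; it is interior to the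
    fundamental alcove, with value 1 on all simple roots. *)
Let e : 'rV[R]_d.+1 := const_mx 1.
Let ede : dot e de = 1.
Proof. by rewrite dotE -de_sum; apply: eq_bigr => i _; rewrite mxE mul1r. Qed.
Local Notation F := (affine_value e).
Local Notation phi := (affine_action e).
Let ht v : R := \sum_i v 0 i.
Let e_ht v : dot e v = ht v.
Proof. by rewrite dotE; apply: eq_bigr => i _; rewrite mxE mul1r. Qed.
Let ht_simple i : ht (a_ i) = 1.
Proof.
rewrite /ht (bigD1 i) //= simple_rootE eqxx big1 ?addr0// => j ji.
by rewrite simple_rootE (negbTE ji).
Qed.
Let F0 v : F 0 v = ht v. Proof. by rewrite /affine_value dot0l addr0 e_ht. Qed.

Let ht_nonneg v : nonneg v -> 0 <= ht v.
Proof. by move=> v0; apply: sumr_ge0. Qed.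

Let ht_gt0 b : pos b -> 0 < ht b.
Proof.
move=> [Pb b0]; rewrite lt_neqAle ht_nonneg // andbT eq_sym /ht.
rewrite psumr_neq0 => [|i _]; last exact: b0.
apply: contrapT => /negP /hasPn nob; apply: (root_neq0 coxWS Pb).
apply/rowP => i; rewrite mxE; apply/eqP; rewrite eq_le b0 andbT leNgt.
by have := nob i (mem_index_enum _).
Qed.

Let unit_dot_le p b : Phi b -> dot p (b *m P) ^+ 2 <= dot p p.
Proof. by move=> Pb; have := dot_cauchy p (b *m P); rewrite positive_root_unit // mulr1. Qed.

Let lt_sqr1 (x : R) : x ^+ 2 < 1 -> -1 < x.
Proof. by move=> x1; rewrite ltNge; apply/negP => xle; nra. Qed.

(** The origin is at distance 1 from each simple wall. If [z] is not 1, its image of the origin lies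
    beyond or on one of these walls, hence at distance at least 1. *)
Let orbit_separated x y : dot (phi x 0 - phi y 0) (phi x 0 - phi y 0) < 1 -> x = y.
Proof.
have sep z : dot (phi z 0) (phi z 0) < 1 -> z = 1%g.
  move=> z1; suff zV : z^-1%g = 1%g by rewrite -(invgK z) zV invg1.
  apply: (act_nonneg_eq1 coxWS (R := R)) => i.
  have [//|neg] := act_simple_sign R coxWS z^-1%g i; exfalso.
  have := ht_nonneg neg; rewrite -F0 affine_valueN -affine_actionE //.
  rewrite /affine_value e_ht ht_simple.
  have := lt_sqr1 (le_lt_trans (unit_dot_le (phi z 0) (root_simple R coxWS i)) z1).
  lra.
move=> xy; apply: (mulgI y^-1%g); rewrite mulVg; apply: sep.
rewrite affine_actionM //.
have := affine_action_isometry e y^-1%g (phi x 0) (phi y 0).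
by rewrite affine_actionK // subr0 => ->.
Qed.

Let coord_small k (u : 'rV[R]_k) : (forall i : 'I_k, `|u 0 i| < k.+1%:R^-1) -> dot u u < 1.
Proof.
move=> uk; rewrite dotE; apply: (@le_lt_trans _ _ (\sum_(i < k) k.+1%:R^-1)).
  apply: ler_sum => i _; rewrite -expr2 -real_normK ?num_real//.
  have h1 : k.+1%:R^-1 <= 1 :> R by rewrite invf_le1 ?ltr0n// ler1n.
  have := uk i; move: (normr_ge0 (u 0 i)) => n0 n1.
  rewrite expr2 -[leRHS]mulr1; apply: ler_pM => //; first exact: ltW.
  by apply: le_trans h1; exact: ltW.
by rewrite sumr_const card_ord -[_ *+ k]mulr_natr mulrC ltr_pdivrMr ?ltr0n// mul1r ltr_nat.
Qed.

Let coord_bound k (u : 'rV[R]_k) K (i : 'I_k) : dot u u <= K -> `|u 0 i| <= 1 + K.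
Proof.
move=> uK; have := le_trans (dot_coord_le u i) uK; rewrite -real_normK ?num_real//.
by move: (normr_ge0 (u 0 i)) => n0 n1; nra.
Qed.

Let finite_orbit_ball K : finite_set [set q | exists2 x, q = phi x 0 & dot q q <= K].
Proof.
apply: (@finite_grid_separated _ _ _ (1 + K) d.+1%:R^-1).
- by rewrite invr_gt0 ltr0n.
- by move=> u i [x _]; exact: coord_bound.
- move=> _ _ [x -> _] [y -> _] xy; congr (phi _ 0); apply: orbit_separated.
  by apply: coord_small => i; have := xy i; rewrite !mxE.
Qed.

(** The reflection in [b] moves the origin to [- (2 * ht b) *: (b *m P)], from which [b] can be
    recovered. Bounded height confines this orbit point to a ball. *)
Lemma finite_bounded_height K : finite_set [set b | pos b /\ \sum_i b 0 i <= K].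
Proof.
apply: (finite_set_inj (finite_orbit_ball (4 * K ^+ 2))
  (f := fun b => - ((2 * ht b) *: (b *m P)))).
  move=> b [pb bK]; have [Pb _] := pb; have [t tb] := root_reflection coxWS Pb.
  exists t.
    by rewrite (affine_action_reflection e _ tb) ?F0 ?add0r// (root_form coxWS Pb).
  rewrite dotNl dotNr opprK dotZl dotZr positive_root_unit // mulr1.
  by have := ht_gt0 pb; rewrite /ht; nra.
move=> b c [pb _] [pc _] /oppr_inj E.
have [Pb _] := pb; have [Pc _] := pc; have hb := ht_gt0 pb; have hc := ht_gt0 pc.
have hE : ht b = ht c.
  have := congr1 (fun u : 'rV[R]_d => dot u u) E; rewrite !(dotZl, dotZr) !positive_root_unit //.
  by rewrite !mulr1 => E2; nra.
have [k kE] : exists k, b - c = k *: de.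
  apply: Pker; rewrite mulmxBl; apply/eqP; rewrite subr_eq0; apply/eqP.
  by move: E; rewrite hE => /(scalerI _); apply; rewrite gt_eqF // mulr_gt0.
apply/eqP; rewrite -subr_eq0 kE.
have : ht (b - c) = k.
  by rewrite kE -e_ht dotZr ede mulr1.
rewrite /ht; under eq_bigr do rewrite !mxE.
by rewrite sumrB -/(ht b) -/(ht c) hE subrr => <-; rewrite scale0r.
Qed.

(** Take the point of the orbit of [p] nearest to the origin: were it on the negative side of a
    simple wall, reflecting would bring it nearer. *)
Lemma move_to_alcove p : exists x, forall i, 0 <= F (phi x p) (a_ i).
Proof.
pose A := [set x : W | dot (phi x p) (phi x p) <= dot p p].
have finA : finite_set A.
  apply: (finite_set_inj (finite_orbit_ball (4 * dot p p)) (f := fun x => phi x 0)).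
    move=> x xA; exists x => //.
    have := affine_action_isometry e x 0 p; rewrite sub0r dotNl dotNr opprK.
    (* The square of [phi x 0 - 2 *: phi x p] completes the parallelogram identity, whence
       [dot (phi x 0) (phi x 0) <= 4 * dot p p]. *)
    have := dot_ge0 (phi x 0 + (1 - 2) *: (2 *: phi x p)); move: xA; rewrite /A /=.
    rewrite !dot_linE (dotC (phi x p) (phi x 0)).
    by move: (dot _ _) (dot _ _) (dot _ _) (dot _ _) => *; nra.
  by move=> x y _ _ E; apply: orbit_separated; rewrite E subrr dot0l ltr01.
have [|x xA xmin] := finite_set_argmin (fun x => dot (phi x p) (phi x p)) finA.
  by exists 1%g; rewrite /A /= affine_action1.
exists x => i; rewrite leNgt; apply/negP => neg.
have Pi := root_form coxWS (root_simple R coxWS i).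
have si v : act (s i) v = reflection m (a_ i) v by rewrite act_simple.
set q := phi x p in neg xmin; set z := F q (a_ i) in neg.
have sqE : phi (s i * x)%g p = q - (2 * z) *: (a_ i *m P).
  by rewrite affine_actionM // (affine_action_reflection e _ si).
have qE : dot (q - (2 * z) *: (a_ i *m P)) (q - (2 * z) *: (a_ i *m P)) =
    dot q q + 4 * z.
  rewrite !dot_linE positive_root_unit; last exact: root_simple.
  rewrite (dotC (a_ i *m P)).
  have -> : dot q (a_ i *m P) = z - 1 by rewrite /z /affine_value e_ht ht_simple; ring.
  ring.
have xA' : dot q q <= dot p p := xA.
have min := xmin (s i * x)%g; rewrite /A /= sqE qE in min.
have : dot q q <= dot q q + 4 * z by apply: min; lra.
lra.
Qed.

(** The vertex of the alcove at which all simple roots but [a_ j] vanish. *)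
Let vertex j : exists p, forall v, F p v = v 0 j / de 0 j.
Proof.
have [|p pE] := dual_model (c := (de 0 j)^-1 *: a_ j - e).
  rewrite dotDl dotNl dotZl ede dotC dotE (bigD1 j) //= simple_rootE eqxx mulr1.
  rewrite big1 ?addr0 => [|i ij]; last by rewrite simple_rootE (negbTE ij) mulr0.
  by rewrite mulVf ?subrr// gt_eqF.
exists p => v; rewrite /affine_value -pE dotDl dotNl addrC subrK dotZl dotC.
rewrite dotE (bigD1 j) //= simple_rootE eqxx mulr1.
rewrite big1 ?addr0 => [|i ij]; last by rewrite simple_rootE (negbTE ij) mulr0.
by rewrite mulrC.
Qed.

(** A root with zero coordinate [j] vanishes at vertex [j], so its height is at most the distance of
    that vertex from the origin. *)
Lemma finite_proper_support : finite_set [set b | pos b /\ exists j, b 0 j = 0].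
Proof.
have /choice[p pE] := vertex.
apply: sub_finite_set (finite_bounded_height (1 + \sum_j dot (p j) (p j))).
move=> b [pb [j bj]]; split=> //; have [Pb _] := pb.
have := pE j b; rewrite bj mul0r /affine_value e_ht /ht => E.
have := unit_dot_le (p j) Pb.
have : dot (p j) (p j) <= \sum_j dot (p j) (p j).
  by rewrite (bigD1 j) //= lerDl sumr_ge0 // => i _; exact: dot_ge0.
have -> : dot (p j) (b *m P) = - \sum_i b 0 i by lra.
by have := ht_gt0 pb; rewrite /ht; move: (\sum_i b 0 i) => *; nra.
Qed.

Let alcove_zero p b : (forall i, 0 <= F p (a_ i)) -> pos b -> F p b = 0 ->
  exists j, b 0 j = 0.
Proof.
move=> p0 [Pb b0] /eqP; rewrite affine_value_expand psumr_eq0 => [/allP bp|i _]; last first.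
  by rewrite mulr_ge0.
apply: contrapT => nob.
have p_eq0 i : F p (a_ i) = 0.
  have := bp i (mem_index_enum _); rewrite /= mulf_eq0 => /orP[/eqP bi|/eqP//].
  by case: nob; exists i.
have := affine_value_de ede p; rewrite affine_value_expand big1 => [/esym/eqP|i _].
  by rewrite oner_eq0.
by rewrite p_eq0 mulr0.
Qed.

Let common_zero b g : Phi b -> Phi g -> B b g ^+ 2 < 1 ->
  exists p, F p b = 0 /\ F p g = 0.
Proof.
move=> Pb Pg bg; set c := B b g in bg *.
have c1 : 1 - c ^+ 2 != 0 by lra.
(* The solution, within the span of the two directions, of the system whose matrix is their Gram
   matrix. *)
exists (((c * ht g - ht b) / (1 - c ^+ 2)) *: (b *m P) +
        ((c * ht b - ht g) / (1 - c ^+ 2)) *: (g *m P)).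
rewrite /affine_value !e_ht !dotDl !dotZl !positive_root_unit // -!BE.
rewrite (bformC cox g b) -/c.
by split; field.
Qed.

(** Two roots with product strictly between -1 and 1 vanish at a common point. Moving it into the
    closed alcove turns both, up to sign, into positive roots with a zero coordinate, and there are
    finitely many of these. *)
Lemma finite_form_values : exists S : set R, finite_set S /\
  forall b g, Phi b -> Phi g -> B b g ^+ 2 < 1 -> S (B b g).
Proof.
pose Z := [set b | pos b /\ exists j, b 0 j = 0].
pose Z' := Z `|` (-%R @` Z).
have finZ' : finite_set Z'.
  rewrite finite_setU; split; first exact: finite_proper_support.
  exact/finite_image/finite_proper_support.
exists ((fun bg => B bg.1 bg.2) @` (Z' `*` Z')); split.
  exact/finite_image/finite_setX.
move=> b g Pb Pg bg; have [p [pb pg]] := common_zero Pb Pg bg.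
have [x xp] := move_to_alcove p.
have inZ c : Phi c -> F p c = 0 -> Z' (act x c).
  move=> Pc pc; have Pxc := root_act coxWS x Pc.
  have xc0 : F (phi x p) (act x c) = 0 by rewrite affine_actionE // actK.
  case: (root_sign coxWS Pxc) => [pxc|/negative_rootsP nxc].
    by left; split=> //; exact: alcove_zero xp pxc xc0.
  right; exists (- act x c); last by rewrite opprK.
  by split=> //; apply: alcove_zero xp nxc _; rewrite affine_valueN xc0 oppr0.
exists (act x b, act x g) => /=; last exact: act_form.
by split; exact: inZ.
Qed.

(** Directions are unit vectors. A product at least 1 means equality, and smaller ones stay away
    from 1 by [finite_form_values], so distinct directions are uniformly separated. *)
Lemma finite_directions : finite_set [set b *m P | b in Phi].
Proof.
have [S [finS SP]] := finite_form_values.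
have [k k1 kS] : exists2 k : R, 0 < k & forall z, S z -> z < 1 -> z <= 1 - k.
  have finS' : finite_set (1 |` (fun z => 1 - z) @` (S `&` [set z | z < 1])).
    rewrite finite_setU; split; first exact: finite_set1.
    by apply: finite_image; exact: finite_setIl.
  have [|k kS kmin] := finite_set_argmin id finS'; first by exists 1; left.
  exists k; first by case: kS => [->//|[z [_ /= z1] <-]]; lra.
  by move=> z Sz z1; have := kmin (1 - z) (or_intror (ex_intro2 _ _ z (conj Sz z1) erefl)); rewrite /=; lra.
(* The squared distance of two directions is [2 - 2 * B b g], hence [2 * k]. The cap 1 ensures
   [k' ^+ 2 <= k'] and rules out products at most -1. *)
pose k' := Num.min (2 * k) 1.
have k'0 : 0 < k' by rewrite lt_min; apply/andP; split; lra.
have k'k : k' <= 2 * k by rewrite ge_min lexx.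
have k'1 : k' <= 1 by rewrite ge_min lexx orbT.
apply: (@finite_grid_separated _ _ _ (1 + 1) (k' / d.+1%:R)).
- by rewrite divr_gt0 ?ltr0n.
- by move=> _ i [b Pb <-]; apply: coord_bound; rewrite positive_root_unit.
move=> _ _ [b Pb <-] [g Pg <-] bg; apply/eqP; rewrite -subr_eq0; apply/eqP/dot_eq0.
set z := b *m P - g *m P.
have zE : dot z z = 2 - 2 * B b g.
  by rewrite /z !dot_linE !positive_root_unit // -!BE (bformC cox g); ring.
have z_small : dot z z < k'.
  have : dot (k'^-1 *: z) (k'^-1 *: z) < 1.
    apply: coord_small => i; rewrite mxE normrM gtr0_norm ?invr_gt0//.
    by rewrite mulrC ltr_pdivrMr // mulrC; have := bg i; rewrite !mxE.
  rewrite dotZ exprVn mulrC ltr_pdivrMr ?exprn_gt0// mul1r.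
  by move/lt_le_trans; apply; rewrite expr2 ger_pMl.
have z0 := dot_ge0 z.
have [B1|B1] := ltP (B b g) 1; last by lra.
have [Bm|Bm] := ltP (-1) (B b g); last by lra.
have Sbg : S (B b g) by apply: SP => //; nra.
by have := kS _ Sbg B1; lra.
Qed.

End Height.
End AffineAction.

(** * The affine root system *)

(** Let [r] be the least positive element. Two point reflections compose to a translation by an even
    multiple of [r], reducing [c] to [c'] between 0 and [2 * r]; unless [c'] is 0, both [c'] and
    [2 * r - c'] are at least [r], so [c'] is [r]. *)
Lemma discrete_reflective (R : realType) (T : set R) : T 0 ->
  (forall x y, T x -> T y -> T (2 * x - y)) -> (exists2 x, x <> 0 & T x) ->
  (forall K, finite_set (T `&` [set x | `|x| <= K])) ->
  exists2 r : R, 0 < r & forall c, T c <-> exists k : int, c = k%:~R * r.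
Proof.
move=> T0 Trefl [y0 y0_neq0 Ty0] Tfin.
have TN x : T x -> T (- x) by move=> /(Trefl _ _ T0); rewrite mulr0 sub0r.
have [y y_gt0 Ty] : exists2 y, 0 < y & T y.
  case: (ltgtP 0 y0) => [?|?|E]; [by exists y0 | | by case: y0_neq0].
  by exists (- y0); [rewrite oppr_gt0 | exact: TN].
pose A := [set x | [/\ T x, 0 < x & x <= y]].
have finA : finite_set A.
  by apply: sub_finite_set (Tfin y) => x [Tx x0 xy]; split=> //=; rewrite gtr0_norm.
have [|r [Tr r0 ry] rmin] := finite_set_argmin id finA; first by exists y.
have {}rmin x : T x -> 0 < x -> r <= x.
  move=> Tx x0; case: (leP x y) => xy; first by apply: rmin.
  exact: le_trans ry (ltW xy).
have Tnat k : T (k%:R * r) /\ T (k.+1%:R * r).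
  elim: k => [|k [IH0 IH1]]; first by rewrite mul0r mul1r.
  split=> //; have := Trefl _ _ IH1 IH0.
  rewrite (_ : 2 * (k.+1%:R * r) - k%:R * r = k.+2%:R * r) //.
  by rewrite -[k.+2]addn2 -[k.+1]addn1 !natrD; ring.
have Tint (k : int) : T (k%:~R * r).
  case: k => k; first by case: (Tnat k).
  by rewrite NegzE mulrNz mulNr; apply: TN; case: (Tnat k).
exists r => // c; split=> [Tc|[k ->]//].
have trans x (k : int) : T x -> T (x + 2 * (k%:~R * r)).
  by move=> /(Trefl _ _ T0)/(Trefl _ _ (Tint k)); rewrite (_ : 2 * _ - _ = x + 2 * (k%:~R * r)) //; ring.
pose k := Num.floor (c / (2 * r)).
have /andP[k1 k2] := floor_itv (c / (2 * r)).
have r2 : 0 < 2 * r by rewrite mulr_gt0.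
rewrite -/k ler_pdivlMr // in k1; rewrite -/k ltr_pdivrMr // intrD in k2.
have := trans c (- k) Tc; rewrite mulrNz; set c' := c + _ => Tc'.
have c'E : c = c' + 2 * (k%:~R * r) by rewrite /c'; ring.
have c'0 : 0 <= c' by rewrite /c'; lra.
have c'2 : c' < 2 * r by rewrite /c'; lra.
have [c'_eq0|c'_neq0] := eqVneq c' 0.
  by exists (2 * k); rewrite c'E c'_eq0 intrM add0r; ring.
have rc' : r <= c' by apply: rmin => //; rewrite lt_neqAle eq_sym c'_neq0.
have c'r : r <= 2 * r - c' by apply: rmin; [apply: Trefl | lra].
have c'_eq : c' = r by lra.
by exists (2 * k + 1); rewrite c'E c'_eq intrD intrM; ring.
Qed.

Section AffineRoots.
Context (R : realType) (d : nat) (m : 'M[nat]_d.+1) (W : groupType)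
  (s : 'I_d.+1 -> W) (de : 'rV[R]_d.+1) (P : 'M[R]_(d.+1, d)).
Local Notation B := (bform (R := R) m).
Local Notation a_ := (@simple_root R d.+1).
Local Notation act := (@act R d.+1 m W s).
Local Notation Phi := (@Defs.roots R d.+1 m W s).
Local Notation pos := (@positive_roots R d.+1 m W s).
Implicit Types (u v b g : 'rV[R]_d.+1) (p q : 'rV[R]_d) (x y : W) (i j l : 'I_d.+1).

Hypothesis coxWS : coxeter_system m s.
Hypothesis derad : forall u, B de u = 0.
Hypothesis BE : forall u v, B u v = dot (u *m P) (v *m P).
Hypothesis deP : de *m P = 0.
Hypothesis Pker : forall u, u *m P = 0 -> exists c, u = c *: de.
Hypothesis Pinv : exists C : 'M[R]_(d, d.+1), C *m P = 1%:M.
Hypothesis de_gt0 : forall i, 0 < de 0 i.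
Hypothesis de_sum : \sum_i de 0 i = 1.
Hypothesis infW : infinite_set [set: W].
Hypothesis irr : irreducible_coxeter m.

Let cox : coxeter_matrix m. Proof. by case: coxWS. Qed.
Let actde x : act x de = de. Proof. exact: act_radical. Qed.
Let bde u : B u de = 0. Proof. by rewrite bformC. Qed.

Lemma infinite_roots : infinite_set Phi.
Proof.
move=> finPhi; have [z zmax _] := weak_maximal_above R coxWS infW 1%g.
have [p [red _]] := weak_maximal_seq coxWS infW zmax.
have [|k kN] := @inv_set_seq_finite R _ m _ _ coxWS p _ red _ (@subset_refl _ _).
  apply: sub_finite_set finPhi => b /(inv_set_seqP coxWS _ red)[k [[]]] //.
exact: (@inv_set_seq_not_sub R _ m _ _ coxWS p _ red kN).
Qed.

(** The reflections in two roots of the same direction compose to a translation along the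
    radical. *)
Lemma root_translate b c g : Phi b -> Phi (b + c *: de) -> Phi g ->
  Phi (g + (2 * c * B g b) *: de).
Proof.
move=> Pb Pbc Pg; have := root_reflect coxWS Pbc (root_reflect coxWS Pb Pg).
have bb := root_form coxWS Pb.
rewrite /reflection !(bformBl, bformDr, bformZl, bformZr, bde) bb mulr0 !addr0.
congr (Phi _); apply/rowP => l; rewrite !mxE; ring.
Qed.

Let step_set i := [set c | Phi (a_ i + c *: de)].

Let step_set_finite i K : finite_set (step_set i `&` [set x | `|x| <= K]).
Proof.
have ht_i c : \sum_j (a_ i + c *: de) 0 j = 1 + c.
  under eq_bigr do rewrite !mxE; rewrite big_split /= -mulr_sumr de_sum mulr1.
  rewrite (bigD1 i) //= eqxx big1 ?addr0// => j ji; by rewrite (negbTE ji).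
have de_neq0 : de <> 0.
  by move=> de0; have := de_gt0 ord0; rewrite de0 mxE ltxx.
have finH := finite_bounded_height coxWS BE Pker Pinv de_sum (1 + K).
apply: (finite_set_inj (f := fun c => a_ i + c *: de)
   (C := [set b | pos b /\ \sum_j b 0 j <= 1 + K] `|`
         (-%R @` [set b | pos b /\ \sum_j b 0 j <= 1 + K]))).
- by rewrite finite_setU; split=> //; exact: finite_image.
- move=> c [Pc /= cK]; have := cK; rewrite ler_norml => /andP[c1 c2].
  case: (root_sign coxWS Pc) => [pc|/negative_rootsP nc].
    by left; split=> //; rewrite ht_i; lra.
  right; exists (- (a_ i + c *: de)); last by rewrite opprK.
  split=> //; under eq_bigr do rewrite mxE.
  by rewrite sumrN ht_i; lra.
- move=> c c' _ _ /addrI /eqP; rewrite -subr_eq0 -scalerBl scaler_eq0.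
  by case/orP => [|/eqP//]; rewrite subr_eq0 => /eqP.
Qed.

(** Infinitely many roots share finitely many directions, so two of them differ by a multiple of
    [de], and conjugation makes one simple. [root_translate] then carries the property along the
    edges of the connected graph. *)
Let step_set_nontrivial : forall i, exists2 c, c <> 0 & step_set i c.
Proof.
have [i0 [c0 c0_neq0 c0P]] : exists i0, exists2 c, c <> 0 & step_set i0 c.
  apply: contrapT => no; apply: infinite_roots.
  have finD := finite_directions coxWS BE deP Pker Pinv de_gt0 de_sum.
  apply: (finite_set_inj finD (f := fun b => b *m P)) => [b Pb|b g Pb Pg E].
    by exists b.
  have [c cE] : exists c, g - b = c *: de.
    by apply: Pker; rewrite mulmxBl E subrr.
  have [c_eq0|/eqP c0] := eqVneq c 0; last first.
    case: no; have [x [i bE]] := Pb; exists i, c => //; rewrite /step_set /=.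
    have -> : a_ i + c *: de = act x^-1%g g.
      by rewrite -(subrK b g) cE actD // actZ // actde bE actK // addrC.
    exact: root_act.
  by apply/eqP; rewrite eq_sym -subr_eq0 cE c_eq0 scale0r.
have step i j : coxeter_edge m i j -> (exists2 c, c <> 0 & step_set i c) ->
    exists2 c, c <> 0 & step_set j c.
  move=> ij [c c_neq0 ic]; exists (2 * c * B (a_ j) (a_ i)).
    apply/eqP; rewrite !mulf_neq0 ?pnatr_eq0//; first exact/eqP.
    by rewrite bform_simple gram_sym // lt_eqF // gram_edge.
  by apply: root_translate => //; exact: root_simple.
have ext i j : connect (coxeter_edge m) i j -> (exists2 c, c <> 0 & step_set i c) ->
    exists2 c, c <> 0 & step_set j c.
  move=> /connectP[w pth ->]; elim: w i pth => //= k w IH i /andP[ik pth] /(step _ _ ik).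
  exact: IH.
by move=> i; apply: ext (ex_intro2 _ _ c0 c0_neq0 c0P); case: irr.
Qed.

Lemma root_steps : exists r : 'I_d.+1 -> R, (forall i, 0 < r i) /\
  forall i c, Phi (a_ i + c *: de) <-> exists k : int, c = k%:~R * r i.
Proof.
have /choice[r rP] : forall i, exists r, 0 < r /\
    forall c, Phi (a_ i + c *: de) <-> exists k : int, c = k%:~R * r.
  move=> i; have [||||r r0 rP] := @discrete_reflective R (step_set i); last by exists r.
  - by rewrite /step_set /= scale0r addr0; exact: root_simple.
  (* Reflecting [a_ i + y *: de] in [a_ i + x *: de] and negating yields the shift [2 * x - y]. *)
  - move=> x y Px Py; have := coxeter_rootN coxWS (root_reflect coxWS Px Py).
    rewrite /step_set /= /reflection !(bformDl, bformDr, bformZl, bformZr, bde, derad).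
    rewrite bform_simple1 //; congr (Phi _); apply/rowP => l; rewrite !mxE; ring.
  - exact: step_set_nontrivial.
  - exact: step_set_finite.
by exists r; split=> i; case: (rP i).
Qed.

End AffineRoots.

Lemma int_mul_le4 (k1 k2 : int) :
  0 < k1 * k2 <= 4 -> k2 ^+ 2 <= k1 * k2 -> 1 < k2 ^+ 2 -> k1 = k2.
Proof.
rewrite expr2 => /andP[h0 h4] h1 h2.
have h : `|k2| <= 2 by nia.
have k2E : k2 = 2 \/ k2 = -2 by nia.
by case: k2E => k2E; rewrite k2E in h1 h4 *; lia.
Qed.

(** * The rescaled roots, their lattice, and a special vertex *)

Section AffineLattice.
Context (R : realType) (d : nat) (m : 'M[nat]_d.+1) (W : groupType)
  (s : 'I_d.+1 -> W) (de : 'rV[R]_d.+1) (P : 'M[R]_(d.+1, d)).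
Local Notation B := (bform (R := R) m).
Local Notation a_ := (@simple_root R d.+1).
Local Notation act := (@act R d.+1 m W s).
Local Notation Phi := (@Defs.roots R d.+1 m W s).
Local Notation pos := (@positive_roots R d.+1 m W s).
Implicit Types (u v b c g : 'rV[R]_d.+1) (p q : 'rV[R]_d) (x y : W) (i j l : 'I_d.+1).

Hypothesis coxWS : coxeter_system m s.
Hypothesis derad : forall u, B de u = 0.
Hypothesis BE : forall u v, B u v = dot (u *m P) (v *m P).
Hypothesis deP : de *m P = 0.
Hypothesis Pker : forall u, u *m P = 0 -> exists t : R, u = t *: de.
Hypothesis Pinv : exists C : 'M[R]_(d, d.+1), C *m P = 1%:M.
Hypothesis de_gt0 : forall i, 0 < de 0 i.
Hypothesis de_sum : \sum_i de 0 i = 1.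
Hypothesis irr : irreducible_coxeter m.
Variable r : 'I_d.+1 -> R.
Hypothesis r_gt0 : forall i, 0 < r i.
Hypothesis rP : forall i (t : R),
  Phi (a_ i + t *: de) <-> exists k : int, t = k%:~R * r i.

Let cox : coxeter_matrix m. Proof. by case: coxWS. Qed.
Let actde x : act x de = de. Proof. exact: act_radical. Qed.
Let bde u : B u de = 0. Proof. by rewrite bformC. Qed.
Let r_neq0 i : r i != 0. Proof. by rewrite gt_eqF. Qed.
Let de_neq0 : de != 0.
Proof. by apply/eqP => de0; have := de_gt0 ord0; rewrite de0 mxE ltxx. Qed.
Let unit_root x i : B (act x (a_ i)) (act x (a_ i)) = 1.
Proof. by rewrite act_form // bform_simple1. Qed.

(** Conjugating the string of [a_ i] into that of [a_ j] makes [r i] an integer multiple of [r j];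
    by symmetry the two positive steps coincide. *)
Lemma translate_step x y i j (t : R) : act x (a_ i) + t *: de = act y (a_ j) ->
  r i = r j /\ exists k : int, t = k%:~R * r i.
Proof.
have half x' y' i' j' (t' : R) : act x' (a_ i') + t' *: de = act y' (a_ j') ->
    (exists k : int, t' = k%:~R * r j') /\ exists k : int, r i' = k%:~R * r j'.
  move=> E.
  have E' : act (y'^-1 * x')%g (a_ i') = a_ j' - t' *: de.
    rewrite actM // -[X in act _ X](addrK (t' *: de)) E.
    by rewrite -scaleN1r actD // actK // !actZ // actde scaleN1r.
  have shift (k : int) : exists k' : int, k%:~R * r i' - t' = k'%:~R * r j'.
    apply/rP; have : Phi (a_ i' + (k%:~R * r i') *: de) by apply/rP; exists k.
    move=> /(root_act coxWS (y'^-1 * x')%g); rewrite actD // actZ // actde E'.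
    by rewrite -addrA [- _ + _]addrC -scalerBl.
  have [k0 k0E] := shift 0; have [k1 k1E] := shift 1.
  split; first by exists (- k0); rewrite mulrNz mulNr -k0E; ring.
  by exists (k1 - k0); rewrite intrB mulrBl -k1E -k0E; ring.
move=> E; have [[k kE] [k1 k1E]] := half _ _ _ _ _ E.
have [|_ [k2 k2E]] := half y x j i (- t); first by rewrite -E scaleNr addrK.
suff rij : r i = r j by split=> //; exists k; rewrite rij.
have k1_gt0 : 0 < k1 by rewrite -(ltr0z R) -(pmulr_lgt0 _ (r_gt0 j)) -k1E.
have k2_gt0 : 0 < k2 by rewrite -(ltr0z R) -(pmulr_lgt0 _ (r_gt0 i)) -k2E.
have h1 : 1 <= k1%:~R :> R by rewrite (ler_int R 1).
have h2 : 1 <= k2%:~R :> R by rewrite (ler_int R 1).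
have hi := r_gt0 i; have hj := r_gt0 j.
apply/eqP; rewrite eq_le; apply/andP; split.
  by rewrite k2E; apply: ler_peMl => //; exact: ltW.
by rewrite k1E; apply: ler_peMl => //; exact: ltW.
Qed.

Definition affine_roots : set 'rV[R]_d.+1 :=
  [set b | exists x i, b = (r i)^-1 *: act x (a_ i)].
Local Notation Phia := affine_roots.
Local Notation A_ i := ((r i)^-1 *: a_ i).

Lemma affine_root_simple i : Phia (A_ i).
Proof. by exists 1%g, i; rewrite act1. Qed.

Lemma affine_root_act x b : Phia b -> Phia (act x b).
Proof. by move=> [y [i ->]]; exists (x * y)%g, i; rewrite actZ // actM. Qed.

Lemma affine_rootN b : Phia b -> Phia (- b).
Proof.
by move=> [y [i ->]]; exists (y * s i)%g, i; rewrite actM // act_simple_self // actN // scalerN.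
Qed.

Lemma affine_root_translate b (k : int) : Phia b -> Phia (b + k%:~R *: de).
Proof.
move=> [x [i ->]].
have : Phi (act x (a_ i + (k%:~R * r i) *: de)).
  by apply: root_act => //; apply/rP; exists k.
rewrite actD // actZ // actde => -[y [j E]]; have [rij _] := translate_step E.
exists y, j; rewrite -E -rij scalerDr scalerA; congr (_ + _ *: _).
by field; rewrite r_neq0.
Qed.

Lemma affine_root_same_dir b c : Phia b -> Phia c -> b *m P = c *m P ->
  exists k : int, c = b + k%:~R *: de.
Proof.
move=> [x [i ->]] [y [j ->]] E.
have rij : r i = r j.
  have := congr1 (fun u : 'rV[R]_d => dot u u) E; rewrite /= -!BE !(bformZl, bformZr).
  rewrite !unit_root !mulr1 => E2; have hi := r_gt0 i; have hj := r_gt0 j.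
  apply: invr_inj; have : (r i)^-1 ^+ 2 = (r j)^-1 ^+ 2 by [].
  by move/eqP; rewrite eqrXn2 ?invr_ge0 ?ltW// => /eqP.
have [t tE] : exists t, act y (a_ j) - act x (a_ i) = t *: de.
  apply: Pker; rewrite mulmxBl; apply/eqP; rewrite subr_eq0; apply/eqP.
  move: E; rewrite -!scalemxAl rij => /scalerI -> //.
  by rewrite invr_eq0.
have [|_ [k kE]] := @translate_step x y i j t; first by rewrite -tE addrC subrK.
exists k; rewrite -rij -[act y _](subrK (act x (a_ i))) tE kE scalerDr scalerA addrC.
by congr (_ + _ *: _); field.
Qed.

(** The underlying unit directions agree up to sign, and replacing [x] by [x * s i] absorbs the
    sign. Then [translate_step] equates the scales. *)
Lemma affine_root_proportional b c (t : R) : Phia b -> Phia c ->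
  t *: (b *m P) = c *m P -> t = 1 \/ t = -1.
Proof.
move=> Pb Pc E; have [x [i bE]] := Pb; have [y [j cE]] := Pc.
have bb : B b b = (r i)^-1 ^+ 2 by rewrite bE bformZl bformZr unit_root mulr1.
have cc : B c c = (r j)^-1 ^+ 2 by rewrite cE bformZl bformZr unit_root mulr1.
have tt : t ^+ 2 * (r i)^-1 ^+ 2 = (r j)^-1 ^+ 2.
  by rewrite -bb -cc (BE c) -E dotZ -BE.
suff : r i = r j.
  move=> rij; move: tt; rewrite rij -[RHS]mul1r => /mulIf H.
  have /eqP : t ^+ 2 = 1 by apply: H; rewrite expf_neq0 // invr_eq0.
  by rewrite sqrf_eq1 => /orP[] /eqP; [left|right].
have tr : (t * r j / r i) ^+ 2 = 1.
  rewrite !exprMn mulrAC tt exprVn mulVf // expf_neq0 //.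
have E2 : act y (a_ j) *m P = (t * r j / r i) *: (act x (a_ i) *m P).
  have -> : act y (a_ j) = r j *: c by rewrite cE scalerA divff // scale1r.
  have -> : act x (a_ i) = r i *: b by rewrite bE scalerA divff // scale1r.
  rewrite -!scalemxAl -E !scalerA; congr (_ *: _).
  by field.
have [sg sgE] : exists z, act z (a_ i) *m P = act y (a_ j) *m P.
  move/eqP: tr; rewrite sqrf_eq1 => /orP[] /eqP tr; rewrite tr in E2.
    by exists x; rewrite E2 scale1r.
  exists (x * s i)%g; rewrite E2 actM // act_simple_self //.
  by rewrite actN // mulNmx scaleN1r.
have [t' tE'] : exists t', act y (a_ j) - act sg (a_ i) = t' *: de.
  by apply: Pker; rewrite mulmxBl -sgE subrr.
by have [|] := @translate_step sg y i j t'; first by rewrite -tE' addrC subrK.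
Qed.

(** By [root_translate] with shift [r i], the quantity is, up to scale, a shift of a root along the
    radical, so it is a multiple of the step of that root. *)
Lemma affine_root_int x i c : Phia c -> 2 * r i * B c (act x (a_ i)) \is a Num.int.
Proof.
move=> [y [j ->]]; have Pg : Phi (act y (a_ j)) by exists y, j.
have Pb : Phi (act x (a_ i)) by exists x, i.
have Pbr : Phi (act x (a_ i) + r i *: de).
  have : Phi (act x (a_ i + r i *: de)).
    by apply: root_act => //; apply/rP; exists 1; rewrite mul1r.
  by rewrite actD // actZ // actde.
have [z [k E]] := root_translate coxWS derad Pb Pbr Pg.
have [_ [t tE]] := translate_step E.
apply/intrP; exists t; apply: (mulIf (r_neq0 j)); rewrite -tE bformZl.
by field.
Qed.

(** Membership in the lattice spanned by the [A_ i], in coordinates. *)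
Let L v := forall j, v 0 j * r j \is a Num.int.

Let L_D u v : L u -> L v -> L (u + v).
Proof. by move=> Lu Lv j; rewrite mxE mulrDl rpredD. Qed.

Let L_N u : L u -> L (- u).
Proof. by move=> Lu j; rewrite mxE mulNr rpredN. Qed.

Let L_simple (t : R) i : t * r i \is a Num.int -> L (t *: a_ i).
Proof.
move=> ti j; rewrite mxE simple_rootE; case: eqP => [->|_]; first by rewrite mulr1.
by rewrite mulr0 mul0r.
Qed.

Let L_simple_inv i : L (A_ i).
Proof. by apply: L_simple; rewrite mulVf. Qed.

Lemma affine_root_lattice b : Phia b -> L b.
Proof.
move=> [x [i ->]]; have [w <-] := word_prod_surj coxWS x.
elim: w => [|k w IH]; first by rewrite word_prod_nil act1.
rewrite word_prod_cons actM // act_simple // simple_reflE /reflection.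
rewrite scalerBr scalerA; apply: L_D => //; apply/L_N/L_simple.
have : Phia ((r i)^-1 *: act (word_prod s w) (a_ i)) by exists (word_prod s w), i.
move=> /(affine_root_int 1%g k); rewrite act1 // bformZl.
by congr (_ \is a _); ring.
Qed.

Let L_de : L de.
Proof.
have /affine_root_lattice L1 := affine_root_translate 1 (affine_root_simple ord0).
by have := L_D L1 (L_N (L_simple_inv ord0)); rewrite scale1r [_ + de]addrC addrK.
Qed.

Lemma lattice_form_int i u : L u -> 2 * r i * B u (a_ i) \is a Num.int.
Proof.
move=> Lu; rewrite bform_expandl mulr_sumr; apply: rpred_sum => j _.
have := affine_root_int 1%g i (affine_root_simple j); rewrite act1 // bformZl => h.
have -> : 2 * r i * (u 0 j * B (a_ j) (a_ i)) =
  (u 0 j * r j) * (2 * r i * ((r j)^-1 * B (a_ j) (a_ i))) by field.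
exact: rpredM.
Qed.

Let orbit_nonorthogonal i j : exists x, B (act x (a_ i)) (a_ j) != 0.
Proof.
have /connectP[w pth ->] : connect (coxeter_edge m) i j by case: irr.
suff ext k : (exists x, B (act x (a_ i)) (a_ k) != 0) -> path (coxeter_edge m) k w ->
    exists x, B (act x (a_ i)) (a_ (last k w)) != 0.
  by apply: ext => //; exists 1%g; rewrite act1 // bform_simple1 // oner_neq0.
elim: w k {pth} => //= k' w IH k [x xk] /andP[kk' pth]; apply: IH pth.
have [E|] := eqVneq (B (act x (a_ i)) (a_ k')) 0; last by exists x.
exists (s k * x)%g; rewrite actM // act_simple // simple_reflE /reflection.
rewrite bformBl E bformZl sub0r oppr_eq0 !mulf_neq0 ?pnatr_eq0//.
by rewrite bform_simple lt_eqF // gram_edge.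
Qed.

Section Shortest.
Variable l : 'I_d.+1.
Hypothesis rmax : forall i, r i <= r l.

(** The squared length of [A_ i] is [(r i)^-1 ^+ 2], so [A_ l] is shortest. The Cartan integers of a
    nonorthogonal pair of conjugates have product at most 4, and their quotient is the ratio of
    squared lengths: the smaller integer is 1 in absolute value, or the two are equal. *)
Let ratio_int i : (r l / r i) ^+ 2 \is a Num.int.
Proof.
have [x xil] := orbit_nonorthogonal i l; set z := B _ _ in xil.
have z1 : z ^+ 2 <= 1.
  have := dot_cauchy (act x (a_ i) *m P) (a_ l *m P).
  by rewrite -!BE unit_root bform_simple1 // mulr1.
have n1 : 2 * r l * ((r i)^-1 * z) \is a Num.int.
  by rewrite /z -bformZl -[a_ l](act1 coxWS); apply: affine_root_int; exists x, i.
have n2 : 2 * r i * ((r l)^-1 * z) \is a Num.int.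
  rewrite /z bformC // -bformZl; apply: affine_root_int; exact: affine_root_simple.
case/intrP: n1 => k1 k1E; case/intrP: n2 => k2 k2E.
have k12 : k1%:~R * k2%:~R = 4 * z ^+ 2 :> R.
  by rewrite -k1E -k2E; field; rewrite !r_neq0.
have rat : k1%:~R = (r l / r i) ^+ 2 * k2%:~R.
  by rewrite -k1E -k2E; field; rewrite !r_neq0.
have rat1 : 1 <= (r l / r i) ^+ 2.
  by rewrite exprn_ege1 // ler_pdivlMr // mul1r.
have z0 : 0 < z ^+ 2 by rewrite exprn_even_gt0.
have k2_neq0 : k2 != 0.
  apply/eqP => k20; move: k12; rewrite k20 mulr0; lra.
have k1k2 : 0 < k1 * k2 <= 4.
  rewrite -(ltr0z R) -(ler_int R) intrM k12; apply/andP; split; first lra.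
  by rewrite [4%:~R](_ : _ = 4) //; lra.
have k2k1 : k2 ^+ 2 <= k1 * k2.
  rewrite -(ler_int R) intrM rat expr2 intrM -mulrA -!expr2 ler_peMl //.
  exact: sqr_ge0.
have : (r l / r i) ^+ 2 = k1%:~R / k2%:~R.
  by rewrite rat mulfK // intr_eq0.
case: (leP (k2 ^+ 2) 1) => h.
  have : k2 = 1 \/ k2 = -1 by nia.
  move=> k2pm ->; apply/intrP; case: k2pm => ->; [exists k1 | exists (- k1)];
    by rewrite ?mulrNz mulr1z ?invrN invr1 ?mulrN mulr1.
have -> : k1 = k2 by exact: int_mul_le4.
by rewrite divff ?intr_eq0// => ->.
Qed.

(** Normalized so that the shortest root [A_ l] has value 1. *)
Let q v := B v v * r l ^+ 2.

Let q_int v : L v -> q v \is a Num.int.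
Proof.
move=> Lv; suff [] : L v /\ q v \is a Num.int by [].
rewrite (row_sum_simple v); apply: (big_ind (fun v => L v /\ q v \is a Num.int)).
- by split=> [j|]; rewrite ?mxE ?mul0r// /q bform0l mul0r.
- move=> u w [Lu qu] [Lw qw]; split; first exact: L_D.
  have -> : q (u + w) = q u + q w + 2 * B u w * r l ^+ 2.
    by rewrite /q !(bformDl, bformDr) (bformC cox w u); ring.
  apply: rpredD; first exact: rpredD.
  rewrite bform_expandr mulr_sumr mulr_suml; apply: rpred_sum => j _.
  have -> : 2 * (w 0 j * B u (a_ j)) * r l ^+ 2 =
    (w 0 j * r j) * (2 * r j * B u (a_ j)) * (r l / r j) ^+ 2 by field.
  exact: rpredM (rpredM (Lw j) (lattice_form_int j Lu)) (ratio_int j).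
- move=> j _; split; first exact: L_simple.
  rewrite /q bformZl bformZr bform_simple1 //.
  have -> : v 0 j * (v 0 j * 1) * r l ^+ 2 = (v 0 j * r j) ^+ 2 * (r l / r j) ^+ 2.
    by field.
  exact: rpredM (rpredX 2 (Lv j)) (ratio_int j).
Qed.

Let B_ge0 v : 0 <= B v v.
Proof. by rewrite BE dot_ge0. Qed.

Let B_eq0 v : B v v = 0 -> exists t : R, v = t *: de.
Proof. by rewrite BE => /dot_eq0; exact: Pker. Qed.

Let rl2 : 0 < r l ^+ 2. Proof. by rewrite exprn_gt0. Qed.

Let q_ge1 v : L v -> q v != 0 -> 1 <= q v.
Proof.
move=> /q_int /intrP[k kE] q0; have : 0 <= q v by rewrite mulr_ge0 // ltW.
rewrite kE -[1]/(1%:~R) ler_int ler0z => k0; rewrite -gtz0_ge1 lt_neqAle k0 andbT.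
by apply: contraNneq q0 => k00; rewrite kE -k00.
Qed.

(** The positive and negative parts have disjoint supports, so their product is nonpositive and
    [q v] is at least the sum of their values. As [q] is integral on the lattice, one part is
    isotropic, a multiple of [de], whose coordinates are all positive. *)
Let short_sign v : L v -> q v = 1 -> nonneg v \/ nonneg (- v).
Proof.
move=> Lv qv1; pose vp := \row_j Num.max (v 0 j) 0; pose vm := \row_j Num.max (- v 0 j) 0.
have Lp : L vp.
  by move=> j; rewrite mxE; case: leP => _; [rewrite mul0r | exact: Lv].
have Lm : L vm.
  by move=> j; rewrite mxE; case: leP => _; [rewrite mul0r | rewrite mulNr rpredN; exact: Lv].
have vE : v = vp - vm.
  by apply/rowP => j; rewrite !mxE; case: (leP (v 0 j) 0); case: (leP (- v 0 j) 0) => *; lra.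
have pm0 : B vp vm <= 0.
  rewrite bform_expandl; apply: sumr_le0 => i _; rewrite bform_expandr.
  rewrite mulr_sumr; apply: sumr_le0 => j _; rewrite !mxE bform_simple.
  have [<-|ij] := eqVneq i j.
    by case: (leP (v 0 i) 0); case: (leP (- v 0 i) 0); rewrite ?mul0r ?mulr0 // => *; exfalso; lra.
  have g0 := gram_le0 R cox ij.
  have p0 : 0 <= Num.max (v 0 i) 0 by rewrite le_max lexx orbT.
  have m0 : 0 <= Num.max (- v 0 j) 0 by rewrite le_max lexx orbT.
  by rewrite mulr_ge0_le0 // mulr_ge0_le0.
have qE : q v = q vp + q vm - 2 * B vp vm * r l ^+ 2.
  by rewrite {1}vE /q !(bformBl, bformBr) (bformC cox vm vp); ring.
have pm0' : 0 <= - 2 * B vp vm * r l ^+ 2 by rewrite mulr_ge0 ?(ltW rl2)//; lra.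
have qp0 : 0 <= q vp by rewrite mulr_ge0 // ltW.
have qm0 : 0 <= q vm by rewrite mulr_ge0 // ltW.
have q0 u : q u = 0 -> exists t : R, u = t *: de.
  by move/eqP; rewrite mulf_eq0 (gt_eqF rl2) orbF => /eqP; exact: B_eq0.
have [/q0[t tE]|/(q_ge1 Lp) qp1] := eqVneq (q vp) 0; last first.
  have [/q0[t tE]|/(q_ge1 Lm) qm1] := eqVneq (q vm) 0; last lra.
  case: (leP t 0) => t0; [left|right] => j; have := congr1 (fun u : 'rV_d.+1 => u 0 j) tE;
    rewrite !mxE.
    by have := mulr_le0_ge0 t0 (ltW (de_gt0 j)); case: (leP (- v 0 j) 0) => *; lra.
  by have := mulr_gt0 t0 (de_gt0 j); case: (leP (- v 0 j) 0) => *; lra.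
case: (leP t 0) => t0; [right|left] => j; have := congr1 (fun u : 'rV_d.+1 => u 0 j) tE;
  rewrite !mxE.
  by have := mulr_le0_ge0 t0 (ltW (de_gt0 j)); case: (leP (v 0 j) 0) => *; lra.
by have := mulr_gt0 t0 (de_gt0 j); case: (leP (v 0 j) 0) => *; lra.
Qed.

Let q_act x v : q (act x v) = q v.
Proof. by rewrite /q act_form. Qed.

Let L_act i v : L v -> L (act (s i) v).
Proof.
move=> Lv; rewrite act_simple // simple_reflE /reflection; apply: L_D => //.
apply/L_N/L_simple; have := lattice_form_int i Lv.
by congr (_ \is a _); ring.
Qed.

(** Reflecting in a simple root with positive product lowers the integral height. By [short_sign]
    the result stays nonnegative, unless [v] is a multiple of [a_ i]; minimality of the length of
    [A_ l] then forces [v] to be [A_ i]. *)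
Let short_positive_root N v : \sum_j v 0 j * r j < N%:R -> L v -> nonneg v -> q v = 1 ->
  Phia v.
Proof.
elim: N v => [|N IH] v htv Lv v0 qv1.
  have : 0 <= \sum_j v 0 j * r j by apply: sumr_ge0 => j _; rewrite mulr_ge0 // ltW.
  by rewrite leNgt htv.
have [i vi] : exists i, 0 < v 0 i * B v (a_ i).
  apply: contrapT => no; suff : q v <= 0 by rewrite qv1; lra.
  rewrite /q pmulr_lle0 // {2}(row_sum_simple v) bform_sumr; apply: sumr_le0 => i _.
  rewrite bformZr leNgt; apply/negP => vi; by apply: no; exists i.
have vi0 := v0 i.
have vi_gt0 : 0 < v 0 i by rewrite lt_neqAle vi0 andbT; apply: contraTneq vi => <-; rewrite mul0r ltxx.
have Bi : 0 < B v (a_ i) by rewrite -(pmulr_rgt0 _ vi_gt0).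
have Lw := L_act i Lv; have qw : q (act (s i) v) = 1 by rewrite q_act.
have wE : act (s i) v = v - (2 * B v (a_ i)) *: a_ i.
  by rewrite act_simple // simple_reflE.
have wj j : j != i -> act (s i) v 0 j = v 0 j.
  by move=> ji; rewrite wE !mxE eqxx (negbTE ji) mulr0 subr0.
have [w0|w0] := short_sign Lw qw.
  suff : Phia (act (s i) v) by move/(affine_root_act (s i)); rewrite -actM // (simple_mul_self coxWS) act1.
  apply: IH => //; have := htv; rewrite !(bigD1 i (P := xpredT)) //= -natr1.
  under [X in _ -> _ + X < _]eq_bigr => j ji do rewrite wj //.
  have -> : act (s i) v 0 i = v 0 i - 2 * B v (a_ i).
    by rewrite wE !mxE !eqxx mulr1.
  have /intrP[k kE] := lattice_form_int i Lv.
  have : 1 <= 2 * r i * B v (a_ i).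
    have : 0 < 2 * r i * B v (a_ i) by rewrite !mulr_gt0.
    by rewrite kE ltr0z -[1]/(1%:~R) ler_int gtz0_ge1.
  by rewrite mulrBl; move: (\sum_(_ < _ | _) _) => S *; lra.
have vE : v = v 0 i *: a_ i.
  apply/rowP => j; rewrite mxE simple_rootE; have [->|ji] := eqVneq j i.
    by rewrite mulr1.
  by have := w0 j; have := v0 j; rewrite mxE wj // mulr0; lra.
have : q v = (v 0 i * r l) ^+ 2.
  by rewrite /q {1 2}vE bformZl bformZr bform_simple1 //; ring.
rewrite qv1; have rl0 := r_gt0 l; have ri0 := r_gt0 i.
set n := v 0 i * r l => n1.
have n0 : 0 < n by rewrite mulr_gt0.
have {n0}n1 : n = 1 by nra.
have : 1 <= v 0 i * r i.
  have : 0 < v 0 i * r i by rewrite mulr_gt0.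
  by have /intrP[k ->] := Lv i; rewrite ltr0z -[1]/(1%:~R) ler_int gtz0_ge1.
have : v 0 i * r i <= n by rewrite ler_pM2l.
rewrite n1 => h1 h2; have h : v 0 i * r i = 1 by lra.
exists 1%g, i; rewrite act1 // {1}vE; congr (_ *: _).
by apply: (mulIf (r_neq0 i)); rewrite h mulVf.
Qed.

Let short_root v : L v -> q v = 1 -> Phia v.
Proof.
have root u : L u -> nonneg u -> q u = 1 -> Phia u.
  move=> Lu u0; have /archi_boundP h : 0 <= \sum_j u 0 j * r j.
    by apply: sumr_ge0 => j _; rewrite mulr_ge0 // ltW.
  exact: short_positive_root h Lu u0.
move=> Lv qv1; case: (short_sign Lv qv1) => [|v0]; first by move/root; apply.
rewrite -(opprK v); apply: affine_rootN; apply: root => //; first exact: L_N.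
by rewrite -qv1 /q bformNl bformNr opprK.
Qed.

(** Integer combinations of the coordinates of [de] in the [A_ i] form a group generated by some
    [rho], and [rho^-1 *: de] is still in the lattice. Adding it to [A_ l] gives a short lattice
    vector, hence a root of the same direction, so [rho^-1] is an integer and 1 belongs to the
    group. *)
Lemma radical_primitive_step : exists f : 'I_d.+1 -> R,
  (forall i, f i \is a Num.int) /\ \sum_i de 0 i * r i * f i = 1.
Proof.
pose T := [set t : R | exists f : 'I_d.+1 -> R,
  (forall i, f i \is a Num.int) /\ t = \sum_i de 0 i * r i * f i].
have Tint t : T t -> t \is a Num.int.
  move=> [f [fi ->]]; apply: rpred_sum => i _; apply: rpredM => //; exact: L_de.
have Tde i : T (de 0 i * r i).
  exists (fun j => (j == i)%:R); split=> [j|]; first by case: eqP => _; rewrite ?rpred0 ?rpred1.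
  rewrite (bigD1 i) //= eqxx mulr1 big1 ?addr0// => j /negbTE->; by rewrite mulr0.
have [||||rho rho0 rhoP] := @discrete_reflective R T.
- by exists (fun=> 0); split=> [i|]; rewrite ?rpred0// big1 // => i _; rewrite mulr0.
- move=> _ _ [f [fi ->]] [f' [fi' ->]]; exists (fun i => 2 * f i - f' i); split=> [i|].
    by rewrite rpredB // rpredM // ?rpred_nat.
  by rewrite mulr_sumr -sumrB; apply: eq_bigr => i _; ring.
- exists (de 0 ord0 * r ord0); last exact: Tde.
  by apply/eqP; rewrite gt_eqF // mulr_gt0.
- move=> K; have [N NK] : exists N : nat, K < N%:R.
    by exists (Num.bound `|K|); apply: le_lt_trans (ler_norm K) (archi_boundP (normr_ge0 K)).
  apply: (@sub_finite_set _ _ ((fun k : nat => k%:R : R) @` `I_N `|`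
      (fun k : nat => - (k%:R : R)) @` `I_N)); last first.
    by rewrite finite_setU; split; apply/finite_image/finite_II.
  move=> t [/Tint/intrP[k ->]] /= kK; have := le_lt_trans kK NK.
  case: k {kK} => k; first by rewrite normr_nat ltr_nat => kN; left; exists k.
  by rewrite NegzE mulrNz normrN normr_nat ltr_nat => kN; right; exists k.+1.
have Lrho : L (rho^-1 *: de).
  move=> j; have /rhoP[k kE] := Tde j; rewrite mxE -mulrA kE mulrCA mulVf ?gt_eqF//.
  by rewrite mulr1; apply/intrP; exists k.
have : Phia (A_ l + rho^-1 *: de).
  apply: short_root; first exact: L_D.
  rewrite /q !(bformDl, bformDr, bformZl, bformZr, bde, derad) bform_simple1 //.
  by field; rewrite !gt_eqF.
move=> /(affine_root_same_dir (affine_root_simple l))[].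
  by rewrite mulmxDl -(scalemxAl rho^-1) deP scaler0 addr0.
move=> k /addrI /eqP; rewrite -subr_eq0 -scalerBl scaler_eq0 (negbTE de_neq0) orbF subr_eq0.
move=> /eqP kE; have /rhoP : exists k' : int, k%:~R * rho = k'%:~R * rho by exists k.
by rewrite -kE mulVf ?gt_eqF// => -[f [fi fE]]; exists f.
Qed.

End Shortest.

(** The coefficients of [radical_primitive_step] define a point with integral values on all rescaled
    roots. Moved into the closed alcove, it has nonnegative integral values at the [A_ i], whose sum
    weighted by the positive integers [de 0 i * r i] is 1; so some weight is 1. *)
Lemma step_unit : exists i0, de 0 i0 * r i0 = 1.
Proof.
have [l lmax] : exists l, forall i, r i <= r l.
  by exists [arg max_(l > ord0) r l]%O; case: arg_maxP => // l _ h i; exact: h.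
have [f [fint f1]] := radical_primitive_step lmax.
pose e : 'rV[R]_d.+1 := const_mx 1; pose c : 'rV[R]_d.+1 := \row_i (f i * r i).
have ede : dot e de = 1.
  by rewrite dotE -de_sum; apply: eq_bigr => i _; rewrite mxE mul1r.
have cde : dot c de = 1.
  by rewrite dotE -f1; apply: eq_bigr => i _; rewrite mxE; ring.
have [p pE] : exists p, forall v, affine_value P e p v = dot c v.
  have [|p pE] := dual_model deP Pker Pinv (c := c - e).
    by rewrite dotDl dotNl cde ede subrr.
  by exists p => v; rewrite /affine_value -pE dotDl dotNl; ring.
have [x x0] := move_to_alcove coxWS BE Pinv p.
set p' := affine_action _ _ _ _ _ _ in x0; pose F i := affine_value P e p' (A_ i).
have Fint i : F i \is a Num.int.
  rewrite /F affine_actionE // pE dotE; apply: rpred_sum => j _; rewrite mxE.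
  rewrite -mulrA (mulrC (r j)); apply: rpredM => //.
  by apply: affine_root_lattice; apply: affine_root_act; exact: affine_root_simple.
have F0 i : 0 <= F i by rewrite /F affine_valueZ mulr_ge0 ?invr_ge0 ?(ltW (r_gt0 i)) ?x0.
have Fsum : \sum_i de 0 i * r i * F i = 1.
  rewrite -(affine_value_de deP ede p') affine_value_expand; apply: eq_bigr => i _.
  by rewrite /F affine_valueZ; field.
have ge1 t : t \is a Num.int -> 0 < t -> 1 <= t :> R.
  by move=> /intrP[k ->]; rewrite ltr0z -[1]/(1%:~R) ler_int gtz0_ge1.
have M1 i : 1 <= de 0 i * r i by apply: ge1; [exact: L_de | rewrite mulr_gt0].
have [i Fi] : exists i, 0 < F i.
  apply: contrapT => no; move/eqP: Fsum; rewrite big1 ?(eq_sym 0) ?oner_eq0// => i _.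
  have := F0 i; rewrite le_eqVlt => /orP[/eqP <-|Fi]; first by rewrite mulr0.
  by case: no; exists i.
exists i; apply/eqP; rewrite eq_le M1 andbT.
have rest : 0 <= \sum_(j | j != i) de 0 j * r j * F j.
  by apply: sumr_ge0 => j _; rewrite mulr_ge0 // (le_trans ler01).
have Fi1 := ge1 _ (Fint i) Fi; have Mi := M1 i.
move: Fsum; rewrite (bigD1 i) //=; move: (de 0 i * r i) (\sum_(j | _) _) Mi rest => M S *.
by nra.
Qed.

(** * Identification with the affine Weyl group of the directions *)

Section WeylGroup.
Variable i0 : 'I_d.+1.
Hypothesis i0_unit : de 0 i0 * r i0 = 1.
Local Notation e := ((de 0 i0)^-1 *: a_ i0).
Local Notation phi := (affine_action m s P e).
Local Notation F := (affine_value P e).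

(** The coordinate along [A_ i0]. Using it as base form places the origin at the vertex opposite the
    wall [i0]. *)
Let E v := v 0 i0 * r i0.
Let e_E v : dot e v = E v.
Proof.
rewrite dotZl dotE (bigD1 i0) //= simple_rootE eqxx mul1r big1 => [|j ji].
  have -> : (de 0 i0)^-1 = r i0.
    by rewrite -[LHS]mulr1 -i0_unit mulrA mulVf ?mul1r// gt_eqF.
  by rewrite addr0 mulrC.
by rewrite simple_rootE (negbTE ji) mul0r.
Qed.
Let E_de : E de = 1. Proof. exact: i0_unit. Qed.
Let ede : dot e de = 1. Proof. by rewrite e_E. Qed.

Definition weyl_roots : set 'rV[R]_d := [set b *m P | b in Phia].
Definition weyl_simple : 'M[R]_d := \matrix_j (A_ (lift i0 j) *m P).
(** As [de] has coordinate 1 along [A_ i0], the vector [de - A_ i0] involves only the other simple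
    roots; this is its direction. *)
Definition weyl_highest : 'rV[R]_d := - (A_ i0 *m P).
Local Notation Psi := weyl_roots.

(** The origin is special: the integer [E b] can be removed by shifting along [de], so every
    direction has a hyperplane through the origin. *)
Let lift_root b : Phia b -> exists c, [/\ Phia c, c *m P = b *m P & E c = 0].
Proof.
move=> Pb; have /intrP[k kE] := affine_root_lattice Pb i0.
exists (b + (- k)%:~R *: de); split; first exact: affine_root_translate.
  by rewrite mulmxDl -(scalemxAl (- k)%:~R) deP scaler0 addr0.
by rewrite /E !mxE mulrDl kE -mulrA i0_unit mulrNz; ring.
Qed.

Let affine_root_sign b : Phia b -> nonneg b \/ nonneg (- b).
Proof.
move=> [x [i bE]]; have ri : 0 <= (r i)^-1 by rewrite invr_ge0 ltW.
case: (act_simple_sign R coxWS x i) => h; [left|right] => j; have := h j;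
  rewrite bE !mxE => h'; rewrite -?mulrN mulr_ge0 //.
Qed.

Let expand_zero v : v 0 i0 = 0 ->
  v *m P = (\row_j (v 0 (lift i0 j) * r (lift i0 j))) *m weyl_simple.
Proof.
move=> v0; rewrite {1}(row_sum_simple v) mulmx_suml (bigD1_ord i0) //= v0 scale0r mul0mx add0r.
rewrite mulmx_sum_row; apply: eq_bigr => j _.
by rewrite rowK mxE -!scalemxAl scalerA -mulrA divff // mulr1.
Qed.

Let weyl_simple_inj (v : 'rV[R]_d) : v *m weyl_simple = 0 -> v = 0.
Proof.
move=> v0; pose u : 'rV[R]_d.+1 := \sum_j (v 0 j / r (lift i0 j)) *: a_ (lift i0 j).
have u_i0 : u 0 i0 = 0.
  rewrite summxE big1 // => j _; rewrite mxE simple_rootE.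
  by rewrite (negbTE (neq_lift i0 j)) mulr0.
have u_j (j : 'I_d) : u 0 (lift i0 j) = v 0 j / r (lift i0 j).
  rewrite summxE (bigD1 j) //= mxE simple_rootE eqxx mulr1 big1 ?addr0// => k kj.
  by rewrite mxE simple_rootE (inj_eq lift_inj) eq_sym (negbTE kj) mulr0.
have [t uE] : exists t : R, u = t *: de.
  apply: Pker; rewrite expand_zero // -[RHS]v0; congr (_ *m _).
  by apply/rowP => j; rewrite mxE u_j divfK.
have t0 : t = 0.
  have := congr1 (fun w : 'rV[R]_d.+1 => w 0 i0) uE; rewrite u_i0 mxE => /esym/eqP.
  by rewrite mulf_eq0 (gt_eqF (de_gt0 i0)) orbF => /eqP.
apply/rowP => j; have := u_j j; rewrite uE t0 scale0r !mxE => /esym/eqP.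
by rewrite mulf_eq0 invr_eq0 (negbTE (r_neq0 _)) orbF => /eqP.
Qed.

Let weyl_simple_unit : weyl_simple \in unitmx.
Proof. by rewrite -row_free_unit; exact: inj_row_free weyl_simple_inj. Qed.

Let weyl_simple_root (j : 'I_d) : Psi (row j weyl_simple).
Proof. by exists (A_ (lift i0 j)); [exact: affine_root_simple | rewrite rowK]. Qed.

Let norm_root x i : dot (((r i)^-1 *: act x (a_ i)) *m P) (((r i)^-1 *: act x (a_ i)) *m P) =
  (r i)^-1 ^+ 2.
Proof. by rewrite -BE bformZl bformZr unit_root mulr1. Qed.

Let coroot_root x i : coroot (((r i)^-1 *: act x (a_ i)) *m P) =
  (2 * r i) *: (act x (a_ i) *m P).
Proof.
rewrite /coroot norm_root -scalemxAl scalerA; congr (_ *: _).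
by field; rewrite r_neq0.
Qed.

Let refl0_root x i v : affine_refl (((r i)^-1 *: act x (a_ i)) *m P) 0 (v *m P) =
  reflection m (act x (a_ i)) v *m P.
Proof.
rewrite /affine_refl coroot_root -BE subr0 scalerA /reflection mulmxBl -scalemxAl.
by rewrite bformZr; congr (_ - _ *: _); field.
Qed.

Lemma weyl_root_system : root_system Psi.
Proof.
split.
- split.
    have finD := finite_directions coxWS BE deP Pker Pinv de_gt0 de_sum.
    have finDI := finite_setX (@finite_finset _ (setT : set 'I_d.+1)) finD.
    apply: sub_finite_set (finite_image (fun ia => (r ia.1)^-1 *: ia.2) finDI).
    move=> _ [b [x [i ->]] <-]; exists (i, act x (a_ i) *m P); last by rewrite -scalemxAl.
    by split=> //=; exists (act x (a_ i)) => //; exists x, i.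
  move=> [b [x [i ->]] b0]; have := norm_root x i; rewrite b0 dot0l => /esym/eqP.
  by rewrite expf_eq0 invr_eq0 (negbTE (r_neq0 i)).
- by exists weyl_simple.
- by move=> _ t [b Pb <-] [c Pc E']; exact: affine_root_proportional Pb Pc (esym E').
- move=> _ _ [b [x [i ->]] <-] [c Pc <-]; rewrite refl0_root.
  have [z zE] : exists z, forall v, act z v = reflection m (act x (a_ i)) v.
    by apply: root_reflection => //; exists x, i.
  by rewrite -zE; exists (act z c) => //; exact: affine_root_act.
- move=> _ _ [b [x [i ->]] <-] [c Pc <-]; rewrite coroot_root dotZr -BE.
  exact: affine_root_int.
Qed.

(** Connectedness puts all simple directions on the same side of an orthogonal splitting, and a root
    on the other side would be orthogonal to them all. *)
Lemma weyl_irreducible : irreducible_root_system Psi.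
Proof.
split; first by exists (A_ i0 *m P), (A_ i0) => //; exact: affine_root_simple.
move=> A AP A0 A'0; apply: contrapT => no.
have orth (a b : 'rV[R]_d) : A a -> (Psi `\` A) b -> dot a b = 0.
  by move=> Aa Ab; apply/eqP/negP => /negP ab; apply: no; exists a, b.
have simple i : Psi (A_ i *m P) by exists (A_ i) => //; exact: affine_root_simple.
have Ball (b : 'rV[R]_d) : Psi b -> (forall i, dot (A_ i *m P) b = 0) -> False.
  move=> [c [x [k ->]] <-] h; have := norm_root x k.
  rewrite -BE [X in B X _]row_sum_simple bform_suml big1 => [/esym/eqP|i _].
    by rewrite expf_eq0 invr_eq0 (negbTE (r_neq0 k)).
  have := h i; rewrite -BE !bformZl bformZr => /eqP.
  by rewrite mulf_eq0 invr_eq0 (negbTE (r_neq0 i)) /= => /eqP ->; rewrite mulr0.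
have edge i j : coxeter_edge m i j -> A (A_ i *m P) -> A (A_ j *m P).
  move=> ij Ai; apply: contrapT => nAj; have := orth _ _ Ai (conj (simple j) nAj).
  rewrite -BE bformZl bformZr bform_simple => /eqP.
  by rewrite !mulf_eq0 !invr_eq0 !(negbTE (r_neq0 _)) /= lt_eqF // gram_edge.
have conn i j : A (A_ i *m P) -> A (A_ j *m P).
  have /connectP[w pth ->] : connect (coxeter_edge m) i j by case: irr.
  elim: w i pth => //= k w IH i /andP[ik pth] /(edge _ _ ik); exact: IH.
have [Ai|nAi] := pselect (A (A_ i0 *m P)).
  have [b [Pb nAb]] := A'0; apply: (Ball b Pb) => i; apply: orth; last by split.
  exact: conn Ai.
have [a Aa] := A0; apply: (Ball a (AP _ Aa)) => i; rewrite dotC; apply: orth => //.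
by split=> // Ai; apply/nAi/(conn i).
Qed.

Let coord_ge0 c j : nonneg c -> 0 <= c 0 j * r j.
Proof. by move=> c0; rewrite mulr_ge0 // ltW. Qed.

Lemma weyl_simple_system : simple_system Psi weyl_simple.
Proof.
split=> // _ [b Pb <-]; have [c [Pc <- /eqP]] := lift_root Pb.
rewrite mulf_eq0 (negbTE (r_neq0 i0)) orbF => /eqP c0.
exists (\row_j (c 0 (lift i0 j) * r (lift i0 j))); first exact: expand_zero.
case: (affine_root_sign Pc) => h; [left|right] => j; rewrite mxE.
  exact: coord_ge0.
by rewrite -oppr_ge0 -mulNr; have := coord_ge0 (lift i0 j) h; rewrite mxE.
Qed.

(** For a root [c] with [E c = 0], the root [de - c] has a positive coordinate at [i0], hence is
    nonnegative. Removing [A_ i0] leaves nonnegative coordinates on the remaining simple roots. *)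
Lemma weyl_highest_root : highest_root Psi weyl_simple weyl_highest.
Proof.
split.
  exists (- A_ i0); last by rewrite mulNmx.
  by apply: affine_rootN; exact: affine_root_simple.
move=> _ [b Pb <-]; have [c [Pc <- Ec]] := lift_root Pb.
have Pd : Phia (de - c).
  by rewrite addrC -[de]scale1r; apply: (affine_root_translate 1); exact: affine_rootN.
have c0 : c 0 i0 = 0.
  by move/eqP: Ec; rewrite mulf_eq0 (negbTE (r_neq0 i0)) orbF => /eqP.
have dc0 : nonneg (de - c).
  case: (affine_root_sign Pd) => // /(_ i0); rewrite !mxE c0.
  by have := de_gt0 i0; lra.
pose v := de - c - A_ i0.
have v0 : v 0 i0 = 0.
  rewrite !mxE c0 !eqxx mulr1 subr0; apply/eqP; rewrite subr_eq0; apply/eqP.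
  by apply: (mulIf (r_neq0 i0)); rewrite i0_unit mulVf.
exists (\row_j (v 0 (lift i0 j) * r (lift i0 j))).
  by rewrite -expand_zero // /v !mulmxBl deP sub0r addrC.
move=> j; rewrite mxE; have := coord_ge0 (lift i0 j) dc0.
have lj : (lift i0 j == i0) = false by rewrite eq_sym (negbTE (neq_lift _ _)).
by rewrite /v !mxE lj andbF mulr0 subr0.
Qed.

Let phi_reflection t x i (k : int) : (forall v, act t v = reflection m (act x (a_ i)) v) ->
  E ((r i)^-1 *: act x (a_ i)) = - k%:~R ->
  phi t = affine_refl (((r i)^-1 *: act x (a_ i)) *m P) k.
Proof.
set b := act x (a_ i) => tb bk; apply/funext => p.
rewrite (affine_action_reflection coxWS BE Pinv e _ tb) ?unit_root//.
rewrite /affine_refl coroot_root -/b -scalemxAl dotZr scalerA; congr (_ - _ *: _).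
have -> : k%:~R = - E ((r i)^-1 *: b) by rewrite bk opprK.
by rewrite /affine_value e_E /E mxE; field; rewrite r_neq0.
Qed.

Let phi_refl_exists (a : 'rV[R]_d) (k : int) : Psi a -> exists t, phi t = affine_refl a k.
Proof.
move=> [b Pb <-]; have [c [Pc <- Ec]] := lift_root Pb.
have [x [i cE]] := affine_root_translate (- k) Pc.
have [|t tb] := @root_reflection R _ m _ _ coxWS (act x (a_ i)); first by exists x, i.
exists t; rewrite (@phi_reflection t x i k) // -cE.
  congr (affine_refl _ _).
  by rewrite mulmxDl -(scalemxAl (- k)%:~R) deP scaler0 addr0.
by rewrite /E !mxE mulrDl -mulrA i0_unit mulr1 mulrNz -/(E c) Ec add0r.
Qed.

Let phi_simple i : phi (s i) = affine_refl (A_ i *m P) (if i == i0 then -1 else 0).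
Proof.
have := @phi_reflection (s i) 1%g i (if i == i0 then -1 else 0); rewrite act1 //.
apply=> [v|]; first by rewrite act_simple // simple_reflE.
rewrite /E !mxE eqxx /= eq_sym; case: eqP => [->|_].
  by rewrite mulr1 mulVf // mulrNz opprK.
by rewrite mulr0 mul0r oppr0.
Qed.

Let phiM x y : phi (x * y)%g = phi x \o phi y.
Proof. by apply/funext => p; exact: affine_actionM. Qed.

Let phi1 : phi 1%g = id.
Proof. by apply/funext => p; exact: affine_action1. Qed.

Let phi_inj : injective phi.
Proof.
move=> x y xy; apply: invg_inj; apply: (act_faithful coxWS (R := R)) => i.
have val u : (forall p, F p u = 0) -> u = 0.
  move=> u0; have [|t tE] := Pker (u := u).
    apply: dot_eq0; have := u0 (u *m P); have := u0 0.
    by rewrite /affine_value dot0l addr0 => ->; rewrite add0r.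
  have := u0 0; rewrite tE affine_valueZ affine_value_de // mulr1 => ->.
  by rewrite scale0r.
apply/eqP; rewrite -subr_eq0; apply/eqP/val => p.
by rewrite affine_valueD affine_valueN -!affine_actionE // xy subrr.
Qed.

Let weyl_group_comp (f g : 'rV[R]_d -> 'rV[R]_d) : affine_weyl_group Psi f -> affine_weyl_group Psi g ->
  affine_weyl_group Psi (f \o g).
Proof.
by move=> + Gg; elim=> // a k h Pa _ IH; apply: (affine_weyl_refl k Pa IH).
Qed.

Let phi_range : range phi = affine_weyl_group Psi.
Proof.
apply/seteqP; split=> [_ [x _ <-]|f].
  have [w <-] := word_prod_surj coxWS x; elim: w => [|i w IH].
    by rewrite word_prod_nil phi1; exact: affine_weyl_id.
  rewrite word_prod_cons phiM phi_simple; apply: weyl_group_comp => //.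
  have Pi : Psi (A_ i *m P) by exists (A_ i) => //; exact: affine_root_simple.
  exact: (affine_weyl_refl (if i == i0 then -1 else 0) Pi (affine_weyl_id _)).
elim=> [|a k g Pa _ [x _ <-]]; first by exists 1%g.
have [t tE] := phi_refl_exists k Pa.
by exists (t * x)%g => //; rewrite phiM tE.
Qed.

Let phi_simple_refls :
  [set phi (s i) | i in [set: 'I_d.+1]] = affine_simple_refls weyl_simple weyl_highest.
Proof.
have reflN (a : 'rV[R]_d) : affine_refl a (-1) = affine_refl (- a) 1.
  apply/funext => p; rewrite /affine_refl /coroot !(dotNl, dotNr) !opprK.
  have -> : 1%:~R = 1 :> R by [].
  by apply/rowP => j; rewrite !mxE; ring.
have phi0 : phi (s i0) = affine_refl weyl_highest 1 by rewrite phi_simple eqxx reflN.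
have phij (j : 'I_d) : phi (s (lift i0 j)) = affine_refl (row j weyl_simple) 0.
  by rewrite phi_simple eq_sym (negbTE (neq_lift _ _)) rowK.
apply/seteqP; split=> [_ [i _ <-]|_ [[j _ <-]|->]].
- case: (unliftP i0 i) => [j ->|->]; last by right.
  by left; exists j.
- by exists (lift i0 j).
- by exists i0.
Qed.

Lemma affine_coxeter_weyl : affine_coxeter R s.
Proof.
exists d, Psi, weyl_simple, weyl_highest, phi; split => //.
- by split; [exact: weyl_root_system | exact: weyl_irreducible].
- by split; [exact: weyl_simple_system | exact: weyl_highest_root].
Qed.

End WeylGroup.
End AffineLattice.

Lemma semidefinite_affine (R : realType) (d : nat) (m : 'M[nat]_d.+1) (W : groupType)
    (s : 'I_d.+1 -> W) (de : 'rV[R]_d.+1) (P : 'M[R]_(d.+1, d)) :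
  coxeter_system m s -> irreducible_coxeter m -> infinite_set [set: W] ->
  (forall u, bform m de u = 0) ->
  (forall u v, bform m u v = dot (u *m P) (v *m P)) -> de *m P = 0 ->
  (forall u, u *m P = 0 -> exists t : R, u = t *: de) ->
  (exists C : 'M[R]_(d, d.+1), C *m P = 1%:M) ->
  (forall i, 0 < de 0 i) -> \sum_i de 0 i = 1 -> affine_coxeter R s.
Proof.
move=> cox irr infW derad BE deP Pker Pinv de0 de1.
have [r [r0 rP]] := root_steps cox derad BE deP Pker Pinv de0 de1 infW irr.
have [i0 i0E] := step_unit cox derad BE deP Pker Pinv de0 de1 irr r0 rP.
by apply: (affine_coxeter_weyl cox derad BE deP Pker Pinv de0 de1 irr r0 rP); exact: i0E.
Qed.

(** * Affine Weyl groups *)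

Section RootSystem.
Context (R : realType) (d : nat) (Psi : set 'rV[R]_d) (Delta : 'M[R]_d)
  (theta : 'rV[R]_d).
Implicit Types (a b c p q v y : 'rV[R]_d) (k l : int) (F : 'rV[R]_d -> 'rV[R]_d).

Hypothesis rootPsi : root_system Psi.
Hypothesis simplePsi : simple_system Psi Delta.
Hypothesis highestPsi : highest_root Psi Delta theta.

Let Psi_neq0 a : Psi a -> dot a a != 0.
Proof.
by case: rootPsi => -[_ n0] _ _ _ _ Pa; apply/eqP => /dot_eq0 a0; rewrite a0 in Pa.
Qed.

Lemma root_systemN a : Psi a -> Psi (- a).
Proof.
move=> Pa; have n0 := Psi_neq0 Pa; have [_ _ _ h _] := rootPsi.
have := h a a Pa Pa; rewrite /affine_refl subr0 /coroot scalerA mulrCA divff // mulr1.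
by congr (Psi _); apply/rowP => j; rewrite !mxE; ring.
Qed.

Let Delta_unit : Delta \in unitmx. Proof. by case: simplePsi. Qed.
Let co a := a *m invmx Delta.
Let h := co theta.
Let pt y := y *m (invmx Delta)^T.

Let coK a : co a *m Delta = a. Proof. exact: mulmxKV. Qed.
Let co_mul c : co (c *m Delta) = c. Proof. exact: mulmxK. Qed.
Let coN a : co (- a) = - co a. Proof. exact: mulNmx. Qed.

Let dot_pt y a : dot (pt y) a = dot y (co a).
Proof. by rewrite /dot /pt /co trmx_mul -!mulmxA. Qed.

Let co_row (j : 'I_d) : co (row j Delta) = delta_mx 0 j.
Proof. by rewrite /co -row_mul mulmxV // row1. Qed.

Let co_sign a : Psi a -> nonneg (co a) \/ nonneg (- co a).
Proof.
case: simplePsi => _ _ sg /sg[c -> [] h']; rewrite co_mul; [left|right] => j //.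
by rewrite mxE oppr_ge0.
Qed.

Let co_le a : Psi a -> nonneg (h - co a).
Proof.
case: highestPsi => _ hi /hi[c tE c0]; have -> : h - co a = c; last exact: c0.
by rewrite /h /co -mulmxBl tE; exact: co_mul.
Qed.

Let h_ge1 (j : 'I_d) : 1 <= h 0 j.
Proof.
have [_ sr _] := simplePsi; have := co_le (sr j) j.
have subE (u v : 'rV[R]_d) : (u - v) 0 j = u 0 j - v 0 j by rewrite !mxE.
by rewrite subE co_row [delta_mx _ _ _ _]mxE !eqxx subr_ge0.
Qed.

Let dot_nonneg u v : nonneg u -> nonneg v -> 0 <= dot u v.
Proof. by move=> u0 v0; rewrite dotE; apply: sumr_ge0 => j _; exact: mulr_ge0. Qed.

Definition alcove p := (forall j, 0 < dot p (row j Delta)) /\ dot p theta < 1.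
(* The closed alcove, in the coordinates dual to the simple roots. *)
Let cl y := nonneg y /\ dot y h <= 1.

Lemma alcove_exists : exists p, alcove p.
Proof.
pose S := \sum_j h 0 j.
have S0 : 0 <= S by apply: sumr_ge0 => j _; exact: le_trans (h_ge1 j).
exists (pt (const_mx (1 + S)^-1)); split=> [j|].
  rewrite dot_pt co_row dotE (bigD1 j) //= !mxE !eqxx mulr1 big1 => [|i ij].
    by rewrite addr0 invr_gt0; lra.
  by rewrite !mxE (negbTE ij) mulr0.
rewrite dot_pt -/h dotE; under eq_bigr do rewrite mxE.
by rewrite -mulr_sumr -/S mulrC ltr_pdivrMr; lra.
Qed.

Let alcove_pt p : alcove p -> exists y, [/\ p = pt y, forall j, 0 < y 0 j & dot y h < 1].
Proof.
move=> [p0 p1]; exists (p *m Delta^T); have pE : p = pt (p *m Delta^T).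
  by rewrite /pt -mulmxA -trmx_mul mulVmx // trmx1 mulmx1.
set y := p *m _ in pE *; clearbody y; split=> //; last by rewrite -dot_pt -pE.
move=> j; have := p0 j; rewrite {1}pE dot_pt co_row dotE (bigD1 j) //= !mxE !eqxx mulr1.
by rewrite big1 ?addr0// => i ij; rewrite !mxE (negbTE ij) mulr0.
Qed.

(** On the alcove a positive root takes values strictly between 0 and 1, being bounded by the
    highest root. *)
Lemma alcove_neq0 p a k : alcove p -> Psi a -> dot p a - k%:~R != 0.
Proof.
move=> pA; have [y [-> y0 y1]] := alcove_pt pA.
have pos_neq0 b l : Psi b -> nonneg (co b) -> dot (pt y) b - l%:~R != 0.
  move=> Pb b0; rewrite dot_pt; have y0' : nonneg y by move=> j; exact: ltW.
  have d0 := dot_nonneg y0' b0; have := dot_nonneg y0' (co_le Pb).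
  rewrite dotDr dotNr => dh; apply/eqP => E.
  have l0 : l = 0.
    have : 0%:~R <= l%:~R :> R by lra.
    have : l%:~R < 1%:~R :> R by lra.
    by rewrite ltr_int ler_int; lia.
  have : dot y (co b) = 0 by move: E; rewrite l0 subr0.
  rewrite dotE => /eqP; rewrite psumr_eq0 => [/allP cb|j _]; last by rewrite mulr_ge0.
  have : co b = 0.
    apply/rowP => j; have := cb j (mem_index_enum _).
    by rewrite /= mulf_eq0 (gt_eqF (y0 j)) [in RHS]mxE => /eqP.
  move=> b00; have := Psi_neq0 Pb.
  by rewrite -(coK b) b00 mul0mx dot0l eqxx.
move=> Pa; case: (co_sign Pa) => ca; first exact: pos_neq0.
have := pos_neq0 (- a) (- k) (root_systemN Pa); rewrite coN => /(_ ca).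
by rewrite dotNr mulrNz -opprD oppr_eq0.
Qed.

Let closure_sign p y a k : alcove p -> cl y -> Psi a -> 0 < dot p a - k%:~R ->
  0 <= dot (pt y) a - k%:~R.
Proof.
move=> /alcove_pt[z [-> z0 z1]] [y0 y1] Pa; rewrite !dot_pt.
have z0' : nonneg z by move=> j; exact: ltW.
case: (co_sign Pa) => ca.
  have := dot_nonneg y0 ca; have := dot_nonneg z0' (co_le Pa); rewrite dotDr dotNr => zh ya za.
  have : k%:~R < 1%:~R :> R by lra.
  rewrite ltr_int => k1; have : k%:~R <= 0%:~R :> R by rewrite ler_int; lia.
  lra.
have := dot_nonneg z0' ca; have := dot_nonneg y0 (co_le (root_systemN Pa)).
rewrite coN !(dotDr, dotNr) => yh zca za.
have : k%:~R <= -1 :> R.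
  have : k%:~R < 0%:~R :> R by lra.
  rewrite ltr_int => k1; have : k%:~R <= (-1)%:~R :> R by rewrite ler_int; lia.
  by [].
lra.
Qed.

Definition affine_root_fun a k v := dot v a - k%:~R.
Local Notation f := affine_root_fun.

Lemma affine_root_funN a k v : f (- a) (- k) v = - f a k v.
Proof. by rewrite /f dotNr mulrNz opprD. Qed.

Lemma affine_reflN a k : affine_refl (- a) (- k) = affine_refl a k.
Proof.
apply/funext => v; rewrite /affine_refl /coroot !(dotNl, dotNr) !opprK mulrNz.
by apply/rowP => i; rewrite !mxE; ring.
Qed.

(** Pulling an affine function back through a reflection shifts its level by [l] times a Cartan
    integer, so the level stays integral. *)
Let refl_conj c l a k : Psi c -> Psi a ->
  exists b k', [/\ Psi b, forall v, f a k (affine_refl c l v) = f b k' v &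
    forall v, affine_refl a k (affine_refl c l v) = affine_refl c l (affine_refl b k' v)].
Proof.
move=> Pc Pa; have [_ _ _ refl crys] := rootPsi.
have /intrP[t] := crys c a Pc Pa; have Nc := Psi_neq0 Pc; have Na := Psi_neq0 Pa.
rewrite /coroot dotZr => tE; set b := affine_refl c 0 a.
have bc : dot b c = - dot a c.
  by rewrite /b /affine_refl /coroot subr0 !(dotDl, dotNl, dotZl); field.
have bb : dot b b = dot a a.
  rewrite /b /affine_refl /coroot subr0 !(dotDl, dotNl, dotZl, dotDr, dotNr, dotZr) (dotC c a).
  by field.
have fE u : f a k (affine_refl c l u) = f b (k - l * t) u.
  rewrite /b /f /affine_refl !(dotDl, dotNl, dotZl, dotDr, dotNr, dotZr) subr0.
  rewrite intrB intrM -tE (dotC c a); ring.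
exists b, (k - l * t); split=> [||u]; [exact: refl | exact: fE |].
rewrite {1}/affine_refl -/(f a k _) fE [affine_refl b _ _]/affine_refl -/(f b _ _).
set g := f b _ _; clearbody g.
have bE : b = a - (2 / dot c c * dot a c) *: c.
  by rewrite /b /affine_refl /coroot subr0 scalerA mulrC.
clearbody b; rewrite /affine_refl /coroot bb !(dotDl, dotNl, dotZl) bc bE.
by apply/rowP => i; rewrite !mxE; field; rewrite Nc Na.
Qed.

Lemma affine_weyl_conj F a k : affine_weyl_group Psi F -> Psi a ->
  exists b l, [/\ Psi b, forall v, f a k (F v) = f b l v &
    forall v, affine_refl a k (F v) = F (affine_refl b l v)].
Proof.
move=> WF; elim: WF a k => [|c l G Pc _ IH] a k Pa; first by exists a, k.
have [b [k' [Pb fE cE]]] := @refl_conj c l a k Pc Pa.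
have [b' [k'' [Pb' fE' cE']]] := IH b k' Pb; exists b', k''; split=> // v /=.
  by rewrite fE fE'.
by rewrite cE cE'.
Qed.

(** The function is nonnegative at [pt y] by closure. Pulled back by [F] it is negative on the
    alcove, hence nonpositive at [pt y], which [F] fixes. *)
Let sign_same F y a k p : alcove p -> affine_weyl_group Psi F -> cl y -> F (pt y) = pt y ->
  Psi a -> 0 < f a k p -> f a k (F p) < 0 -> f a k (pt y) = 0.
Proof.
move=> pA WF ycl Fy Pa a0 aF.
have := closure_sign pA ycl Pa a0; rewrite -/(f a k _) => y0.
have [b [l [Pb fE _]]] := affine_weyl_conj k WF Pa.
have := closure_sign pA ycl (root_systemN Pb) (k := - l).
rewrite -/(f _ _ _) -/(f _ _ (pt y)) !affine_root_funN -!fE Fy oppr_gt0 oppr_ge0 => /(_ aF) y0'.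
by apply/eqP; rewrite eq_le y0'.
Qed.

Lemma simple_refl_weyl F : affine_simple_refls Delta theta F ->
  exists a k, [/\ Psi a, F = affine_refl a k & forall p, alcove p -> 0 < f a k p].
Proof.
have [_ sr _] := simplePsi; have [Pt _] := highestPsi.
case=> [[j _ <-]|->]; last first.
  exists (- theta), (-1); split=> [||p [_ p1]]; first exact: root_systemN.
    apply/funext => v; rewrite /affine_refl /coroot !(dotNl, dotNr) !opprK.
    by apply/rowP => i; rewrite !mxE; ring.
  by rewrite /f dotNr; lra.
exists (row j Delta), 0; split=> // p [p0 _]; by rewrite /f subr0.
Qed.

Let refl_eq a t : Psi a -> Psi (t *: a) -> affine_refl (t *: a) 0 = affine_refl a 0.
Proof.
case: rootPsi => _ _ red _ _ Pa /(red _ _ Pa)[->|->]; first by rewrite scale1r.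
apply/funext => v; rewrite scaleN1r /affine_refl /coroot !(dotNl, dotNr) !opprK.
by apply/rowP => i; rewrite !mxE; ring.
Qed.

(** By [sign_same] a separating hyperplane contains the whole face of the closed alcove fixed by
    [F]. Evaluating at the vertices of that face makes [a] proportional to the root of the wall, and
    reducedness leaves only a sign. *)
Lemma wall_separation F a k p : alcove p -> affine_simple_refls Delta theta F ->
  Psi a -> 0 < f a k p -> f a k (F p) < 0 -> affine_refl a k = F.
Proof.
move=> pA WF Pa a0 aF.
have WF' : affine_weyl_group Psi F.
  have [b [l [Pb -> _]]] := simple_refl_weyl WF.
  exact: (affine_weyl_refl l Pb (affine_weyl_id _)).
have zero y : cl y -> F (pt y) = pt y -> dot y (co a) = k%:~R.
  move=> ycl Fy; have := sign_same pA WF' ycl Fy Pa a0 aF.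
  by rewrite /f dot_pt => /subr0_eq.
have [_ sr _] := simplePsi; have [Pt _] := highestPsi.
(* The vertices of the closed alcove other than the origin. *)
pose e (l : 'I_d) : 'rV[R]_d := (h 0 l)^-1 *: simple_root R l.
have h_gt0 (l : 'I_d) : 0 < h 0 l by apply: lt_le_trans (h_ge1 l).
have dot_e (l : 'I_d) (u : 'rV[R]_d) : dot (e l) u = u 0 l / h 0 l.
  rewrite dotZl dotE (bigD1 l) //= big1 => [|i il].
    by rewrite simple_rootE eqxx mul1r addr0 mulrC.
  by rewrite simple_rootE (negbTE il) mul0r.
have e_cl (l : 'I_d) : cl (e l).
  split; last by rewrite dot_e divff // gt_eqF.
  by apply: nonnegZ; [rewrite invr_ge0 ltW | exact: simple_root_nonneg].
case: WF {WF'} zero => [[j _ <-]|->] zero; last first.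
  have ca (l : 'I_d) : co a 0 l = k%:~R * h 0 l.
    have := zero (e l) (e_cl l); rewrite /affine_refl dot_pt -/h !dot_e divff ?gt_eqF//.
    rewrite subrr scale0r subr0 => /(_ erefl) <-.
    by rewrite divfK // gt_eqF.
  have aE : a = k%:~R *: theta.
    rewrite -(coK a) -(coK theta) -/h scalemxAl; congr (_ *m _).
    by apply/rowP => l; rewrite ca [RHS]mxE.
  rewrite aE; have := Pa; rewrite aE; case: rootPsi => _ _ red _ _ /(red _ _ Pt)[] kE.
    by rewrite kE scale1r (_ : k = 1) //; exact: (@intr_inj R).
  have -> : k = -1 by apply: (@intr_inj R).
  apply/funext => v; rewrite scaleN1r /affine_refl /coroot !(dotNl, dotNr) !opprK.
  by apply/rowP => i; rewrite !mxE; ring.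
have fix_pt y : y 0 j = 0 -> affine_refl (row j Delta) 0 (pt y) = pt y.
  move=> yj; rewrite /affine_refl dot_pt co_row dotE (bigD1 j) //= yj mul0r big1 => [|i ij].
    by rewrite addr0 subrr scale0r subr0.
  by rewrite mxE (negbTE ij) mulr0.
have k0 : k = 0.
  apply: (@intr_inj R); rewrite -(zero 0) ?dot0l//.
    by split=> [i|]; rewrite ?mxE // dot0l ler01.
  by apply: fix_pt; rewrite mxE.
have ca (l : 'I_d) : l != j -> co a 0 l = 0.
  move=> lj; have := zero (e l) (e_cl l); rewrite fix_pt => [/(_ erefl)|]; last first.
    by rewrite [LHS]mxE simple_rootE eq_sym (negbTE lj) mulr0.
  by rewrite dot_e k0 => /eqP; rewrite mulf_eq0 invr_eq0 (gt_eqF (h_gt0 l)) orbF => /eqP.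
have aE : a = co a 0 j *: row j Delta.
  rewrite -{1}(coK a) rowE scalemxAl; congr (_ *m _).
  apply/rowP => l; rewrite [RHS]mxE -/(simple_root R j) simple_rootE.
  by have [->|lj] := eqVneq l j; rewrite ?mulr1 // ca // mulr0.
by rewrite k0 aE; apply: refl_eq => //; rewrite -aE.
Qed.

Lemma affine_weyl_comp F G : affine_weyl_group Psi F -> affine_weyl_group Psi G ->
  affine_weyl_group Psi (F \o G).
Proof.
by move=> + WG; elim=> // a k E Pa _ IH; apply: (affine_weyl_refl k Pa IH).
Qed.

Let coroot_translation a k : Psi a -> affine_weyl_group Psi (fun v => v + k%:~R *: coroot a).
Proof.
move=> Pa; have := affine_weyl_refl k Pa (affine_weyl_refl 0 Pa (affine_weyl_id Psi)).
congr (affine_weyl_group _ _); apply/funext => v /=; have N := Psi_neq0 Pa.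
rewrite /affine_refl /coroot !(dotDl, dotNl, dotZl) subr0.
by apply/rowP => i; rewrite !mxE; field.
Qed.

(* [la] is obtained by rounding the coordinates of a large multiple of [u] in the basis
   of simple coroots. *)
Lemma coroot_lattice_negative (A : set 'rV[R]_d) u : A `<=` Psi ->
  (forall a, A a -> dot u a < 0) ->
  exists la, affine_weyl_group Psi (fun v => v + la) /\ forall a, A a -> dot la a < 0.
Proof.
move=> AP uA; have [[finPsi _] _ _ _ _] := rootPsi; have [_ sr _] := simplePsi.
pose g (j : 'I_d) := coroot (row j Delta).
have [x uE] : exists x : 'rV[R]_d, u = \sum_j x 0 j *: g j.
  exists (\row_j ((u *m invmx Delta) 0 j * dot (row j Delta) (row j Delta) / 2)).
  rewrite -{1}[u](mulmxKV Delta_unit) mulmx_sum_row; apply: eq_bigr => j _.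
  rewrite [in RHS]mxE /g /coroot scalerA; congr (_ *: _).
  by have := Psi_neq0 (sr j) => N; field.
pose K a := \sum_j `|dot (g j) a|.
(* [K a] bounds the effect on [a] of rounding each coordinate by less than 1; [M] makes the value of
   [u] outweigh it on all of [A]. *)
have [M M0 KM] : exists2 M : R, 0 < M & forall a, A a -> K a < M * - dot u a.
  have finA : finite_set A by exact: sub_finite_set finPsi.
  have [A0|A0] := pselect (A !=set0); last first.
    by exists 1 => // a Aa; case: A0; exists a.
  have [b Ab bmin] := finite_set_argmin (fun a => - (K a / - dot u a)) finA A0.
  have K0 a : 0 <= K a by apply: sumr_ge0.
  exists (K b / - dot u b + 1).
    by rewrite ltr_wpDl // divr_ge0 // oppr_ge0 ltW // uA.
  move=> a Aa; rewrite -ltr_pdivrMr ?oppr_gt0 ?uA//.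
  by have := bmin a Aa; rewrite lerN2; lra.
pose la := \sum_j (Num.floor (M * x 0 j))%:~R *: g j.
exists la; split.
  rewrite /la; elim/big_ind: _ => [|v w Wv Ww|j _].
  - by under eq_fun do rewrite addr0; exact: affine_weyl_id.
  - have := affine_weyl_comp Ww Wv; congr (affine_weyl_group _ _).
    by apply/funext => z /=; rewrite addrA.
  - exact: coroot_translation.
move=> a Aa; have := KM a Aa; rewrite /K.
suff : dot la a - M * dot u a <= \sum_j `|dot (g j) a| by lra.
have dot_suml (y : 'I_d -> R) : dot (\sum_j y j *: g j) a = \sum_j y j * dot (g j) a.
  elim/big_rec2: _ => [|j t v _ <-]; first by rewrite dot0l.
  by rewrite dotDl dotZl.
rewrite uE !dot_suml mulr_sumr -sumrB; apply: ler_sum => j _.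
rewrite mulrA -mulrBl; apply: le_trans (ler_norm _) _; rewrite normrM ler_piMl //.
have /andP[f1 f2] := floor_itv (M * x 0 j); rewrite intrD in f2.
by rewrite ler_norml; apply/andP; split; lra.
Qed.
End RootSystem.

Lemma finite_powerset (T : choiceType) (A : set T) :
  finite_set A -> finite_set [set B | B `<=` A].
Proof.
move=> /finite_seqP[r ->].
apply: (@sub_finite_set _ _ ((fun t : (size r).-tuple bool => [set` mask t r]) @` setT)).
  move=> B Br; have rs : size (map (fun x => `[< B x >]) r) == size r by rewrite size_map.
  exists (Tuple rs) => //=; rewrite -filter_mask.
  apply/seteqP; split=> x /=; first by rewrite mem_filter => /andP[/asboolP].
  by move=> Bx; rewrite mem_filter; apply/andP; split; [exact/asboolP | exact: Br].
exact/finite_image/finite_finset.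
Qed.

(** * Inversion sets as sets of separating hyperplanes *)

Section AffineMaximal.
Context (R : realType) (n : nat) (m : 'M[nat]_n) (W : groupType) (s : 'I_n -> W).
Local Notation act := (@act R n m W s).
Local Notation a_ := (@simple_root R n).
Local Notation Phi := (@Defs.roots R n m W s).
Local Notation pos := (@positive_roots R n m W s).
Local Notation neg := (@negative_roots R n m W s).
Local Notation N := (@inv_set R n m W s).
Local Notation Nbar := (@inv_set_bar R n m W s).
Implicit Types (x z w : W) (i j : 'I_n).

Hypothesis coxWS : coxeter_system m s.
Hypothesis infW : infinite_set [set: W].
Variables (d : nat) (Psi : set 'rV[R]_d) (Delta : 'M[R]_d) (theta : 'rV[R]_d)
  (phi : W -> 'rV[R]_d -> 'rV[R]_d).
Hypothesis rootPsi : root_system Psi.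
Hypothesis simplePsi : simple_system Psi Delta.
Hypothesis highestPsi : highest_root Psi Delta theta.
Hypothesis phi_inj : injective phi.
Hypothesis phiM : forall x z, phi (x * z)%g = phi x \o phi z.
Hypothesis phi_range : range phi = affine_weyl_group Psi.
Hypothesis phi_simple :
  [set phi (s i) | i in [set: 'I_n]] = affine_simple_refls Delta theta.
Local Notation f := affine_root_fun.

Let phi_weyl x : affine_weyl_group Psi (phi x).
Proof. by rewrite -phi_range; exists x. Qed.

Let phi1 : phi 1%g = id.
Proof.
have [e _ eE] : range phi id by rewrite phi_range; exact: affine_weyl_id.
suff <- : e = 1%g by [].
by apply: (mulgI e); rewrite mulg1; apply: phi_inj; rewrite phiM eE.
Qed.

Let phi_simple_wall i : affine_simple_refls Delta theta (phi (s i)).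
Proof. by rewrite -phi_simple; exists i. Qed.

Let walls : exists ak : 'I_n -> 'rV[R]_d * int, forall i,
  [/\ Psi (ak i).1, phi (s i) = affine_refl (ak i).1 (ak i).2 &
      forall p, alcove Delta theta p -> 0 < f (ak i).1 (ak i).2 p].
Proof.
have /choice[ak akP] : forall i, exists ak : 'rV[R]_d * int,
  [/\ Psi ak.1, phi (s i) = affine_refl ak.1 ak.2 &
      forall p, alcove Delta theta p -> 0 < f ak.1 ak.2 p]; last by exists ak.
move=> i; have [a [k ?]] := simple_refl_weyl rootPsi simplePsi highestPsi (phi_simple_wall i).
by exists (a, k).
Qed.

Let root_neg_simple x i j : act x (a_ i) = - a_ j \/ act x (a_ i) = a_ j ->
  (x * s i = s j * x)%g.
Proof.
move=> E; apply: (mulIg x^-1%g); rewrite mulgK.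
apply: (act_faithful coxWS (R := R)) => k.
rewrite !actM // !act_simple // !simple_reflE.
have -> : act x (reflection m (a_ i) (act x^-1 (a_ k))) = reflection m (act x (a_ i)) (a_ k).
  rewrite /reflection actD // actN // actZ // actVK //.
  by rewrite -(act_form coxWS x (act x^-1%g _)) actVK.
case: E => ->; rewrite // /reflection bformNr mulrN scaleNr scalerN opprK //.
Qed.

(** Append a letter [j] to a word of [y]. If [y] conjugates [s j] to [s i], the root changes sign
    and the alcove crosses wall [i]. Otherwise neither happens: [s j] permutes the positive roots
    other than [a_ j], and only wall [j] separates [p] from its image. *)
Let wall_sign p ak : alcove Delta theta p -> (forall i,
  [/\ Psi (ak i).1, phi (s i) = affine_refl (ak i).1 (ak i).2 &
      forall q, alcove Delta theta q -> 0 < f (ak i).1 (ak i).2 q]) ->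
  forall z i, (pos (act z^-1%g (a_ i)) -> 0 < f (ak i).1 (ak i).2 (phi z p)) /\
    (neg (act z^-1%g (a_ i)) -> f (ak i).1 (ak i).2 (phi z p) < 0).
Proof.
move=> pA akP z; have [w <-] := word_prod_surj coxWS z.
elim/last_ind: w => [|w j IH] i; have [Pi phiE pi] := akP i.
  rewrite word_prod_nil invg1 act1 // phi1; split=> [_|]; first exact: pi.
  by move/(positive_not_negative coxWS (positive_simple R coxWS i)).
rewrite word_prod_rcons; set y := word_prod s w in IH *.
have [IHp IHn] := IH i; have Pg : Phi (act y^-1%g (a_ i)) by exists y^-1%g, i.
set g := act y^-1%g (a_ i) in IHp IHn Pg.
rewrite invgM (simple_invg coxWS) actM // -/g phiM /=.
have [E|ne] := pselect (y^-1 * s i = s j * y^-1)%g.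
  have -> : act (s j) g = - g.
    by rewrite /g -actM // -E actM // act_simple_self // actN.
  have -> : phi y (phi (s j) p) = phi (s i) (phi y p).
    have E' : (y * s j = s i * y)%g by apply: (mulgI y^-1%g); rewrite mulKg mulgA E mulgVK.
    by have := congr1 (fun x => phi x p) E'; rewrite !phiM.
  have -> : f (ak i).1 (ak i).2 (phi (s i) (phi y p)) = - f (ak i).1 (ak i).2 (phi y p).
    rewrite phiE /f /affine_refl dotDl dotNl dotZl /coroot dotZl.
    have N0 : dot (ak i).1 (ak i).1 != 0.
      by apply/eqP => /dot_eq0 E0; case: rootPsi => -[_]; rewrite -E0.
    by field.
  rewrite oppr_gt0 oppr_lt0; split=> h; [apply: IHn | apply: IHp].
    exact/negative_rootsP.
  by rewrite -[g]opprK; apply/negative_rootsP.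
have [b [l [Pb fE cE]]] := affine_weyl_conj rootPsi (ak i).2 (phi_weyl y) Pi.
have not_refl : affine_refl b l <> phi (s j).
  move=> blE; apply: ne; have yE : (s i * y = y * s j)%g.
    by apply: phi_inj; rewrite !phiM phiE -blE; apply/funext => v /=; rewrite cE.
  by apply: (mulIg y); rewrite mulgVK -mulgA yE mulKg.
have not_simple : g <> a_ j /\ - g <> a_ j.
  split=> E; apply: ne; apply: root_neg_simple; [right|left] => //.
  by rewrite -E opprK.
rewrite !fE in IHp IHn *; have b0 := alcove_neq0 rootPsi simplePsi highestPsi l pA Pb.
have sep := wall_separation rootPsi simplePsi highestPsi pA (phi_simple_wall j).
have [[c k'] [Pc Fc _]] : exists ck : 'rV[R]_d * int,
    [/\ Psi ck.1, forall v, f b l (phi (s j) v) = f ck.1 ck.2 v & True].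
  have [c [k' [Pc Fc _]]] := affine_weyl_conj rootPsi l (phi_weyl (s j)) Pb.
  by exists (c, k').
have c0 := alcove_neq0 rootPsi simplePsi highestPsi k' pA Pc.
rewrite -/(f c k' p) -Fc /= in c0.
case: (root_sign coxWS Pg) => [pg|/negative_rootsP ng].
  have bp := IHp pg; have pg' := positive_simple_refl coxWS pg (proj1 not_simple).
  split=> [_|/(positive_not_negative coxWS pg')//].
  rewrite lt_neqAle eq_sym c0 /= leNgt; apply/negP => lt0.
  exact: not_refl (sep _ _ Pb bp lt0).
have bn := IHn (proj2 (negative_rootsP _ _ _) ng).
have ng' := positive_simple_refl coxWS ng (proj2 not_simple); rewrite actN // in ng'.
split=> [/(positive_not_negative coxWS)[]|_]; first exact/negative_rootsP.
rewrite lt_neqAle c0 /= leNgt; apply/negP => lt0; apply: not_refl.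
rewrite -affine_reflN; apply: sep; first exact: (root_systemN rootPsi).
  by rewrite affine_root_funN oppr_gt0.
by rewrite affine_root_funN oppr_lt0.
Qed.

(** Writing [b] as [act x (a_ i)], the hyperplane is wall [i] pulled back by [x^-1], and [wall_sign]
    is applied to [x^-1 * w]. *)
Let inv_set_affine p b : alcove Delta theta p -> pos b -> exists a k,
  [/\ Psi a, 0 < f a k p & forall w, N w b <-> f a k (phi w p) < 0].
Proof.
move=> pA pb; have [ak akP] := walls; have sgn := wall_sign pA akP.
have [[x [i bE]] _] := pb; have [Pi _ _] := akP i.
have [a [k [Pa fE _]]] := affine_weyl_conj rootPsi (ak i).2 (phi_weyl x^-1%g) Pi.
have fw w : f a k (phi w p) = f (ak i).1 (ak i).2 (phi (x^-1 * w)%g p).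
  by rewrite phiM /= fE.
have aw w : act (x^-1 * w)^-1%g (a_ i) = act w^-1%g b.
  by rewrite invgM invgK actM // bE.
exists a, k; split=> // [|w].
  have := fw 1%g; rewrite phi1 => ->; apply: (proj1 (sgn _ i)).
  by rewrite aw invg1 act1.
rewrite fw; split=> [[_ nb]|lt0]; first by apply: (proj2 (sgn _ i)); rewrite aw.
split=> //; case: (root_sign coxWS (root_act coxWS w^-1%g (proj1 pb))) => // pb'.
have := proj1 (sgn (x^-1 * w)%g i); rewrite aw => /(_ pb') gt0.
by have := lt_trans lt0 gt0; rewrite ltxx.
Qed.

(* [z] is the infinite word whose prefixes run along the multiples of a translation of the
   coroot lattice that is negative on [A]. *)
Let negative_cover p (A : set 'rV[R]_d) u : alcove Delta theta p -> A `<=` Psi ->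
  A !=set0 -> (forall a, A a -> dot u a < 0) ->
  exists z : Wbar R m s, forall b a k, pos b -> A a ->
    (forall w, N w b <-> f a k (phi w p) < 0) -> Nbar z b.
Proof.
move=> pA AP [a0 Aa0] uA.
have [la [Wla laA]] := coroot_lattice_negative rootPsi simplePsi AP uA.
have [x xE] : exists x, phi x = (fun v => v + la).
  have [x _ xE] : range phi (fun v => v + la) by rewrite phi_range.
  by exists x.
pose t k := (x ^+ k)%g.
have tE k v : phi (t k) v = v + k%:R *: la.
  elim: k v => [|k IH] v; first by rewrite /t expg0 phi1 scale0r addr0.
  by rewrite /t expgS phiM /= IH xE -addrA -[in RHS]natr1 scalerDl scale1r.
(* Along multiples of [la] an affine function is affine in [k]; positive at the start and negative
   at [k], it stays negative. *)
have tS k : N (t k) `<=` N (t k.+1).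
  move=> b Nb; have pb : pos b by case: Nb.
  have [a [k' [Pa b0 bP]]] := inv_set_affine pA pb.
  apply/bP; move/bP: Nb b0; rewrite !tE /f !dotDl !dotZl -natr1 => h1 h2.
  have k0 : 0 <= k%:R :> R by [].
  by nra.
have tneq k : t k <> t k.+1.
  move=> E; have := congr1 (fun w => phi w 0) E; rewrite /= !tE !add0r => /eqP.
  rewrite -subr_eq0 -scalerBl scaler_eq0 => /orP[|/eqP la0].
    by rewrite -natr1 opprD addrA subrr sub0r oppr_eq0 oner_eq0.
  by have := laA _ Aa0; rewrite la0 dot0l ltxx.
have [q red qE] := inv_set_chain coxWS infW tS tneq.
exists (bar_of_seq R m red) => b a k pb Aa bP; rewrite inv_set_bar_of_seq qE.
have [K KE] : exists K : nat, f a k p < K%:R * - dot la a.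
  have la0 : 0 < - dot la a by rewrite oppr_gt0 laA.
  exists (Num.bound `|f a k p / - dot la a|); rewrite -ltr_pdivrMr //.
  by apply: le_lt_trans (ler_norm _) (archi_boundP (normr_ge0 _)).
exists K => //; apply/bP; move: KE; rewrite tE /f dotDl dotZl; lra.
Qed.

Lemma affine_finite_maximal : finite_set [set z : Wbar R m s | weak_maximal z].
Proof.
have [p pA] := alcove_exists simplePsi highestPsi.
have [[finPsi _] _ _ _ _] := rootPsi.
pose A (z : Wbar R m s) := Psi `&` [set a | exists b k,
  [/\ Nbar z b, 0 < f a k p & forall w, N w b <-> f a k (phi w p) < 0]].
have cover (z : Wbar R m s) : weak_maximal z -> A z !=set0 /\
    (exists u, forall a, A z a -> dot u a < 0) /\
    forall b, Nbar z b -> pos b /\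
      exists a k, A z a /\ forall w, N w b <-> f a k (phi w p) < 0.
  move=> zmax; have [q [red zE]] := weak_maximal_seq coxWS infW zmax.
  have NE : Nbar z = @inv_set_seq R n m W s q by rewrite zE inv_set_bar_of_seq.
  have walls_of b : Nbar z b -> pos b /\
      exists a k, A z a /\ forall w, N w b <-> f a k (phi w p) < 0.
    move=> zb; have pb : pos b by move: zb; rewrite NE => -[k _ []].
    split=> //; have [a [k [Pa a0 aP]]] := inv_set_affine pA pb.
    by exists a, k; split=> //; split=> //; exists b, k.
  split.
    apply: contrapT => A0; apply: (inv_set_seq_not_sub coxWS (R := R) (x := 1%g) red) => b.
    rewrite -NE => /walls_of[_ [a [k [Aa _]]]]; by case: A0; exists a.
  split=> //.
  (* One inversion is chosen for each direction; these are finitely many, so a single prefix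
     contains them all. *)
  have /choice[g gP] : forall a, exists b, A z a -> exists k,
      [/\ Nbar z b, 0 < f a k p & forall w, N w b <-> f a k (phi w p) < 0].
    move=> a; have [[_ [b [k h]]]|nA] := pselect (A z a); last by exists 0.
    by exists b => _; exists k.
  have finA : finite_set (A z) by apply: sub_finite_set finPsi => a [].
  have [|K KN] := inv_set_seq_finite (R := R) coxWS red (finite_image g finA).
    by move=> _ [a Aa <-]; have [k [gz _ _]] := gP a Aa; rewrite -NE.
  (* Along this displacement of [p] each chosen affine function passes from positive to negative. *)
  exists (phi (word_prod s (mkseq q K)) p - p) => a Aa.
  have [k [_ a0 aP]] := gP a Aa; have /aP : N (word_prod s (mkseq q K)) (g a).
    by apply: KN; exists a.
  by move: a0; rewrite /f dotDl dotNl; lra.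
apply: (finite_set_inj (finite_powerset finPsi) (f := A)) => [z zmax a []//|z z' zmax zmax' AE].
have [A0 [[u uA] zA]] := cover z zmax; have [_ [_ zA']] := cover z' zmax'.
have [|t tP] := @negative_cover p (A z) u pA _ A0 uA; first by move=> a [].
(* [t] contains every positive root whose hyperplane has its direction in [A z], so it lies above
   [z] and [z'] alike. *)
have zt : t = z.
  apply: zmax => b /zA[pb [a [k [Aa aP]]]]; exact: tP pb Aa aP.
rewrite -zt; apply: zmax' => b /zA'[pb [a [k [Aa aP]]]].
by apply: tP pb _ aP; rewrite AE.
Qed.
End AffineMaximal.

(** * The two implications *)

Lemma affine_finite (R : realType) (n : nat) (m : 'M[nat]_n) (W : groupType)
    (s : 'I_n -> W) : coxeter_system m s -> infinite_set [set: W] ->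
  affine_coxeter R s -> finite_set [set z : Wbar R m s | weak_maximal z].
Proof.
move=> coxWS infW [d [Psi [Delta [theta [phi [[rP _] [sP hP] [phi_inj phiM] phi_range phi_s]]]]]].
exact: (affine_finite_maximal coxWS infW rP sP hP phi_inj phiM phi_range phi_s).
Qed.

Lemma affine_of_finite_maximal (R : realType) (n : nat) (m : 'M[nat]_n) (W : groupType)
    (s : 'I_n -> W) : coxeter_system m s -> irreducible_coxeter m ->
  infinite_set [set: W] -> finite_set [set z : Wbar R m s | weak_maximal z] ->
  affine_coxeter R s.
Proof.
move=> coxWS irr infW fin; have cox : coxeter_matrix m by case: coxWS.
have [mu [v [v0 vE mule iso]]] := @perron_frobenius R n m cox irr.
have n0 : (0 < n)%N by case: irr.
have dotv i : dot v (simple_root R i) = v 0 i.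
  rewrite dotE (bigD1 i) //= simple_rootE eqxx mulr1 big1 ?addr0// => j ji.
  by rewrite simple_rootE (negbTE ji) mulr0.
case: (ltgtP mu 0) => [mu_lt0|mu_gt0|mu0].
- case: (@indefinite_infinite_maximal R n m W s coxWS v n0 infW v0) => // i.
  by rewrite vE dotv nmulr_rlt0.
- by case: infW; exact: (positive_definite_finite coxWS mu_gt0 n0 v0 vE mule).
case: n n0 m s coxWS irr cox fin v v0 vE mule iso dotv => // d _ m s coxWS irr cox fin.
move=> v v0 vE mule iso dotv.
have S0 : 0 < \sum_i v 0 i by rewrite (bigD1 ord0) //= ltr_pwDl // sumr_ge0 // => i _; exact: ltW.
(* Scaled to have height 1, since the affine value of the radical vector must be 1 for the height as
   base form. *)
pose de := (\sum_i v 0 i)^-1 *: v.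
have de0 i : 0 < de 0 i by rewrite mxE mulr_gt0 // invr_gt0.
have de1 : \sum_i de 0 i = 1.
  by under eq_bigr do rewrite mxE; rewrite -mulr_sumr mulVf // gt_eqF.
have der u : bform m de u = 0 by rewrite bformZl vE mu0 mul0r mulr0.
have psd (u : 'rV[R]_d.+1) : 0 <= bform m u u by have := mule u; rewrite mu0 mul0r.
have rad (u : 'rV[R]_d.+1) : bform m u u = 0 -> exists t, u = t *: de.
  move=> u0; have [|t tE] := iso u; first by rewrite mu0 mul0r.
  by exists (t * \sum_i v 0 i); rewrite tE scalerA -mulrA divff ?mulr1// gt_eqF.
have [P [BE deP Pker Pinv]] := euclidean_model cox de0 der psd rad.
exact: (semidefinite_affine coxWS irr infW der BE deP Pker Pinv de0 de1).
Qed.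

Theorem theorem3p16 (R : realType) (n : nat) (m : 'M[nat]_n) (W : groupType)
    (s : 'I_n -> W) (coxWS : coxeter_system m s)
    (irrWS : irreducible_coxeter m) (infW : infinite_set [set: W]) :
  affine_coxeter R s <->
  finite_set [set x : Wbar R m s | weak_maximal x].
Proof.
split; first exact: affine_finite.
exact: affine_of_finite_maximal.
Qed.
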